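(* For every integer $N\ge 0$, $$\frac{(-4)^N}{2\pi}\int_{-\infty}^{\infty} t^{2N}\left|\Gamma\!\left(\tfrac12+it\right)\zeta\!\left(\tfrac12+it\right)\right|^2dt \;=\; \log(2\pi)-\gamma-4N+\left(\frac{4^N}{2}-1\right)B_{2N}+\sum_{j=2}^{2N}T_{2N,j}\,\frac{\zeta(j)B_j}{j},$$ where for integers $M\ge 2$ and $j\ge 2$, $$T_{M,j}=(j-1)!\sum_{n=2}^{M}\binom{M}{n}2^n\Big[(-1)^nS(n+1,j)+(-1)^jS(n,j-1)\Big].$$
   Context: $\Gamma$ is the Euler Gamma function and $\zeta$ the Riemann zeta function (analytically continued); $\gamma$ is the Euler–Mascheroni constant. The Bernoulli numbers $B_n$ are defined by $\frac{t}{e^t-1}=\sum_{n\ge0}B_n\frac{t^n}{n!}$ ($|t|<2\pi$), so $B_0=1$, $B_1=-1/2$, $B_2=1/6$. $S(n,k)$ denotes the Stirling numbers of the second kind, defined by $x^n=\sum_{k=0}^nS(n,k)(x)_k$ with $(x)_k=x(x-1)\cdots(x-k+1)$, $(x)_0=1$; $S(n,k)=0$ if $k>n$ or $k<0$, $S(0,0)=1$, $S(n,0)=0$ for $n\ge1$. Empty sums (e.g. $\sum_{j=2}^{0}$) are $0$. *)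

(* Defs.v *)
From Stdlib Require Import Reals List Factorial Binomial.
From Coquelicot Require Import Coquelicot.
Open Scope R_scope.

(* finite sum  sum_{k=a}^{b} f k  (0 if b < a) *)
Definition sumR (a b : nat) (f : nat -> R) : R :=
  fold_right Rplus 0 (map f (seq a (S b - a))).

(* x^s = exp(s ln x) for real x > 0 and complex s *)
Definition cpow (x : R) (s : C) : C :=
  (exp (Re s * ln x) * cos (Im s * ln x), exp (Re s * ln x) * sin (Im s * ln x)).

Definition csum (a : nat -> C) : C :=
  (Series (fun n => Re (a n)), Series (fun n => Im (a n))).

Definition Gamma (s : C) : C :=
  (RInt_gen (fun x => Re (cpow x (s - 1)%C) * exp (- x))
            (at_right 0) (Rbar_locally p_infty),
   RInt_gen (fun x => Im (cpow x (s - 1)%C) * exp (- x))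
            (at_right 0) (Rbar_locally p_infty)).

(* Riemann zeta: Dirichlet series for Re s > 1; for 0 < Re s <= 1 (s not a zero of
   1 - 2^(1-s)) its analytic continuation via the Dirichlet eta function,
   zeta(s) = eta(s) / (1 - 2^(1-s)),  eta(s) = sum_{n>=1} (-1)^(n-1) n^(-s). *)
Definition eta (s : C) : C :=
  csum (fun n => Cmult (RtoC ((-1) ^ n)) (cpow (INR (S n)) (- s)%C)).

Definition zeta (s : C) : C :=
  if Rlt_dec 1 (Re s) then csum (fun n => cpow (INR (S n)) (- s)%C)
  else Cdiv (eta s) (Cminus (RtoC 1) (cpow 2 (Cminus (RtoC 1) s))).

Definition euler_gamma : R :=
  real (Lim_seq (fun n => sumR 1 n (fun k => / INR k) - ln (INR n))).

(* Bernoulli numbers via t/(e^t-1) = sum B_n t^n/n!  :  B_n = n-th derivative at 0 *)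
Definition bern_gf (t : R) : R := if Req_EM_T t 0 then 1 else t / (exp t - 1).
Definition Bernoulli (n : nat) : R := Derive_n bern_gf n 0.

Fixpoint stirling2 (n k : nat) : nat :=
  match n, k with
  | O, O => 1%nat
  | O, S _ => 0%nat
  | S _, O => 0%nat
  | S n', S k' => (S k' * stirling2 n' (S k') + stirling2 n' k')%nat
  end.

Definition T (M j : nat) : R :=
  INR (fact (j - 1)) *
  sumR 2 M (fun n => Binomial.C M n * 2 ^ n *
     ((-1) ^ n * INR (stirling2 (S n) j) + (-1) ^ j * INR (stirling2 n (j - 1)))).

(* Main.v *)
(* With [x = exp u], [Gamma s * zeta s] on the critical line is the Fourier transform of
   [exp (u / 2) * phi x], where [phi x = 1 / (exp x - 1) - 1 / x]: expanding
   [1 / (exp x + 1)] gives [Gamma s * eta s], and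
   [1 / (exp x + 1) = phi x - 2 phi (2 x)] produces the factor [1 - 2 ^ (1 - s)].
   By Plancherel the left-hand side becomes [int phi * (1 + 2 x d/dx)^(2N) phi dx].
   Since [(x d/dx)^n = sum_k S(n,k) x^k (d/dx)^k], it remains to integrate
   [x^k * phi^(k) * phi]. The Taylor expansion in [h] of the addition formula
   [h f(x) f(x+h) = h f(h) (f(x) - f(x+h)) - h f(x+h)] for [f x = 1 / (exp x - 1)]
   writes [f * f^(k)] as a combination of derivatives of [f] with Bernoulli coefficients.
   Repeated integration by parts then reduces each term to [int x^(j-1) f = (j-1)! zeta(j)]
   or to one integral equal to [(ln (2 PI) - gamma) / 2] by Stirling's formula.
   The remaining sums over Stirling numbers are computed from the recurrence of [S(n,k)]. *)
Require Import Defs.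
From Stdlib Require Import Reals List Lra Lia Wf_nat Factorial Binomial.
From Coquelicot Require Import Coquelicot.
Open Scope R_scope.

(** * Finite sums and Stirling numbers *)

(** All integrals are taken in the variable [u = ln x]: there dilations of [x] are shifts, [x d/dx]
    is [d/du], and one decay class, [tame], covers every integrand. The obstacle in the moments is
    that splitting [phi] into [f - 1/x] creates pieces whose integrals diverge. They are regrouped
    into the convergent [psi_gap], [kappa] and [chi], whose integrals give harmonic numbers, the
    constant and zeta values. Plancherel is obtained from two inequalities. Under the weight
    [exp (- e t)] the kernel becomes Poisson's; its positivity gives the upper bound and its total
    mass [PI], as [e] tends to 0, the lower one. On the arithmetic side, the moment of order [k] is
    [(-1)^k k!] times a combination of [1], [1/k], [1/(k+1)], [H_k] and binomials [C(k,r)]. Their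
    sums against [S(n,k)] are [(-1)^n], a term carried by [n = 1], [B_n], [(-1)^n n], and a multiple
    of [S(n+1,r+1)]. This is where [-4N], [B_{2N}] and the bracket in [T] come from. *)

Fixpoint bsum (n : nat) (F : nat -> R) : R :=
  match n with O => 0 | S m => bsum m F + F m end.

Lemma bsum_ext n F G :
  (forall i, (i < n)%nat -> F i = G i) -> bsum n F = bsum n G.
Proof.
  induction n as [|n IH]; intros H; simpl; [reflexivity|].
  rewrite IH by (intros; apply H; lia). rewrite H by lia. reflexivity.
Qed.

Lemma bsum_plus n F G : bsum n (fun i => F i + G i) = bsum n F + bsum n G.
Proof. induction n as [|n IH]; simpl; [|rewrite IH]; ring. Qed.

Lemma bsum_scal n a F : bsum n (fun i => a * F i) = a * bsum n F.
Proof. induction n as [|n IH]; simpl; [|rewrite IH]; ring. Qed.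

Lemma bsum_zero n F : (forall i, (i < n)%nat -> F i = 0) -> bsum n F = 0.
Proof.
  intros H. rewrite (bsum_ext n F (fun _ => 0 * 0)) by (intros; rewrite H by easy; ring).
  rewrite bsum_scal. ring.
Qed.

Lemma bsum_head n F : bsum (S n) F = F O + bsum n (fun i => F (S i)).
Proof.
  induction n as [|n IH]; [simpl; ring|].
  change (bsum (S (S n)) F) with (bsum (S n) F + F (S n)). rewrite IH. simpl. ring.
Qed.

Lemma bsum_switch n m (F : nat -> nat -> R) :
  bsum n (fun i => bsum m (fun j => F i j)) = bsum m (fun j => bsum n (fun i => F i j)).
Proof.
  induction n as [|n IH]; simpl.
  - symmetry. apply bsum_zero. reflexivity.
  - rewrite IH, <- bsum_plus. reflexivity.
Qed.

Lemma bsum_app n m F : bsum (n + m) F = bsum n F + bsum m (fun i => F (n + i)%nat).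
Proof.
  induction m as [|m IH]; simpl.
  - rewrite Nat.add_0_r. ring.
  - rewrite Nat.add_succ_r. simpl. rewrite IH. ring.
Qed.

Lemma sumR_bsum a b f : sumR a b f = bsum (S b - a) (fun i => f (a + i)%nat).
Proof.
  unfold sumR. generalize (S b - a)%nat as n. intros n; revert a.
  induction n as [|n IH]; intros a; [reflexivity|].
  rewrite bsum_head. cbn [List.seq List.map fold_right].
  rewrite IH, Nat.add_0_r. f_equal. apply bsum_ext. intros. f_equal. lia.
Qed.

(** One step of Pascal's rule under the sum, shared by the Leibniz rule and the binomial transforms
    below. The end terms are split off because [Binomial.C n i] does not vanish for [i > n]. *)
Lemma bsum_pascal n (a : nat -> R) :
  bsum (S (S n)) (fun i => Binomial.C (S n) i * a i)
  = bsum (S n) (fun i => Binomial.C n i * (a i + a (S i))).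
Proof.
  assert (HC0 : forall m, Binomial.C m 0 = 1).
  { intros m. unfold Binomial.C. rewrite Nat.sub_0_r. simpl (fact 0). rewrite Rmult_1_l.
    apply Rinv_r. apply INR_fact_neq_0. }
  assert (HCn : forall m, Binomial.C m m = 1).
  { intros m. unfold Binomial.C. rewrite Nat.sub_diag. simpl (fact 0). rewrite Rmult_1_r.
    apply Rinv_r. apply INR_fact_neq_0. }
  rewrite bsum_head.
  rewrite (bsum_ext (S n) (fun i => Binomial.C n i * (a i + a (S i)))
    (fun i => Binomial.C n i * a i + Binomial.C n i * a (S i))) by (intros; ring).
  rewrite bsum_plus.
  change (bsum (S n) (fun i => Binomial.C (S n) (S i) * a (S i)))
    with (bsum n (fun i => Binomial.C (S n) (S i) * a (S i)) + Binomial.C (S n) (S n) * a (S n)).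
  rewrite (bsum_ext n _ (fun i => Binomial.C n (S i) * a (S i) + Binomial.C n i * a (S i))).
  2:{ intros i Hi. rewrite <- pascal by easy. ring. }
  rewrite bsum_plus.
  rewrite (bsum_head n (fun i => Binomial.C n i * a i)).
  change (bsum (S n) (fun i => Binomial.C n i * a (S i)))
    with (bsum n (fun i => Binomial.C n i * a (S i)) + Binomial.C n n * a (S n)).
  rewrite !HC0, !HCn. ring.
Qed.

(** * Sums against Stirling numbers and their binomial transforms *)

Lemma INR_S_pos n : 0 < INR (S n).
Proof. apply lt_0_INR. lia. Qed.

Lemma pow_m1_sqr k : (-1) ^ k * (-1) ^ k = 1.
Proof. rewrite <- Rpow_mult_distr. replace (-1 * -1) with 1 by ring. apply pow1. Qed.

(** For [c k = x^k f^(k)(x)] this is [(x d/dx)^n f]. *)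
Definition Sfun (n : nat) (c : nat -> R) : R :=
  bsum (S n) (fun k => INR (stirling2 n k) * c k).

Lemma stirling2_gt n k : (n < k)%nat -> stirling2 n k = O.
Proof.
  revert k; induction n as [|n IH]; intros [|k] H; simpl; try lia.
  rewrite !IH by lia. lia.
Qed.

Lemma Sfun_ext n c d : (forall k, (k <= n)%nat -> c k = d k) -> Sfun n c = Sfun n d.
Proof. intros H. apply bsum_ext. intros k Hk. rewrite H by lia. reflexivity. Qed.

Lemma Sfun_plus n c d : Sfun n (fun k => c k + d k) = Sfun n c + Sfun n d.
Proof.
  unfold Sfun. rewrite <- bsum_plus. apply bsum_ext. intros. ring.
Qed.

Lemma Sfun_scal n a c : Sfun n (fun k => a * c k) = a * Sfun n c.
Proof.
  unfold Sfun. rewrite <- bsum_scal. apply bsum_ext. intros. ring.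
Qed.

(** The recurrence of [S(n,k)] transposed onto the sequence. It mirrors [x d/dx (x^k f^(k)) = k x^k
    f^(k) + x^(k+1) f^(k+1)]. *)
Lemma Sfun_S n c : Sfun (S n) c = Sfun n (fun k => INR k * c k + c (S k)).
Proof.
  unfold Sfun. rewrite bsum_head. change (stirling2 (S n) 0) with 0%nat.
  rewrite (bsum_ext (S n) (fun i => INR (stirling2 (S n) (S i)) * c (S i))
    (fun i => INR (stirling2 n (S i)) * (INR (S i) * c (S i)) + INR (stirling2 n i) * c (S i))).
  2:{ intros i _. change (stirling2 (S n) (S i))
        with (S i * stirling2 n (S i) + stirling2 n i)%nat.
      rewrite plus_INR, mult_INR. ring. }
  rewrite bsum_plus.
  rewrite (bsum_ext (S n) (fun k => INR (stirling2 n k) * (INR k * c k + c (S k)))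
    (fun i => INR (stirling2 n i) * (INR i * c i) + INR (stirling2 n i) * c (S i))) by (intros; ring).
  rewrite bsum_plus.
  assert (H := bsum_head (S n) (fun i => INR (stirling2 n i) * (INR i * c i))).
  change (bsum (S (S n)) ?F) with (bsum (S n) F + F (S n)) in H. cbv beta in H.
  rewrite (stirling2_gt n (S n)) in H by lia.
  change (INR 0) with 0 in *. lra.
Qed.

(* Coefficients in the basis [(-1)^k k!] turn the recurrence [Sfun_S] into [d_k -> k d_k - (k+1) d_{k+1}]. *)
Definition alt (d : nat -> R) (k : nat) : R := (-1) ^ k * INR (fact k) * d k.

Lemma Sfun_alt_S n d :
  Sfun (S n) (alt d) = Sfun n (alt (fun k => INR k * d k - INR (S k) * d (S k))).
Proof.
  rewrite Sfun_S. apply Sfun_ext. intros k _. unfold alt.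
  rewrite fact_simpl, mult_INR, <- tech_pow_Rmult. ring.
Qed.

Lemma Sfun_alt_plus n d e :
  Sfun n (alt (fun k => d k + e k)) = Sfun n (alt d) + Sfun n (alt e).
Proof. rewrite <- Sfun_plus. apply Sfun_ext. intros. unfold alt. ring. Qed.

Lemma Sfun_alt_scal n a d :
  Sfun n (alt (fun k => a * d k)) = a * Sfun n (alt d).
Proof. rewrite <- Sfun_scal. apply Sfun_ext. intros. unfold alt. ring. Qed.

Lemma Sfun_alt_ext n d e :
  (forall k, (k <= n)%nat -> d k = e k) -> Sfun n (alt d) = Sfun n (alt e).
Proof. intros H. apply Sfun_ext. intros. unfold alt. rewrite H by easy. reflexivity. Qed.

(** The constant sequence is an eigenvector of the recurrence, with eigenvalue -1; it corresponds to
    [f = 1/x]. *)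
Lemma Sfun_alt_1 n : Sfun n (alt (fun _ => 1)) = (-1) ^ n.
Proof.
  induction n as [|n IH]; [unfold Sfun, alt; simpl; ring|].
  rewrite Sfun_alt_S.
  rewrite (Sfun_alt_ext n _ (fun _ => (-1) * 1)) by (intros; rewrite S_INR; ring).
  rewrite Sfun_alt_scal, IH. reflexivity.
Qed.

Definition harm (n : nat) : R := bsum n (fun k => / INR (S k)).

(** Since [(k+1) H_{k+1} = (k+1) H_k + 1], the recurrence sends [harm] to [- harm - 1]: a Jordan
    block over the eigenvector 1, whence the factor [n]. *)
Lemma Sfun_alt_harm n : Sfun n (alt harm) = (-1) ^ n * INR n.
Proof.
  induction n as [|n IH]; [unfold Sfun, alt, harm; simpl; ring|].
  rewrite Sfun_alt_S.
  rewrite (Sfun_alt_ext n _ (fun k => (-1) * harm k + (-1) * 1)).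
  - rewrite Sfun_alt_plus, !Sfun_alt_scal, IH, Sfun_alt_1. rewrite S_INR. simpl. ring.
  - intros k _. change (harm (S k)) with (harm k + / INR (S k)).
    assert (INR (S k) <> 0) by (apply not_0_INR; lia).
    rewrite Rmult_plus_distr_l, Rinv_r by easy. rewrite S_INR. ring.
Qed.

(** One step of the recurrence gives [k/k - (k+1)/(k+1) = 0] for [k >= 1], and the entry at [k = 0]
    is killed by [S(n,0) = 0]. The value at [n = 0] is left as [/ INR 0], which later evaluates to 0
    by [Rinv_0]. *)
Lemma Sfun_alt_inv n :
  Sfun n (alt (fun k => / INR k)) =
  match n with O => / INR 0 | S O => -1 | _ => 0 end.
Proof.
  destruct n as [|[|n]].
  - unfold Sfun, alt. simpl. ring.
  - unfold Sfun, alt. simpl. rewrite Rinv_1. ring.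
  - rewrite Sfun_alt_S. unfold Sfun. apply bsum_zero. intros [|k] _.
    + simpl. ring.
    + unfold alt. rewrite !Rinv_r by (apply not_0_INR; lia). ring.
Qed.

(* [binom k r], vanishing for [r > k] (unlike [Binomial.C]). *)
Fixpoint binom (k r : nat) : nat :=
  match k, r with
  | _, O => 1
  | O, S _ => 0
  | S k', S r' => binom k' r' + binom k' (S r')
  end.

Lemma binom_gt k r : (k < r)%nat -> binom k r = 0%nat.
Proof.
  revert r; induction k as [|k IH]; intros [|r] H; simpl; try lia. rewrite !IH; lia.
Qed.

Lemma binom_diag k : binom k k = 1%nat.
Proof. induction k as [|k IH]; [reflexivity|]. simpl. rewrite IH, binom_gt; lia. Qed.

Lemma binom_1 n : binom n 1 = n.
Proof.
  induction n as [|n IH]; [reflexivity|].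
  change (binom (S n) 1) with (binom n 0 + binom n 1)%nat. rewrite IH. destruct n; reflexivity.
Qed.

Lemma binom_C k r : (r <= k)%nat -> INR (binom k r) = Binomial.C k r.
Proof.
  revert r; induction k as [|k IH]; intros [|r] H; try lia.
  - unfold Binomial.C. simpl. field.
  - unfold Binomial.C. rewrite Nat.sub_0_r. simpl (binom _ _). simpl (fact 0).
    simpl (INR 1). field. apply INR_fact_neq_0.
  - destruct (Nat.eq_dec r k) as [->|Hn].
    + rewrite binom_diag. unfold Binomial.C. rewrite Nat.sub_diag. simpl (fact 0).
      simpl (INR 1). field. apply INR_fact_neq_0.
    + rewrite <- pascal by lia. simpl. rewrite plus_INR, !IH by lia. reflexivity.
Qed.

Lemma binom_absorb k r : (k * binom k r = r * binom k r + S r * binom k (S r))%nat.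
Proof.
  revert r; induction k as [|k IH]; intros [|r]; simpl (binom _ _); try lia.
  - assert (H := IH 0%nat). destruct k; simpl in *; lia.
  - assert (H1 := IH r). assert (H2 := IH (S r)). nia.
Qed.

(** The recurrence sends [C(k,r)] to [- (r+1) C(k,r) - r C(k,r-1)], which up to sign and [r!] is the
    recurrence of [S(n+1,r+1)]. This produces the first Stirling number in [T]. *)
Lemma Sfun_alt_binom n r :
  Sfun n (alt (fun k => INR (binom k r)))
  = (-1) ^ n * INR (fact r) * INR (stirling2 (S n) (S r)).
Proof.
  revert r; induction n as [|n IH]; intros r.
  - unfold Sfun, alt. simpl bsum. destruct r as [|r].
    + simpl. ring.
    + simpl. replace (r * 0 + 0)%nat with 0%nat by lia. simpl. ring.
  - rewrite Sfun_alt_S.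
    destruct r as [|r].
    + rewrite (Sfun_alt_ext n _ (fun k => (-1) * INR (binom k 0))).
      * rewrite Sfun_alt_scal, IH.
        assert (H1 : forall m, stirling2 (S m) 1 = 1%nat).
        { clear. induction m as [|m IHm]; [reflexivity|].
          change (stirling2 (S (S m)) 1) with (1 * stirling2 (S m) 1 + 0)%nat. lia. }
        rewrite !H1. simpl. ring.
      * intros k _. rewrite S_INR. destruct k; simpl; ring.
    + rewrite (Sfun_alt_ext n _ (fun k => (- INR (S (S r))) * INR (binom k (S r))
          + (- INR (S r)) * INR (binom k r))).
      * rewrite Sfun_alt_plus, !Sfun_alt_scal, !IH.
        change (stirling2 (S (S n)) (S (S r)))
          with (S (S r) * stirling2 (S n) (S (S r)) + stirling2 (S n) (S r))%nat.
        rewrite plus_INR, mult_INR, fact_simpl, mult_INR, <- tech_pow_Rmult. ring.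
      * intros k _. rewrite <- !mult_INR.
        rewrite (binom_absorb (S k) (S r)), (binom_absorb k (S r)).
        rewrite !plus_INR, !mult_INR. change (binom (S k) (S r)) with (binom k r + binom k (S r))%nat.
        change (binom (S k) (S (S r))) with (binom k (S r) + binom k (S (S r)))%nat.
        rewrite !plus_INR. rewrite !S_INR. ring.
Qed.

(** Let [D] be the step [c k -> k c k + c (k+1)] of [Sfun_S]. The left side is the entry at 0 of
    [(1 + D)^n c]. The map [c k -> c k + k c (k-1)] turns [1 + D] into [D] and preserves the entry
    at 0. *)
Lemma bsum_binom_Sfun n c :
  bsum (S n) (fun i => Binomial.C n i * Sfun i c)
  = Sfun n (fun k => c k + INR k * c (pred k)).
Proof.
  revert c; induction n as [|n IH]; intros c.
  - unfold Sfun, Binomial.C. simpl. field.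
  - rewrite bsum_pascal, Sfun_S.
    rewrite (bsum_ext (S n) _ (fun i => Binomial.C n i
       * Sfun i (fun k => c k + (INR k * c k + c (S k))))).
    2:{ intros i _. rewrite Sfun_S, <- Sfun_plus. reflexivity. }
    rewrite IH. apply Sfun_ext. intros [|k] _.
    + simpl. ring.
    + rewrite !Nat.pred_succ, !S_INR. ring.
Qed.

(** For [c k = (-1)^k k! / (k+1)] the extra term [k c (k-1)] of [bsum_binom_Sfun] is [- alt (1/k)],
    whose Stirling sum vanishes from order 2 on. So the sums satisfy the recurrence that determines
    the Bernoulli numbers. *)
Lemma Sfun_alt_bernoulli (B : nat -> R) :
  B O = 1 ->
  (forall n, (2 <= n)%nat -> bsum n (fun i => Binomial.C n i * B i) = 0) ->
  forall n, Sfun n (alt (fun k => / INR (S k))) = B n.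
Proof.
  intros HB0 HB n.
  induction n as [n IH] using (well_founded_induction Wf_nat.lt_wf).
  destruct n as [|n].
  { unfold Sfun, alt. simpl. rewrite HB0. field. }
  (* Order [n + 2] determines the value at [n + 1]: the term of index [n + 2] stands on both sides
     with coefficient 1 and cancels. *)
  assert (H := bsum_binom_Sfun (S (S n)) (alt (fun k => / INR (S k)))).
  rewrite Sfun_plus in H.
  rewrite (Sfun_ext (S (S n)) (fun k => INR k * _) (fun k => (-1) * alt (fun k => / INR k) k)) in H.
  2:{ intros [|k] _; [|].
      - unfold alt. simpl. rewrite Rinv_0. ring.
      - unfold alt. rewrite Nat.pred_succ, fact_simpl, mult_INR, <- tech_pow_Rmult.
        field. apply not_0_INR. lia. }
  rewrite Sfun_scal, Sfun_alt_inv in H.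
  assert (H2 := HB (S (S n)) ltac:(lia)).
  change (bsum (S (S (S n))) ?F) with (bsum (S n) F + F (S n) + F (S (S n))) in H.
  change (bsum (S (S n)) ?F) with (bsum (S n) F + F (S n)) in H2.
  cbv beta in H, H2.
  rewrite (bsum_ext (S n) _ (fun i => Binomial.C (S (S n)) i * B i)) in H
    by (intros; rewrite IH by easy; reflexivity).
  replace (Binomial.C (S (S n)) (S (S n))) with 1 in H.
  2:{ rewrite <- binom_C, binom_diag by lia. reflexivity. }
  assert (HC : Binomial.C (S (S n)) (S n) <> 0).
  { unfold Binomial.C. apply Rmult_integral_contrapositive_currified.
    - apply INR_fact_neq_0.
    - apply Rinv_neq_0_compat, Rmult_integral_contrapositive_currified; apply INR_fact_neq_0. }
  apply (Rmult_eq_reg_l (Binomial.C (S (S n)) (S n))); lra.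
Qed.

Lemma bsum_binom_pow M y : bsum (S M) (fun n => Binomial.C M n * y ^ n) = (1 + y) ^ M.
Proof.
  induction M as [|M IH]; [unfold Binomial.C; simpl; field|].
  rewrite bsum_pascal.
  rewrite (bsum_ext _ _ (fun i => (1 + y) * (Binomial.C M i * y ^ i))) by (intros; simpl; ring).
  rewrite bsum_scal, IH. simpl. ring.
Qed.

(** This is [y d/dy] of the binomial theorem, multiplied by [1 + y] to avoid the exponent
    [M - 1]. *)
Lemma bsum_binom_pow_n M y :
  bsum (S M) (fun n => Binomial.C M n * (y ^ n * INR n)) * (1 + y) = INR M * y * (1 + y) ^ M.
Proof.
  induction M as [|M IH]; [unfold Binomial.C; simpl; field|].
  rewrite bsum_pascal.
  rewrite (bsum_ext _ _ (fun i => (1 + y) * (Binomial.C M i * (y ^ i * INR i))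
    + y * (Binomial.C M i * y ^ i))) by (intros; rewrite S_INR; simpl; ring).
  rewrite bsum_plus, !bsum_scal, bsum_binom_pow, Rmult_plus_distr_r, Rmult_assoc, IH, S_INR.
  simpl. ring.
Qed.

(** * Bernoulli numbers and the function phi *)

(** [F n] is the n-th derivative of [F 0] on [U]. As a property of explicit sequences it lets
    [dseq_unique] turn a functional identity between closed forms into identities for all
    derivatives, in particular for the Taylor coefficients at 0. *)
Definition dseq (U : R -> Prop) (F : nat -> R -> R) : Prop :=
  forall n x, U x -> is_derive (F n) x (F (S n) x).

Lemma ex_derive_cont (f : R -> R) x : ex_derive f x -> continuous f x.
Proof. apply (@ex_derive_continuous _ R_NormedModule). Qed.

Lemma is_derive_cont (f g : R -> R) :
  (forall x, is_derive f x (g x)) -> forall x, continuous f x.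
Proof. intros H x. apply ex_derive_cont. exists (g x). apply H. Qed.

Lemma is_derive_mul (f g : R -> R) x df dg :
  is_derive f x df -> is_derive g x dg -> is_derive (fun y => f y * g y) x (df * g x + f x * dg).
Proof. intros H1 H2. apply @is_derive_mult; [easy|easy|exact Rmult_comm]. Qed.

Lemma dseq_unique U F G :
  open U -> dseq U F -> dseq U G -> (forall x, U x -> F O x = G O x) ->
  forall n x, U x -> F n x = G n x.
Proof.
  intros HU HF HG H0 n. induction n as [|n IH]; [exact H0|].
  intros x Hx. rewrite <- (is_derive_unique _ _ _ (HF n x Hx)).
  rewrite <- (is_derive_unique _ _ _ (HG n x Hx)).
  apply Derive_ext_loc. generalize (HU x Hx). apply filter_imp. exact IH.
Qed.

Lemma is_derive_bsum n (F : nat -> R -> R) (dF : nat -> R) x :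
  (forall i, (i < n)%nat -> is_derive (F i) x (dF i)) ->
  is_derive (fun y => bsum n (fun i => F i y)) x (bsum n dF).
Proof.
  induction n as [|n IH]; intros H; simpl.
  - apply @is_derive_const.
  - apply @is_derive_plus; [apply IH; intros; apply H; lia|apply H; lia].
Qed.

Lemma dseq_mult U F G :
  dseq U F -> dseq U G ->
  dseq U (fun n x => bsum (S n) (fun i => Binomial.C n i * (F i x * G (n - i)%nat x))).
Proof.
  intros HF HG n x Hx.
  rewrite (bsum_pascal n (fun i => F i x * G (S n - i)%nat x)).
  apply (is_derive_bsum (S n) (fun i y => Binomial.C n i * (F i y * G (n - i)%nat y))).
  intros i Hi.
  apply is_derive_scal.
  replace (F i x * G (S n - i)%nat x + F (S i) x * G (S n - S i)%nat x)
    with (F (S i) x * G (n - i)%nat x + F i x * G (S (n - i)) x).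
  - apply is_derive_mul; [apply HF, Hx|apply HG, Hx].
  - rewrite Nat.sub_succ_l by lia. simpl. ring.
Qed.

Lemma dseq_id_mult U F :
  dseq U F -> dseq U (fun n x => x * F n x + INR n * F (pred n) x).
Proof.
  intros HF n x Hx.
  evar_last.
  - apply @is_derive_plus.
    + apply is_derive_mul; [apply @is_derive_id|apply HF, Hx].
    + apply is_derive_scal. apply HF, Hx.
  - unfold plus, mult, one; simpl. destruct n as [|n]; rewrite ?S_INR; simpl; ring.
Qed.

Lemma dseq_exp : dseq (fun _ => True) (fun _ => exp).
Proof. intros n x _. apply is_derive_exp. Qed.

Lemma dseq_comp_lin a c (U V : R -> Prop) F :
  dseq U F -> (forall x, V x -> U (a * x + c)) ->
  dseq V (fun n x => a ^ n * F n (a * x + c)).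
Proof.
  intros HF HV n x Hx.
  evar_last.
  - apply is_derive_scal. apply (is_derive_comp (F n) (fun y => a * y + c)).
    + apply HF, HV, Hx.
    + auto_derive; [trivial|reflexivity].
  - unfold scal; simpl. unfold mult; simpl. ring.
Qed.

Definition exp_coef (n : nat) : R := / INR (fact n).
(** [E1] and [E2] are the entire functions [(exp x - 1) / x] and [(exp x - 1 - x) / x^2]; as power
    series they need no special value at 0. *)
Definition E1 : R -> R := PSeries (PS_decr_1 exp_coef).
Definition E2 : R -> R := PSeries (PS_decr_1 (PS_decr_1 exp_coef)).

Lemma CV_radius_exp_coef : CV_radius exp_coef = p_infty.
Proof.
  apply CV_radius_infinite_DAlembert.
  - intros n. apply Rinv_neq_0_compat, INR_fact_neq_0.
  - apply (is_lim_seq_ext (fun n => / INR (S n))).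
    + intros n. unfold exp_coef. rewrite fact_simpl, mult_INR.
      replace (/ (INR (S n) * INR (fact n)) / / INR (fact n)) with (/ INR (S n)).
      * symmetry. apply Rabs_pos_eq. left. apply Rinv_0_lt_compat, lt_0_INR. lia.
      * field. split; [apply INR_fact_neq_0|apply not_0_INR; lia].
    + apply (is_lim_seq_incr_1 (fun n => / INR n)).
      replace (Finite 0) with (Rbar_inv p_infty) by reflexivity.
      apply is_lim_seq_inv; [apply is_lim_seq_INR|discriminate].
Qed.

Lemma exp_E1 x : exp x = 1 + x * E1 x.
Proof.
  rewrite exp_Reals. change (fun n => / INR (fact n)) with exp_coef.
  rewrite PSeries_decr_1.
  - f_equal. unfold exp_coef. simpl. apply Rinv_1.
  - apply CV_radius_inside. rewrite CV_radius_exp_coef. exact I.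
Qed.

Lemma E1_E2 x : E1 x = 1 + x * E2 x.
Proof.
  unfold E1. rewrite PSeries_decr_1.
  - f_equal. unfold PS_decr_1, exp_coef. simpl. apply Rinv_1.
  - apply CV_radius_inside. rewrite CV_radius_decr_1, CV_radius_exp_coef. exact I.
Qed.

Lemma E1_pos x : 0 < E1 x.
Proof.
  assert (H := exp_E1 x).
  destruct (Rtotal_order x 0) as [Hx|[->|Hx]].
  - assert (exp x < 1) by (rewrite <- exp_0; apply exp_increasing; easy). nra.
  - rewrite E1_E2. lra.
  - assert (1 < exp x) by (rewrite <- exp_0; apply exp_increasing; easy). nra.
Qed.

(* Closed under derivation, hence made of smooth functions. *)
Inductive smooth_alg : (R -> R) -> Prop :=
| sa_series a : CV_radius a = p_infty -> smooth_alg (PSeries a)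
| sa_inv : smooth_alg (fun x => / E1 x)
| sa_opp F : smooth_alg F -> smooth_alg (fun x => - F x)
| sa_plus F G : smooth_alg F -> smooth_alg G -> smooth_alg (fun x => F x + G x)
| sa_mult F G : smooth_alg F -> smooth_alg G -> smooth_alg (fun x => F x * G x).

Lemma smooth_alg_derive F :
  smooth_alg F -> exists G, smooth_alg G /\ forall x, is_derive F x (G x).
Proof.
  assert (HPS : forall a, CV_radius a = p_infty ->
    smooth_alg (PSeries (PS_derive a)) /\
    forall x, is_derive (PSeries a) x (PSeries (PS_derive a) x)).
  { intros a Ha. split.
    - apply sa_series. rewrite CV_radius_derive. exact Ha.
    - intros x. apply is_derive_PSeries. rewrite Ha. exact I. }
  induction 1 as [a Ha| |F HF [F' [HF' HdF]]|F G HF [F' [HF' HdF]] HG [G' [HG' HdG]]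
                 |F G HF [F' [HF' HdF]] HG [G' [HG' HdG]]].
  - exists (PSeries (PS_derive a)). apply HPS, Ha.
  - assert (Ha : CV_radius (PS_decr_1 exp_coef) = p_infty).
    { rewrite CV_radius_decr_1. apply CV_radius_exp_coef. }
    destruct (HPS _ Ha) as [H1 H2].
    exists (fun x => - (PSeries (PS_derive (PS_decr_1 exp_coef)) x * (/ E1 x * / E1 x))).
    split.
    + apply sa_opp, sa_mult; [exact H1|apply sa_mult; apply sa_inv].
    + intros x. evar_last.
      * apply is_derive_inv; [apply H2|]. apply Rgt_not_eq, E1_pos.
      * unfold E1. field. apply Rgt_not_eq, E1_pos.
  - exists (fun x => - F' x). split; [apply sa_opp, HF'|].
    intros x. apply @is_derive_opp, HdF.
  - exists (fun x => F' x + G' x). split; [apply sa_plus; easy|].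
    intros x. apply @is_derive_plus; easy.
  - exists (fun x => F' x * G x + F x * G' x).
    split; [apply sa_plus; apply sa_mult; easy|].
    intros x. apply is_derive_mul; easy.
Qed.

Lemma smooth_alg_dseq F : smooth_alg F -> dseq (fun _ => True) (Derive_n F).
Proof.
  intros HF.
  assert (H : forall n, exists G, smooth_alg G /\ forall x, Derive_n F n x = G x).
  { induction n as [|n [G [HG H]]]; [exists F; easy|].
    destruct (smooth_alg_derive G HG) as [G' [HG' HdG]].
    exists G'. split; [easy|]. intros x. simpl.
    rewrite (Derive_ext _ G) by easy. apply is_derive_unique, HdG. }
  intros n x _. apply Derive_correct.
  destruct (H n) as [G [HG HE]]. destruct (smooth_alg_derive G HG) as [G' [HG' HdG]].
  apply (ex_derive_ext G); [intros; symmetry; apply HE|]. exists (G' x). apply HdG.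
Qed.

(* The smooth extension to the whole line of [1 / (exp x - 1) - 1 / x]. *)
Definition phi (n : nat) : R -> R := Derive_n (fun x => - (E2 x * / E1 x)) n.

Lemma phi_dseq : dseq (fun _ => True) phi.
Proof.
  apply smooth_alg_dseq. apply sa_opp, sa_mult; [|apply sa_inv].
  apply sa_series. rewrite !CV_radius_decr_1. apply CV_radius_exp_coef.
Qed.

Lemma phi_continuous n x : continuous (phi n) x.
Proof. apply ex_derive_cont. eexists. apply phi_dseq. exact I. Qed.

Lemma exp_neq_1 x : x <> 0 -> exp x - 1 <> 0.
Proof.
  intros H. assert (H1 := E1_pos x). rewrite exp_E1.
  replace (1 + x * E1 x - 1) with (x * E1 x) by ring.
  apply Rmult_integral_contrapositive_currified; lra.
Qed.

Lemma phi_0 x : x <> 0 -> phi 0 x = / (exp x - 1) - / x.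
Proof.
  intros H. unfold phi. simpl. rewrite exp_E1.
  assert (H1 := E1_pos x). assert (H2 := E1_E2 x).
  replace (E2 x) with ((E1 x - 1) / x) by (rewrite H2; field; easy).
  field. repeat split; nra.
Qed.

Lemma phi_0_0 : phi 0 0 = - / 2.
Proof.
  unfold phi. simpl. rewrite E1_E2.
  replace (E2 0) with (/ 2); [field|].
  unfold E2. rewrite PSeries_0. unfold PS_decr_1, exp_coef. simpl. field.
Qed.

(** The n-th derivative of [1 + x phi(x) = x / (exp x - 1)], the generating function of the
    Bernoulli numbers. *)
Definition bern (n : nat) (x : R) : R :=
  (if n then 1 else 0) + (x * phi n x + INR n * phi (pred n) x).

Lemma bern_dseq : dseq (fun _ => True) bern.
Proof.
  intros n x Hx. evar_last.
  - apply @is_derive_plus; [apply @is_derive_const|].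
    apply (dseq_id_mult _ _ phi_dseq n x Hx).
  - unfold bern, plus, zero; simpl. ring.
Qed.

Lemma bern_0 x : bern 0 x = / E1 x.
Proof.
  unfold bern, phi. simpl. assert (H := E1_pos x). assert (H2 := E1_E2 x).
  apply (Rmult_eq_reg_r (E1 x)); [|lra]. rewrite Rinv_l by lra.
  replace ((1 + (x * - (E2 x * / E1 x) + 0 * - (E2 x * / E1 x))) * E1 x) with (E1 x - x * E2 x)
    by (field; lra). lra.
Qed.

Lemma Bernoulli_bern n : Bernoulli n = bern n 0.
Proof.
  unfold Bernoulli.
  assert (H0 : forall x, bern_gf x = bern 0 x).
  { intros x. rewrite bern_0. unfold bern_gf. destruct (Req_EM_T x 0) as [->|Hx].
    - rewrite E1_E2. field.
    - rewrite exp_E1. assert (H := E1_pos x). field. split; nra. }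
  rewrite (Derive_n_ext _ (bern 0)) by exact H0.
  generalize 0. induction n as [|n IH]; intros x; [reflexivity|].
  simpl. rewrite (Derive_ext _ _ _ IH). apply is_derive_unique, bern_dseq. exact I.
Qed.

Lemma Bernoulli_phi n : Bernoulli (S n) = INR (S n) * phi n 0.
Proof. rewrite Bernoulli_bern. unfold bern. simpl pred. ring. Qed.

Lemma Bernoulli_0 : Bernoulli 0 = 1.
Proof. rewrite Bernoulli_bern, bern_0, E1_E2. field. Qed.

Lemma open_True : open (fun _ : R => True).
Proof. apply open_true. Qed.

(** With [b x = x / (exp x - 1)], differentiate [b(x) exp x = b(x) + x] at 0. For [n >= 2] the
    summand [x] disappears, and the last term of the Leibniz sum cancels the right side. *)
Lemma Bernoulli_rec n :
  (2 <= n)%nat -> bsum n (fun i => Binomial.C n i * Bernoulli i) = 0.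
Proof.
  intros Hn.
  assert (Hid : dseq (fun _ => True) (fun n x => match n with O => x | 1%nat => 1 | _ => 0 end)).
  { intros [|[|m]] x _; [apply @is_derive_id|apply @is_derive_const|apply @is_derive_const]. }
  assert (Hr : dseq (fun _ => True) (fun n x => bern n x +
                match n with O => x | 1%nat => 1 | _ => 0 end)).
  { intros m x Hx. apply @is_derive_plus; [apply bern_dseq|apply Hid]; easy. }
  assert (H := dseq_unique _ _ _ open_True (dseq_mult _ _ _ bern_dseq dseq_exp) Hr).
  assert (H2 := H ltac:(intros x _; clear; unfold Binomial.C; simpl; rewrite bern_0, exp_E1;
     assert (H := E1_pos x); field; lra) n 0 I).
  cbv beta in H2. rewrite exp_0 in H2.
  destruct n as [|[|n]]; try lia.
  change (bsum (S (S (S n))) ?F) with (bsum (S (S n)) F + F (S (S n))) in H2. cbv beta in H2.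
  rewrite (bsum_ext _ _ (fun i => Binomial.C (S (S n)) i * Bernoulli i)) in H2
    by (intros; rewrite Bernoulli_bern; ring).
  rewrite <- (binom_C (S (S n)) (S (S n))), binom_diag in H2 by lia. simpl (INR 1) in H2. lra.
Qed.

(** Comes from [b(2x) exp x = 2 b(x) - b(2x)] for [b x = x / (exp x - 1)]. Multiplied by [-1/2] it
    is the Bernoulli term [(4^N/2 - 1) B_{2N}] of the theorem. *)
Lemma Bernoulli_double M :
  bsum (S M) (fun i => Binomial.C M i * (2 ^ i * Bernoulli i)) = (2 - 2 ^ M) * Bernoulli M.
Proof.
  assert (Hb2 := dseq_comp_lin 2 0 (fun _ => True) (fun _ => True) _ bern_dseq (fun _ _ => I)).
  assert (Hr : dseq (fun _ => True) (fun n x => 2 * bern n x - 2 ^ n * bern n (2 * x + 0))).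
  { intros m x Hx. apply @is_derive_minus; [apply is_derive_scal, bern_dseq|apply Hb2]; easy. }
  assert (H := dseq_unique _ _ _ open_True (dseq_mult _ _ _ Hb2 dseq_exp) Hr).
  simpl in H. lapply H; clear H; [intros H|].
  - specialize (H M 0 I). cbv beta in H.
    rewrite !Bernoulli_bern. replace (2 * 0 + 0) with 0 in H by ring.
    rewrite exp_0 in H. simpl. rewrite Bernoulli_bern.
    rewrite (bsum_ext _ _ (fun i => Binomial.C M i * (2 ^ i * Bernoulli i))) in H
      by (intros; rewrite Bernoulli_bern; ring). lra.
  - intros x _. rewrite Rplus_0_r, !bern_0. unfold Binomial.C. simpl.
    destruct (Req_dec x 0) as [->|Hx].
    + rewrite Rmult_0_r, exp_0, (E1_E2 0). field.
    + assert (H1 := E1_pos x). assert (H2 := E1_pos (2 * x)).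
      assert (H3 := exp_E1 x). assert (H4 := exp_E1 (2 * x)).
      replace (2 * x) with (x + x) in H4 at 1 by ring. rewrite exp_plus in H4.
      replace (E1 (2 * x)) with ((exp x * exp x - 1) / (2 * x)) by (rewrite H4; field; easy).
      assert (HE := exp_neq_1 x Hx). assert (HP := exp_pos x).
      replace (E1 x) with ((exp x - 1) / x) by (rewrite H3; field; easy).
      field. repeat split; try easy.
      replace (exp x * exp x - 1) with ((exp x - 1) * (exp x + 1)) by ring.
      apply Rmult_integral_contrapositive_currified; [easy|lra].
Qed.

Lemma phi_0_opp x : phi 0 (- x) = - 1 - phi 0 x.
Proof.
  destruct (Req_dec x 0) as [->|Hx].
  - rewrite Ropp_0, phi_0_0. lra.
  - assert (HE := exp_neq_1 x Hx). assert (HP := exp_pos x).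
    rewrite !phi_0 by (try apply Ropp_neq_0_compat; easy). rewrite exp_Ropp. field. repeat split; try easy; lra.
Qed.

Lemma Bernoulli_parity n : (2 <= n)%nat -> (-1) ^ n * Bernoulli n = Bernoulli n.
Proof.
  intros Hn. destruct n as [|[|n]]; try lia.
  assert (Hl := dseq_comp_lin (-1) 0 (fun _ => True) (fun _ => True) _ phi_dseq (fun _ _ => I)).
  assert (Hr : dseq (fun _ => True) (fun n x => (if n then - 1 else 0) - phi n x)).
  { intros m x Hx. evar_last.
    - apply @is_derive_minus; [apply @is_derive_const|apply phi_dseq; easy].
    - unfold minus, plus, opp, zero. simpl. ring. }
  assert (H := dseq_unique _ _ _ open_True Hl Hr). simpl in H.
  lapply H; clear H; [intros H|].
  - specialize (H (S n) 0 I). cbv beta in H. replace (-1 * 0 + 0) with 0 in H by ring.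
    rewrite Bernoulli_phi. change ((-1) ^ S (S n)) with (-1 * (-1) ^ S n).
    transitivity (- INR (S (S n)) * ((-1) ^ S n * phi (S n) 0)); [ring|].
    rewrite H. ring.
  - intros x _. rewrite <- phi_0_opp, Rmult_1_l. f_equal. ring.
Qed.

(** The n-th derivative of [1 / (exp x - 1)] on [x > 0], as a smooth part plus the derivative of the
    pole [1/x]. *)
Definition bose (n : nat) (x : R) : R := phi n x + (-1) ^ n * INR (fact n) / x ^ S n.

Lemma bose_dseq : dseq (fun x => 0 < x) bose.
Proof.
  intros n x Hx. evar_last.
  - apply @is_derive_plus; [apply phi_dseq; exact I|].
    apply is_derive_scal. apply is_derive_inv; [|apply pow_nonzero; lra].
    apply is_derive_pow, is_derive_id.
  - unfold bose, plus, one; simpl (pred _); rewrite fact_simpl, mult_INR, S_INR. simpl.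
    field. repeat split; try apply pow_nonzero; lra.
Qed.

Lemma bose_0 x : 0 < x -> bose 0 x = / (exp x - 1).
Proof. intros H. unfold bose. rewrite phi_0 by lra. simpl. field. split; [apply exp_neq_1; lra|lra]. Qed.

(* Taylor coefficients in [h] of the addition formula
   [h f(x+h) (f(x) + 1) = h f(h) (f(x) - f(x+h))], [f = bose 0]. *)
Lemma bose_convolution k x :
  0 < x ->
  INR (S k) * ((bose 0 x + 1) * bose k x)
  = - bsum (S k) (fun i => Binomial.C (S k) i * (Bernoulli i * bose (S k - i) x)).
Proof.
  intros Hx.
  set (U := fun h => - x < h).
  assert (HU : open U) by apply open_gt.
  assert (Hsh : dseq U (fun n h => bose n (x + h))).
  { intros n h Hh. evar_last.
    - apply (is_derive_comp (bose n) (fun y => x + y)).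
      + apply bose_dseq. unfold U in Hh. lra.
      + auto_derive; [trivial|reflexivity].
    - unfold scal; simpl; unfold mult; simpl. ring. }
  assert (HL : dseq U (fun n h => (bose 0 x + 1) * bose n (x + h))).
  { intros n h Hh. apply is_derive_scal, Hsh, Hh. }
  apply dseq_id_mult in HL.
  assert (HG : dseq U (fun n h => (if n then bose 0 x else 0) - bose n (x + h))).
  { intros n h Hh. evar_last.
    - apply @is_derive_minus; [apply @is_derive_const|apply Hsh; easy].
    - unfold minus, plus, opp, zero. simpl. ring. }
  assert (Hb : dseq U bern) by (intros n h _; apply bern_dseq; exact I).
  assert (H := dseq_unique _ _ _ HU HL (dseq_mult _ _ _ Hb HG)).
  simpl in H. lapply H; clear H; [intros H|].
  - specialize (H (S k) 0 ltac:(unfold U; lra)).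
    rewrite Rmult_0_l, Rplus_0_l, Rplus_0_r in H. simpl pred in H.
    change (if S k then ?a else ?b) with b in H.
    (* The Leibniz term [i = k + 1] carries the undifferentiated difference [f x - f (x + h)], which
       is 0 at [h = 0]; hence the sum stops at [i = k]. *)
    rewrite H. rewrite Nat.sub_diag, Rminus_diag, !Rmult_0_r, Rplus_0_r.
    match goal with |- _ = - ?r => replace (- r) with (-1 * r) by ring end.
    rewrite <- bsum_scal.
    apply bsum_ext. intros i Hi. rewrite Bernoulli_bern.
    destruct (S k - i)%nat eqn:E; [lia|]. ring.
  - intros h Hh. unfold U in Hh. rewrite !bose_0 by lra. rewrite bern_0.
    unfold Binomial.C. simpl. destruct (Req_dec h 0) as [->|Hn].
    + rewrite Rplus_0_r. ring.
    + assert (HE := exp_neq_1 h Hn). assert (HE2 := exp_neq_1 x ltac:(lra)).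
      assert (HE3 := exp_neq_1 (x + h) ltac:(lra)). assert (H3 := exp_E1 h).
      replace (E1 h) with ((exp h - 1) / h) by (rewrite H3; field; easy).
      rewrite exp_plus in *. field. repeat split; easy.
Qed.

(** * Integrals over the line of exponentially decaying functions *)

Ltac abs_lra :=
  repeat match goal with
  | H : Rabs _ <= _ |- _ => apply Rabs_le_between in H
  | H : Rabs _ < _ |- _ => apply Rabs_lt_between in H
  end;
  first [apply Rabs_le_between | apply Rabs_lt_between]; lra.

Lemma exp_le x y : x <= y -> exp x <= exp y.
Proof. intros [H| ->]; [left; apply exp_increasing, H|apply Rle_refl]. Qed.

Lemma is_lim_seq_exp_half : is_lim_seq (fun n => exp (- INR n / 2)) 0.
Proof.
  apply (is_lim_seq_ext (fun n => exp (- / 2) ^ n)).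
  - intros n. induction n as [|n IH]; [simpl; rewrite <- exp_0; f_equal; field|].
    simpl pow. rewrite IH, <- exp_plus, S_INR. f_equal. field.
  - apply is_lim_seq_geom. rewrite Rabs_pos_eq by (left; apply exp_pos).
    rewrite <- exp_0. apply exp_increasing. lra.
Qed.

Lemma is_lim_seq_dist0 (u : nat -> R) l (v : nat -> R) :
  (forall n, Rabs (u n - l) <= v n) -> is_lim_seq v 0 -> is_lim_seq u l.
Proof.
  intros H Hv.
  apply (is_lim_seq_le_le (fun n => l + - v n) _ (fun n => l + v n)).
  - intros n. specialize (H n). apply Rabs_le_between in H. lra.
  - replace (Finite l) with (Finite (l + - 0)) by (f_equal; ring).
    apply is_lim_seq_plus'; [apply is_lim_seq_const|].
    apply (is_lim_seq_opp v 0). exact Hv.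
  - replace (Finite l) with (Finite (l + 0)) by (f_equal; ring).
    apply is_lim_seq_plus'; [apply is_lim_seq_const|exact Hv].
Qed.

Lemma is_lim_seq_scal0 (v : nat -> R) c : is_lim_seq v 0 -> is_lim_seq (fun n => c * v n) 0.
Proof.
  intros H. replace (Finite 0) with (Rbar_mult c 0) by (simpl; f_equal; ring).
  apply is_lim_seq_scal_l, H.
Qed.

Lemma ex_RInt_cont (k : R -> R) a b : (forall u, continuous k u) -> ex_RInt k a b.
Proof. intros H. apply (ex_RInt_continuous (V := R_CompleteNormedModule)). intros; apply H. Qed.

Lemma is_RInt_cont (k : R -> R) a b : (forall u, continuous k u) -> is_RInt k a b (RInt k a b).
Proof. intros H. apply (RInt_correct (V := R_CompleteNormedModule)), ex_RInt_cont, H. Qed.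

Lemma RInt_Chasles_cont (k : R -> R) a b c :
  (forall u, continuous k u) -> RInt k a b + RInt k b c = RInt k a c.
Proof. intros H. apply (RInt_Chasles k); apply ex_RInt_cont, H. Qed.

Lemma RInt_derive_cont (K k : R -> R) a b :
  (forall u, is_derive K u (k u)) -> (forall u, continuous k u) -> RInt k a b = K b - K a.
Proof. intros H1 H2. apply is_RInt_unique, (is_RInt_derive K k); intros; easy. Qed.

Lemma RInt_opp_cont (k : R -> R) a b :
  (forall u, continuous k u) -> RInt (fun u => k (- u)) (- b) (- a) = RInt k a b.
Proof.
  intros H. apply is_RInt_unique.
  assert (H1 := is_RInt_comp_opp k (- a) (- b) (RInt k a b)).
  rewrite !Ropp_involutive in H1. specialize (H1 (RInt_correct _ _ _ (ex_RInt_cont k a b H))).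
  apply is_RInt_swap in H1. apply (is_RInt_opp (fun y => opp (k (- y)))) in H1.
  rewrite opp_opp in H1. revert H1. apply is_RInt_ext. intros x _. apply opp_opp.
Qed.

Lemma RInt_shift_cont (k : R -> R) a b c :
  (forall u, continuous k u) -> RInt (fun u => k (u + c)) a b = RInt k (a + c) (b + c).
Proof.
  intros H. assert (H1 := RInt_comp_lin k 1 c a b).
  rewrite !Rmult_1_l in H1. rewrite <- H1 by (apply ex_RInt_cont, H).
  apply RInt_ext. intros x _. unfold scal; simpl; unfold mult; simpl.
  rewrite !Rmult_1_l. reflexivity.
Qed.

Definition decay (C : R) (k : R -> R) : Prop := forall u, Rabs (k u) <= C * exp (- Rabs u / 2).

(** The rate 1/2 is dictated by [exp (u/2) * phi (exp u)], which decays exactly like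
    [exp (- |u| / 2)] at both ends. *)
Definition tame (k : R -> R) : Prop := (forall u, continuous k u) /\ exists C, decay C k.

(** The integral over the line as a total function. Symmetric windows suffice for [tame] integrands,
    where [intR_close] controls arbitrary ones. *)
Definition intR (k : R -> R) : R := real (Lim_seq (fun n => RInt k (- INR n) (INR n))).

Lemma decay_pos C k : decay C k -> 0 <= C.
Proof.
  intros H. specialize (H 0). rewrite Rabs_R0 in H.
  replace (- 0 / 2) with 0 in H by field. rewrite exp_0 in H.
  assert (H1 := Rabs_pos (k 0)). lra.
Qed.

Lemma RInt_tail k C a b :
  (forall u, continuous k u) -> decay C k -> 0 <= a <= b ->
  Rabs (RInt k a b) <= 2 * C * exp (- a / 2).
Proof.
  intros Hc Hd Hab.
  assert (H := norm_RInt_le k (fun u => C * exp (- u / 2)) a b (RInt k a b)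
     (-2 * C * exp (- b / 2) - (-2 * C * exp (- a / 2)))).
  eapply Rle_trans; [apply H|].
  - lra.
  - intros x Hx. eapply Rle_trans; [apply Hd|]. rewrite Rabs_pos_eq by lra. lra.
  - apply is_RInt_cont, Hc.
  - apply (is_RInt_derive (fun u => -2 * C * exp (- u / 2)) (fun u => C * exp (- u / 2))).
    + intros x _. auto_derive; [trivial|]. unfold Rdiv. field.
    + intros x _. apply (continuous_mult (fun _ => C)); [apply continuous_const|].
      apply ex_derive_cont. auto_derive. trivial.
  - assert (H1 := decay_pos _ _ Hd). assert (H2 := exp_pos (- b / 2)). nra.
Qed.

Lemma RInt_tail_neg k C a b :
  (forall u, continuous k u) -> decay C k -> 0 <= a <= b ->
  Rabs (RInt k (- b) (- a)) <= 2 * C * exp (- a / 2).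
Proof.
  intros Hc Hd Hab. rewrite <- RInt_opp_cont by easy. rewrite !Ropp_involutive.
  apply RInt_tail; [|intros u|exact Hab].
  - intros u. apply (continuous_comp (fun u => - u) k); [|apply Hc].
    apply (continuous_opp (fun u : R => u)), continuous_id.
  - rewrite <- Rabs_Ropp with (x := u). apply Hd.
Qed.

Lemma RInt_window k C a b n :
  (forall u, continuous k u) -> decay C k -> 0 <= a <= n -> 0 <= b <= n ->
  Rabs (RInt k (- n) n - RInt k (- a) b) <= 2 * C * (exp (- a / 2) + exp (- b / 2)).
Proof.
  intros Hc Hd Ha Hb.
  rewrite <- (RInt_Chasles_cont k (- n) (- a) n Hc), <- (RInt_Chasles_cont k (- a) b n Hc).
  assert (H1 := RInt_tail k C b n Hc Hd Hb). assert (H2 := RInt_tail_neg k C a n Hc Hd Ha).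
  abs_lra.
Qed.

Lemma intR_lim k : tame k -> is_lim_seq (fun n => RInt k (- INR n) (INR n)) (intR k).
Proof.
  intros [Hc [C Hd]]. apply Lim_seq_correct', ex_lim_seq_cauchy_corr.
  intros eps. assert (H := is_lim_seq_scal0 _ (8 * C) is_lim_seq_exp_half).
  apply is_lim_seq_spec in H. destruct (H eps) as [N HN]. exists N.
  intros n m Hn Hm. specialize (HN N (Nat.le_refl N)). rewrite Rminus_0_r in HN.
  apply Rabs_lt_between in HN.
  assert (H1 := RInt_window k C (INR N) (INR N) (INR n) Hc Hd
     (conj (pos_INR N) (le_INR _ _ Hn)) (conj (pos_INR N) (le_INR _ _ Hn))).
  assert (H2 := RInt_window k C (INR N) (INR N) (INR m) Hc Hd
     (conj (pos_INR N) (le_INR _ _ Hm)) (conj (pos_INR N) (le_INR _ _ Hm))).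
  abs_lra.
Qed.

(** The error depends on [k] only through [C]; this makes truncated Fourier transforms converge
    uniformly in the frequency. *)
Lemma intR_close k C a b :
  (forall u, continuous k u) -> decay C k -> 0 <= a -> 0 <= b ->
  Rabs (intR k - RInt k (- a) b) <= 2 * C * (exp (- a / 2) + exp (- b / 2)).
Proof.
  intros Hc Hd Ha Hb.
  assert (H := intR_lim k (conj Hc (ex_intro _ C Hd))).
  assert (H1 : is_lim_seq (fun n => Rabs (RInt k (- INR n) (INR n) - RInt k (- a) b))
     (Rabs (intR k - RInt k (- a) b))).
  { apply (is_lim_seq_abs _ (Finite _)). apply is_lim_seq_minus'; [exact H|apply is_lim_seq_const]. }
  refine (is_lim_seq_le_loc _ (fun _ => 2 * C * (exp (- a / 2) + exp (- b / 2)))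
     (Finite _) (Finite _) _ H1 (is_lim_seq_const _)).
  destruct (nfloor_ex (Rmax a b)) as [N HN]; [apply (Rle_trans _ a); [easy|apply Rmax_l]|].
  exists (S N). intros n Hn. apply le_INR in Hn. rewrite S_INR in Hn.
  assert (H2 := Rmax_l a b). assert (H3 := Rmax_r a b).
  apply RInt_window; try easy; lra.
Qed.

Lemma intR_unique k l : is_lim_seq (fun n => RInt k (- INR n) (INR n)) (Finite l) -> intR k = l.
Proof. intros H. unfold intR. rewrite (is_lim_seq_unique _ _ H). reflexivity. Qed.

Lemma intR_ext k1 k2 : (forall u, k1 u = k2 u) -> intR k1 = intR k2.
Proof.
  intros H. unfold intR. f_equal. apply Lim_seq_ext. intros n. apply RInt_ext. intros; apply H.
Qed.

Lemma intR_plus k1 k2 : tame k1 -> tame k2 -> intR (fun u => k1 u + k2 u) = intR k1 + intR k2.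
Proof.
  intros H1 H2. apply intR_unique.
  eapply is_lim_seq_ext; [|apply is_lim_seq_plus'; apply intR_lim; [exact H1|exact H2]].
  intros n. symmetry. apply (RInt_plus k1 k2); apply ex_RInt_cont; [apply H1|apply H2].
Qed.

Lemma intR_scal c k : tame k -> intR (fun u => c * k u) = c * intR k.
Proof.
  intros H1. apply intR_unique.
  eapply is_lim_seq_ext; [|apply (is_lim_seq_scal_l (fun n => RInt k (- INR n) (INR n)) c (Finite _)), intR_lim, H1].
  intros n. symmetry. apply (RInt_scal k). apply ex_RInt_cont, H1.
Qed.

Lemma intR_le k1 k2 : tame k1 -> tame k2 -> (forall u, k1 u <= k2 u) -> intR k1 <= intR k2.
Proof.
  intros H1 H2 H. refine (is_lim_seq_le _ _ (Finite _) (Finite _) _ (intR_lim _ H1) (intR_lim _ H2)).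
  intros n. apply RInt_le; [assert (H3 := pos_INR n); lra| | |intros; apply H];
  apply ex_RInt_cont; [apply H1|apply H2].
Qed.

Lemma tame_ext k1 k2 : (forall u, k1 u = k2 u) -> tame k1 -> tame k2.
Proof.
  intros H [H1 [C H2]]. split.
  - intros u. apply (continuous_ext k1); easy.
  - exists C. intros u. rewrite <- H. apply H2.
Qed.

Lemma tame_plus k1 k2 : tame k1 -> tame k2 -> tame (fun u => k1 u + k2 u).
Proof.
  intros [H1 [C H2]] [H3 [D H4]]. split.
  - intros u. apply (continuous_plus k1 k2); easy.
  - exists (C + D). intros u. specialize (H2 u). specialize (H4 u).
    eapply Rle_trans; [apply Rabs_triang|]. lra.
Qed.

Lemma tame_bounded_mult h k B :
  (forall u, continuous h u) -> (forall u, Rabs (h u) <= B) -> tame k -> tame (fun u => h u * k u).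
Proof.
  intros H1 HB [H2 [C H3]]. split.
  - intros u. apply (continuous_mult h k); easy.
  - exists (B * C). intros u. rewrite Rabs_mult, Rmult_assoc.
    apply Rmult_le_compat; try apply Rabs_pos; easy.
Qed.

Lemma tame_scal c k : tame k -> tame (fun u => c * k u).
Proof.
  apply (tame_bounded_mult (fun _ => c) k (Rabs c)).
  - intros u. apply continuous_const.
  - intros. apply Rle_refl.
Qed.

Lemma tame_opp k : tame k -> tame (fun u => - k u).
Proof. intros H. apply (tame_ext (fun u => -1 * k u)); [intros; ring|apply tame_scal, H]. Qed.

Lemma tame_minus k1 k2 : tame k1 -> tame k2 -> tame (fun u => k1 u - k2 u).
Proof. intros. apply tame_plus; [easy|apply tame_opp; easy]. Qed.

Lemma tame_0 : tame (fun _ => 0).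
Proof.
  split; [intros; apply continuous_const|]. exists 0. intros u. rewrite Rabs_R0. lra.
Qed.

Lemma tame_bsum n (k : nat -> R -> R) :
  (forall i, (i < n)%nat -> tame (k i)) -> tame (fun u => bsum n (fun i => k i u)).
Proof.
  induction n as [|n IH]; intros H; simpl; [apply tame_0|].
  apply tame_plus; [apply IH; intros; apply H; lia|apply H; lia].
Qed.

Lemma intR_0 : intR (fun _ => 0) = 0.
Proof.
  apply intR_unique. apply (is_lim_seq_ext (fun _ => 0)); [|apply is_lim_seq_const].
  intros n. rewrite RInt_const. unfold scal; simpl. unfold mult; simpl. ring.
Qed.

Lemma intR_bsum n (k : nat -> R -> R) :
  (forall i, (i < n)%nat -> tame (k i)) ->
  intR (fun u => bsum n (fun i => k i u)) = bsum n (fun i => intR (k i)).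
Proof.
  induction n as [|n IH]; intros H; simpl; [apply intR_0|].
  rewrite intR_plus; [rewrite IH; [reflexivity|intros; apply H; lia]
    |apply tame_bsum; intros; apply H; lia|apply H; lia].
Qed.

Lemma intR_minus k1 k2 : tame k1 -> tame k2 -> intR (fun u => k1 u - k2 u) = intR k1 - intR k2.
Proof.
  intros H1 H2. rewrite (intR_ext _ (fun u => k1 u + -1 * k2 u)) by (intros; ring).
  rewrite intR_plus, intR_scal; [ring|easy|easy|apply tame_scal; easy].
Qed.

Lemma intR_abs_le k1 k2 : tame k1 -> tame k2 -> (forall u, Rabs (k1 u) <= k2 u) -> Rabs (intR k1) <= intR k2.
Proof.
  intros H1 H2 H. apply Rabs_le_between. split.
  - replace (- intR k2) with (intR (fun u => -1 * k2 u)) by (rewrite intR_scal by easy; ring).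
    apply intR_le; [apply tame_scal; easy|easy|]. intros u. specialize (H u).
    apply Rabs_le_between in H. lra.
  - apply intR_le; try easy. intros u. specialize (H u). apply Rabs_le_between in H. lra.
Qed.

Lemma tame_shift k a : tame k -> tame (fun u => k (u + a)).
Proof.
  intros [H [C H2]]. split.
  - intros u. apply (continuous_comp (fun u => u + a) k); [|apply H].
    apply (continuous_plus (fun u : R => u) (fun _ => a)); [apply continuous_id|apply continuous_const].
  - exists (C * exp (Rabs a / 2)). intros u. eapply Rle_trans; [apply H2|].
    rewrite Rmult_assoc, <- exp_plus. apply Rmult_le_compat_l; [apply (decay_pos _ _ H2)|].
    apply exp_le. assert (H3 := Rabs_triang (u + a) (- a)).
    replace (u + a + - a) with u in H3 by ring. rewrite Rabs_Ropp in H3. lra.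
Qed.

(** In the variable [x = exp u] this is the dilation invariance of [dx / x]. *)
Lemma intR_shift k a : tame k -> intR (fun u => k (u + a)) = intR k.
Proof.
  intros H. apply intR_unique. destruct H as [Hc [C Hd]].
  destruct (nfloor_ex (Rabs a) (Rabs_pos a)) as [N0 [_ HN]]. rewrite <- S_INR in HN.
  revert HN. generalize (S N0) as N. intros N HN. apply Rlt_le in HN.
  (* Starting at [N >= |a|] keeps both ends of the shifted window at distance at least [n] from
     0. *)
  apply (is_lim_seq_incr_n _ N).
  apply Rabs_le_between in HN.
  apply (is_lim_seq_dist0 _ _ (fun n => 4 * C * exp (- INR n / 2))).
  2:{ apply is_lim_seq_scal0, is_lim_seq_exp_half. }
  intros n. rewrite RInt_shift_cont by easy. rewrite Rabs_minus_sym.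
  assert (Hn := pos_INR n). assert (HC := decay_pos _ _ Hd).
  rewrite !plus_INR.
  replace (- (INR n + INR N) + a) with (- (INR n + INR N - a)) by ring.
  eapply Rle_trans; [apply (intR_close k C); try easy; lra|].
  assert (H1 : exp (- (INR n + INR N - a) / 2) <= exp (- INR n / 2)) by (apply exp_le; lra).
  assert (H2 : exp (- (INR n + INR N + a) / 2) <= exp (- INR n / 2)) by (apply exp_le; lra).
  nra.
Qed.

Lemma intR_derive K k lp lm :
  (forall u, is_derive K u (k u)) -> (forall u, continuous k u) ->
  is_lim_seq (fun n => K (INR n)) (Finite lp) -> is_lim_seq (fun n => K (- INR n)) (Finite lm) ->
  intR k = lp - lm.
Proof.
  intros H Hc Hp Hm. apply intR_unique.
  eapply is_lim_seq_ext; [|apply is_lim_seq_minus'; [exact Hp|exact Hm]].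
  intros n. symmetry. apply RInt_derive_cont; easy.
Qed.

Lemma tame_lim k : tame k ->
  is_lim_seq (fun n => k (INR n)) 0 /\ is_lim_seq (fun n => k (- INR n)) 0.
Proof.
  intros [_ [C H]].
  split; (apply (is_lim_seq_dist0 _ _ (fun n => C * exp (- INR n / 2)));
    [|apply is_lim_seq_scal0, is_lim_seq_exp_half]); intros n; rewrite Rminus_0_r.
  - specialize (H (INR n)). rewrite (Rabs_pos_eq (INR n)) in H by apply pos_INR. exact H.
  - specialize (H (- INR n)). rewrite Rabs_Ropp, (Rabs_pos_eq (INR n)) in H by apply pos_INR. exact H.
Qed.

Lemma intR_derive_tame K k :
  (forall u, is_derive K u (k u)) -> (forall u, continuous k u) -> tame K -> intR k = 0.
Proof.
  intros H Hc HK. rewrite (intR_derive K k 0 0 H Hc); [ring|apply tame_lim, HK|apply tame_lim, HK].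
Qed.

(* In the variable [x = exp u]: [O(x)] at [0] and [O(1/x)] at infinity. *)
Lemma tame_intro k :
  (forall u, continuous k u) ->
  (exists C, forall u, u <= 0 -> Rabs (k u) <= C * exp u) ->
  (exists C, forall u, 0 <= u -> Rabs (k u) <= C * exp (- u)) -> tame k.
Proof.
  intros H [C1 H1] [C2 H2]. split; [exact H|]. exists (C1 + C2).
  assert (P1 : 0 <= C1).
  { specialize (H1 0 (Rle_refl 0)). rewrite exp_0 in H1. assert (P := Rabs_pos (k 0)). lra. }
  assert (P2 : 0 <= C2).
  { specialize (H2 0 (Rle_refl 0)). rewrite Ropp_0, exp_0 in H2. assert (P := Rabs_pos (k 0)). lra. }
  intros u. destruct (Rle_dec u 0) as [Hu|Hu].
  - eapply Rle_trans; [apply H1, Hu|]. rewrite Rabs_left1 by easy.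
    assert (exp u <= exp (- - u / 2)) by (apply exp_le; lra). assert (P := exp_pos u). nra.
  - eapply Rle_trans; [apply H2; lra|]. rewrite Rabs_pos_eq by lra.
    assert (exp (- u) <= exp (- u / 2)) by (apply exp_le; lra). assert (P := exp_pos (- u)). nra.
Qed.

(** * Moments of phi *)

Lemma phi_bounded k : exists C, 0 <= C /\ forall x, 0 <= x <= 1 -> Rabs (phi k x) <= C.
Proof.
  destruct (continuity_ab_maj (fun x => Rabs (phi k x)) 0 1) as [M [HM _]]; [lra| |].
  - intros c _. apply continuity_pt_filterlim.
    apply (continuous_comp (phi k) Rabs); [apply phi_continuous|apply continuous_Rabs].
  - exists (Rabs (phi k M)). split; [apply Rabs_pos|exact HM].
Qed.

Lemma phi_lipschitz : exists C, 0 <= C /\ forall x, 0 <= x <= 1 -> Rabs (phi 0 x + / 2) <= C * x.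
Proof.
  destruct (phi_bounded 1) as [C [HC H]]. exists C. split; [exact HC|]. intros x Hx.
  destruct (MVT_gen (phi 0) 0 x (phi 1)) as [c [Hc Heq]].
  - intros y _. apply phi_dseq. exact I.
  - intros y _. apply continuity_pt_filterlim, phi_continuous.
  - rewrite Rmin_left, Rmax_right in Hc by lra. rewrite phi_0_0 in Heq.
    replace (phi 0 x + / 2) with (phi 0 x - - / 2) by ring. rewrite Heq, Rminus_0_r, Rabs_mult.
    rewrite (Rabs_pos_eq x) by lra. apply Rmult_le_compat_r; [lra|apply H; lra].
Qed.

(** With [y = x / (m+1)], the inequality [exp y >= 1 + y] raised to the power [m + 1] gives
    [exp x >= 1 + y^(m+1)]. *)
Lemma exp_minus_1_pow m x : 0 <= x -> (x / INR (S m)) ^ S m <= exp x - 1.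
Proof.
  intros Hx. set (y := x / INR (S m)).
  assert (Hm := INR_S_pos m).
  assert (Hy : 0 <= y) by (unfold y; apply Rcomplements.Rdiv_le_0_compat; easy).
  assert (H : forall n, exp y ^ S n >= 1 + y ^ S n).
  { assert (H1 := exp_ineq1_le y).
    induction n as [|n IH]; [simpl; lra|].
    change (exp y ^ S (S n)) with (exp y * exp y ^ S n).
    change (y ^ S (S n)) with (y * y ^ S n).
    assert (P := pow_le y (S n) Hy). nra. }
  specialize (H m).
  assert (HE : forall n, exp y ^ n = exp (INR n * y)).
  { induction n as [|n IH]; [simpl; rewrite Rmult_0_l, exp_0; reflexivity|].
    rewrite S_INR. simpl pow. rewrite IH, <- exp_plus. f_equal. ring. }
  rewrite HE in H. replace (INR (S m) * y) with x in H by (unfold y; field; lra). lra.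
Qed.

Lemma bose_0_bound m : exists C, forall x, 1 <= x -> x ^ m * bose 0 x <= C.
Proof.
  exists (INR (S m) ^ S m). intros x Hx. rewrite bose_0 by lra.
  assert (H := exp_minus_1_pow m x ltac:(lra)).
  assert (Hm := INR_S_pos m).
  unfold Rdiv in H. rewrite Rpow_mult_distr, pow_inv in H.
  assert (P : 0 < INR (S m) ^ S m) by (apply pow_lt; lra).
  assert (Q : 0 < exp x - 1) by (assert (H1 := exp_ineq1 x ltac:(lra)); lra).
  apply (Rmult_le_reg_r (exp x - 1)); [exact Q|].
  rewrite Rmult_assoc, Rinv_l, Rmult_1_r by lra.
  apply (Rmult_le_compat_l (INR (S m) ^ S m)) in H; [|lra].
  replace (INR (S m) ^ S m * (x ^ S m * / INR (S m) ^ S m)) with (x ^ S m) in H by (field; lra).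
  change (x ^ S m) with (x * x ^ m) in H. assert (P1 := pow_le x m ltac:(lra)). nra.
Qed.

Lemma bose_0_pos x : 0 < x -> 0 < bose 0 x.
Proof.
  intros H. rewrite bose_0 by easy. apply Rinv_0_lt_compat.
  assert (H1 := exp_ineq1 x ltac:(lra)). lra.
Qed.

Lemma bsum_dominated n (t : nat -> R -> R) (U : R -> Prop) w :
  (forall x, U x -> 0 <= w x) ->
  (forall i, (i < n)%nat -> exists C, 0 <= C /\ forall x, U x -> Rabs (t i x) <= C * w x) ->
  exists C, 0 <= C /\ forall x, U x -> Rabs (bsum n (fun i => t i x)) <= C * w x.
Proof.
  intros Hw. induction n as [|n IH]; intros H.
  - exists 0. split; [lra|]. intros x Hx. simpl. rewrite Rabs_R0. lra.
  - destruct IH as [C [HC IH]]; [intros; apply H; lia|].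
    destruct (H n ltac:(lia)) as [D [HD Hn]]. exists (C + D). split; [lra|].
    intros x Hx. simpl. eapply Rle_trans; [apply Rabs_triang|].
    specialize (IH x Hx). specialize (Hn x Hx). lra.
Qed.

(** Strong induction: [bose_convolution] expresses [f^(k+1)] through [f f^(k)] and derivatives of
    order at most [k], and [f] is bounded on [x >= 1]. So every derivative inherits the rapid decay
    of [f] at infinity. *)
Lemma bose_le_bose_0 k :
  exists C, 0 <= C /\ forall x, 1 <= x -> Rabs (bose k x) <= C * bose 0 x.
Proof.
  induction k as [k IH] using (well_founded_induction Wf_nat.lt_wf).
  destruct k as [|k].
  { exists 1. split; [lra|]. intros x Hx. assert (H := bose_0_pos x ltac:(lra)).
    rewrite Rabs_pos_eq; lra. }
  assert (Hw : forall x, 1 <= x -> 0 <= bose 0 x).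
  { intros x Hx. left. apply bose_0_pos. lra. }
  destruct (bose_0_bound 0) as [D HD].
  destruct (bsum_dominated k (fun i x => Binomial.C (S k) (S i) *
    (Bernoulli (S i) * bose (S k - S i) x)) (fun x => 1 <= x) (bose 0) Hw) as [C [HC HS]].
  { intros i Hi. destruct (IH (S k - S i)%nat ltac:(lia)) as [C [HC H]].
    exists (Rabs (Binomial.C (S k) (S i) * Bernoulli (S i)) * C). split.
    - apply Rmult_le_pos; [apply Rabs_pos|easy].
    - intros x Hx. rewrite <- Rmult_assoc, Rabs_mult, Rmult_assoc.
      apply Rmult_le_compat_l; [apply Rabs_pos|apply H; easy]. }
  destruct (IH k ltac:(lia)) as [Ck [HCk Hk]].
  exists (INR (S k) * ((D + 1) * Ck) + C).
  assert (HD0 : 0 <= D).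
  { specialize (HD 1 (Rle_refl 1)). rewrite pow_O, Rmult_1_l in HD. specialize (Hw 1 (Rle_refl 1)). lra. }
  assert (Hk0 := pos_INR (S k)).
  split; [apply Rplus_le_le_0_compat; [|easy]; apply Rmult_le_pos; [easy|]; apply Rmult_le_pos; lra|].
  intros x Hx.
  assert (H := bose_convolution k x ltac:(lra)).
  rewrite bsum_head, Bernoulli_0, Nat.sub_0_r in H.
  replace (Binomial.C (S k) 0) with 1 in H.
  2:{ rewrite <- binom_C by lia. reflexivity. }
  assert (E : bose (S k) x = - (INR (S k) * ((bose 0 x + 1) * bose k x)) -
     bsum k (fun i => Binomial.C (S k) (S i) * (Bernoulli (S i) * bose (S k - S i) x))) by lra.
  rewrite E. specialize (HS x Hx). specialize (Hk x Hx). specialize (HD x Hx).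
  specialize (Hw x Hx). rewrite pow_O, Rmult_1_l in HD.
  eapply Rle_trans; [apply Rabs_triang|]. rewrite !Rabs_Ropp, (Rmult_plus_distr_r _ C).
  apply Rplus_le_compat; [|exact HS].
  rewrite !Rabs_mult, (Rabs_pos_eq (INR _)), (Rabs_pos_eq (bose 0 x + 1)) by lra.
  replace (INR (S k) * ((D + 1) * Ck) * bose 0 x) with (INR (S k) * ((D + 1) * (Ck * bose 0 x))) by ring.
  apply Rmult_le_compat_l; [easy|]. apply Rmult_le_compat; try lra. apply Rabs_pos.
Qed.

Lemma bose_bound k m : exists C, 0 <= C /\ forall x, 1 <= x -> x ^ m * Rabs (bose k x) <= C.
Proof.
  destruct (bose_le_bose_0 k) as [C [HC H]]. destruct (bose_0_bound m) as [D HD].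
  assert (HD0 : 0 <= D).
  { eapply Rle_trans; [|apply (HD 1 (Rle_refl 1))]. rewrite pow1, Rmult_1_l.
    left. apply bose_0_pos. lra. }
  exists (C * D). split; [apply Rmult_le_pos; easy|]. intros x Hx.
  assert (P := pow_le x m ltac:(lra)).
  apply Rle_trans with (x ^ m * (C * bose 0 x)).
  - apply Rmult_le_compat_l; [easy|apply H; easy].
  - specialize (HD x Hx). nra.
Qed.

(** [x^k phi^(k)(x)] at [x = exp u], so that differentiation in [u] acts by the step of [Sfun_S]. *)
Definition psi (k : nat) (u : R) : R := exp u ^ k * phi k (exp u).

Lemma psi_derive k u : is_derive (psi k) u (INR k * psi k u + psi (S k) u).
Proof.
  unfold psi. evar_last.
  - apply is_derive_mul; [|apply (is_derive_comp (phi k) exp)].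
    + apply is_derive_pow, is_derive_exp.
    + apply phi_dseq. exact I.
    + apply is_derive_exp.
  - unfold plus, mult, scal; simpl. unfold mult; simpl. destruct k; simpl; ring.
Qed.

Lemma psi_continuous k u : continuous (psi k) u.
Proof. apply ex_derive_cont. eexists. apply psi_derive. Qed.

Lemma exp_le_1 u : u <= 0 -> 0 < exp u <= 1.
Proof. intros H. split; [apply exp_pos|rewrite <- exp_0; apply exp_le, H]. Qed.

Lemma exp_ge_1 u : 0 <= u -> 1 <= exp u.
Proof. intros H. rewrite <- exp_0. apply exp_le, H. Qed.

Lemma pow_le_1 x n : 0 <= x <= 1 -> 0 <= x ^ n <= 1.
Proof. intros H. split; [apply pow_le; lra|]. rewrite <- (pow1 n). apply pow_incr. lra. Qed.

Lemma psi_bose k u :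
  exp u * psi k u = exp u ^ S k * bose k (exp u) - (-1) ^ k * INR (fact k).
Proof.
  unfold psi, bose. assert (P := exp_pos u). simpl. field. repeat split; try apply pow_nonzero; lra.
Qed.

Lemma psi_bound k : exists C, 0 <= C /\ (forall u, Rabs (psi k u) <= C) /\
  (forall u, Rabs (psi k u) <= C * exp (- u)) /\ (forall u, u <= 0 -> Rabs (psi k u) <= C * exp u ^ k).
Proof.
  destruct (phi_bounded k) as [C1 [HC1 H1]]. destruct (bose_bound k (S k)) as [C2 [HC2 H2]].
  assert (HF := pos_INR (fact k)).
  assert (Hn : forall u, u <= 0 -> Rabs (psi k u) <= C1 * exp u ^ k).
  { intros u Hu. assert (HE := exp_le_1 u Hu). unfold psi.
    rewrite Rabs_mult, (Rabs_pos_eq (_ ^ _)) by (apply pow_le; lra). rewrite Rmult_comm.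
    apply Rmult_le_compat_r; [apply pow_le; lra|apply H1; lra]. }
  assert (Hp : forall u, 0 <= u -> Rabs (psi k u) <= (C2 + INR (fact k)) * exp (- u)).
  { intros u Hu. assert (HE := exp_ge_1 u Hu). rewrite exp_Ropp.
    apply (Rmult_le_reg_l (exp u)); [lra|].
    replace (exp u * ((C2 + INR (fact k)) * / exp u)) with (C2 + INR (fact k)) by (field; lra).
    rewrite <- (Rabs_pos_eq (exp u)) at 1 by lra. rewrite <- Rabs_mult, psi_bose.
    eapply Rle_trans; [apply Rabs_triang|]. rewrite Rabs_Ropp, !Rabs_mult, pow_1_abs.
    rewrite (Rabs_pos_eq (INR _)), (Rabs_pos_eq (_ ^ _)) by (try apply pow_le; lra).
    specialize (H2 (exp u) HE). lra. }
  exists (C1 + (C2 + INR (fact k))).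
  assert (E1 : forall u, 0 <= u -> exp (- u) <= 1) by (intros; apply exp_le_1; lra).
  split; [lra|]. repeat split; intros u.
  - destruct (Rle_dec u 0) as [Hu|Hu].
    + eapply Rle_trans; [apply Hn, Hu|]. assert (HE := exp_le_1 u Hu).
      assert (P := pow_le_1 (exp u) k ltac:(lra)). nra.
    + eapply Rle_trans; [apply Hp; lra|]. specialize (E1 u ltac:(lra)). nra.
  - destruct (Rle_dec u 0) as [Hu|Hu].
    + eapply Rle_trans; [apply Hn, Hu|]. assert (HE := exp_le_1 u Hu).
      assert (P := pow_le_1 (exp u) k ltac:(lra)). assert (Q := exp_ge_1 (- u) ltac:(lra)). nra.
    + eapply Rle_trans; [apply Hp; lra|]. assert (P := exp_pos (- u)). nra.
  - intros Hu. eapply Rle_trans; [apply Hn, Hu|]. assert (HE := exp_le_1 u Hu).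
    assert (P := pow_le_1 (exp u) k ltac:(lra)). nra.
Qed.

Lemma exp_continuous u : continuous exp u.
Proof. apply ex_derive_cont. eexists. apply is_derive_exp. Qed.

Lemma cont_mult {U : UniformSpace} (f g : U -> R) :
  (forall u, continuous f u) -> (forall u, continuous g u) ->
  forall u, continuous (fun u => f u * g u) u.
Proof. intros H1 H2 u. apply (continuous_mult f g); easy. Qed.

Lemma cont_plus {U : UniformSpace} (f g : U -> R) :
  (forall u, continuous f u) -> (forall u, continuous g u) ->
  forall u, continuous (fun u => f u + g u) u.
Proof. intros H1 H2 u. apply (continuous_plus f g); easy. Qed.

Lemma cont_opp {U : UniformSpace} (f : U -> R) : (forall u, continuous f u) ->
  forall u, continuous (fun u => - f u) u.
Proof. intros H1 u. apply (continuous_opp f); easy. Qed.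

Lemma cont_minus {U : UniformSpace} (f g : U -> R) :
  (forall u, continuous f u) -> (forall u, continuous g u) ->
  forall u, continuous (fun u => f u - g u) u.
Proof. intros H1 H2. apply (cont_plus f (fun u => - g u)), cont_opp; easy. Qed.

Lemma cont_const {U : UniformSpace} (c : R) : forall u : U, continuous (fun _ => c) u.
Proof. intros u. apply continuous_const. Qed.

Lemma cont_pow {U : UniformSpace} (f : U -> R) n : (forall u, continuous f u) ->
  forall u, continuous (fun u => f u ^ n) u.
Proof.
  intros H. induction n as [|n IH]; [exact (cont_const 1)|].
  exact (cont_mult f (fun u => f u ^ n) H IH).
Qed.

Lemma cont_comp {U V : UniformSpace} (f : V -> R) (g : U -> V) :
  (forall u, continuous f u) -> (forall u, continuous g u) ->
  forall u, continuous (fun u => f (g u)) u.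
Proof. intros H1 H2 u. apply (continuous_comp g f); easy. Qed.

Lemma cont_id : forall u : R, continuous (fun u => u) u.
Proof. intros u. apply continuous_id. Qed.

Lemma cont_fst : forall p : R * R, continuous (fun q => fst q) p.
Proof. intros [x y]. apply continuous_fst. Qed.

Lemma cont_snd : forall p : R * R, continuous (fun q => snd q) p.
Proof. intros [x y]. apply continuous_snd. Qed.

Ltac cont :=
  repeat match goal with
  | |- forall u, continuous exp u => exact exp_continuous
  | |- forall u, continuous (psi _) u => apply psi_continuous
  | |- forall x, continuous (fun u => psi ?k (@?g u)) x => apply (cont_comp (psi k) g)
  | |- forall x, continuous (fun u => exp (@?g u)) x => apply (cont_comp exp g)
  | |- forall x, continuous (fun u => cos (@?g u)) x =>
      apply (cont_comp cos g); [apply continuous_cos|]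
  | |- forall x, continuous (fun u => sin (@?g u)) x =>
      apply (cont_comp sin g); [apply continuous_sin|]
  | |- forall x, continuous (fun u => @?f u ^ ?n) x => apply (cont_pow f n)
  | |- forall x, continuous (fun u => @?f u * @?g u) x => apply (cont_mult f g)
  | |- forall x, continuous (fun u => @?f u + @?g u) x => apply (cont_plus f g)
  | |- forall x, continuous (fun u => @?f u - @?g u) x => apply (cont_minus f g)
  | |- forall x, continuous (fun u => - @?f u) x => apply (cont_opp f)
  | |- forall x, continuous (fun _ => ?c) x => apply (cont_const c)
  | |- forall x, continuous (fun u => u) x => apply cont_id
  | |- forall x, continuous (fun u => fst u) x => apply cont_fst
  | |- forall x, continuous (fun u => snd u) x => apply cont_snd
  | |- forall x, continuous (fun u => ?f (fst u)) x => apply (cont_comp f fst); [|apply cont_fst]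
  | |- forall x, continuous (fun u => ?f (snd u)) x => apply (cont_comp f snd); [|apply cont_snd]
  | |- continuous (fun v => @?f v) ?u => refine ((_ : forall u, continuous f u) u)
  end; try easy.

Lemma tame_psi k : tame (psi (S k)).
Proof.
  destruct (psi_bound (S k)) as [C [HC [_ [H2 H3]]]].
  apply tame_intro; [apply psi_continuous| |].
  - exists C. intros u Hu. eapply Rle_trans; [apply H3, Hu|].
    assert (HE := exp_le_1 u Hu). assert (P := pow_le_1 (exp u) k ltac:(lra)). simpl.
    apply Rmult_le_compat_l; nra.
  - exists C. intros u Hu. apply H2.
Qed.

Lemma tame_exp_psi_psi k l : tame (fun u => exp u * psi k u * psi l u).
Proof.
  destruct (psi_bound k) as [C [HC [H1 [H2 H3]]]].
  destruct (psi_bound l) as [D [HD [G1 [G2 G3]]]].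
  apply tame_intro; [cont| |]; exists (C * D); intros u Hu; assert (HE := exp_pos u);
    rewrite !Rabs_mult, (Rabs_pos_eq (exp u)) by lra.
  - rewrite Rmult_assoc, (Rmult_comm _ (exp u)). apply Rmult_le_compat_l; [lra|].
    apply Rmult_le_compat; try apply Rabs_pos; easy.
  - replace (C * D * exp (- u)) with (exp u * (C * exp (- u)) * (D * exp (- u))).
    + apply Rmult_le_compat; try easy; try apply Rabs_pos.
      * apply Rmult_le_pos; [lra|apply Rabs_pos].
      * apply Rmult_le_compat_l; [lra|easy].
    + rewrite exp_Ropp. field. lra.
Qed.

Lemma is_lim_seq_exp_opp : is_lim_seq (fun n => exp (- INR n)) 0.
Proof.
  apply (is_lim_seq_le_le (fun _ => 0) _ (fun n => exp (- INR n / 2))).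
  - intros n. split; [left; apply exp_pos|]. apply exp_le. assert (H := pos_INR n). lra.
  - apply is_lim_seq_const.
  - apply is_lim_seq_exp_half.
Qed.

Lemma is_lim_seq_exp_dist (u : nat -> R) l C :
  (forall n, Rabs (u n - l) <= C * exp (- INR n)) -> is_lim_seq u l.
Proof.
  intros H. apply (is_lim_seq_dist0 _ _ _ H). apply is_lim_seq_scal0, is_lim_seq_exp_opp.
Qed.

Lemma psi_0_lim :
  is_lim_seq (fun n => psi 0 (INR n)) 0 /\ is_lim_seq (fun n => psi 0 (- INR n)) (- / 2).
Proof.
  destruct (psi_bound 0) as [C [HC [_ [H2 _]]]]. destruct phi_lipschitz as [D [HD H3]].
  split.
  - apply (is_lim_seq_exp_dist _ _ C).
    intros n. rewrite Rminus_0_r. apply H2.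
  - apply (is_lim_seq_exp_dist _ _ D).
    intros n. assert (HE := exp_le_1 (- INR n) ltac:(assert (H := pos_INR n); lra)).
    replace (psi 0 (- INR n) - - / 2) with (phi 0 (exp (- INR n)) + / 2) by (unfold psi; simpl; ring).
    apply H3. lra.
Qed.

(** For [k = 0] it is the increase of [phi] from [-1/2] at 0 to 0 at infinity; each further
    derivative is removed by parts. *)
Lemma intR_psi k : intR (psi (S k)) = (-1) ^ k * INR (fact k) / 2.
Proof.
  induction k as [|k IH].
  - rewrite (intR_derive (psi 0) _ 0 (- / 2)).
    + simpl. field.
    + intros u. replace (psi 1 u) with (INR 0 * psi 0 u + psi 1 u) by (simpl; ring). apply psi_derive.
    + apply psi_continuous.
    + apply psi_0_lim.
    + apply psi_0_lim.
  - assert (H : intR (fun u => INR (S k) * psi (S k) u + psi (S (S k)) u) = 0).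
    { apply (intR_derive_tame (psi (S k))); [apply psi_derive|cont|apply tame_psi]. }
    rewrite intR_plus, intR_scal, IH in H; [|apply tame_psi|apply tame_scal, tame_psi|apply tame_psi].
    rewrite fact_simpl, mult_INR. change ((-1) ^ S k) with (-1 * (-1) ^ k). lra.
Qed.

(* Subtracting [psi 0] cancels the tail of [exp u * psi k], which tends to a nonzero constant. *)
Definition psi_gap (k : nat) (u : R) : R := exp u * ((-1) ^ k / INR (fact k) * psi k u - psi 0 u).

Lemma tame_psi_gap k : tame (psi_gap k).
Proof.
  destruct (psi_bound k) as [C [HC [H1 _]]].
  destruct (psi_bound 0) as [D [HD [G1 _]]].
  destruct (bose_bound k (S (S k))) as [C2 [HC2 H2]].
  destruct (bose_bound 0 2) as [RInt2 [HD2 G2]].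
  set (c := (-1) ^ k / INR (fact k)).
  assert (Hf := INR_fact_neq_0 k).
  assert (Hc2 := pow_m1_sqr k).
  apply tame_intro; [unfold psi_gap; cont| |].
  - exists (Rabs c * C + D). intros u Hu. unfold psi_gap. fold c.
    rewrite Rabs_mult, (Rabs_pos_eq (exp u)), Rmult_comm by (left; apply exp_pos).
    apply Rmult_le_compat_r; [left; apply exp_pos|].
    eapply Rle_trans; [apply Rabs_triang|]. rewrite Rabs_Ropp.
    apply Rplus_le_compat; [|apply G1]. rewrite Rabs_mult.
    apply Rmult_le_compat_l; [apply Rabs_pos|apply H1].
  - exists (Rabs c * C2 + RInt2). intros u Hu. assert (HE := exp_ge_1 u Hu).
    replace (psi_gap k u) with ((c * (exp u ^ S (S k) * bose k (exp u)) - exp u ^ 2 * bose 0 (exp u)) * exp (- u)).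
    + rewrite Rabs_mult, (Rabs_pos_eq (exp (- u))) by (left; apply exp_pos).
      apply Rmult_le_compat_r; [left; apply exp_pos|].
      eapply Rle_trans; [apply Rabs_triang|]. rewrite Rabs_Ropp.
      apply Rplus_le_compat.
      * rewrite Rabs_mult. apply Rmult_le_compat_l; [apply Rabs_pos|].
        rewrite Rabs_mult, Rabs_pos_eq by (apply pow_le; lra). apply H2, HE.
      * rewrite Rabs_mult, Rabs_pos_eq by (apply pow_le; lra). apply G2, HE.
    + unfold psi_gap. fold c.
      replace (exp u * (c * psi k u - psi 0 u)) with (c * (exp u * psi k u) - exp u * psi 0 u) by ring.
      rewrite !psi_bose, exp_Ropp.
      replace (c * (exp u ^ S k * bose k (exp u) - (-1) ^ k * INR (fact k)))
        with (c * (exp u ^ S k * bose k (exp u)) - (-1) ^ k * (-1) ^ k) by (unfold c; field; easy).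
      rewrite Hc2. simpl. field. lra.
Qed.

(** Consecutive gaps differ by the derivative of a multiple of [x psi_k]. At infinity [x psi_k]
    tends to [- (-1)^k k!], the contribution of the pole [1/x], and this boundary value gives the
    increment [1/(k+1)]. *)
Lemma intR_psi_gap k : intR (psi_gap k) = harm k.
Proof.
  induction k as [|k IH].
  - rewrite (intR_ext _ (fun _ => 0)); [apply intR_0|]. intros u. unfold psi_gap. simpl. field.
  - change (harm (S k)) with (harm k + / INR (S k)). rewrite <- IH.
    set (c := (-1) ^ S k / INR (fact (S k))).
    assert (HS : INR (S k) <> 0) by (apply not_0_INR; lia).
    assert (Hf := INR_fact_neq_0 k).
    assert (H : intR (fun u => psi_gap (S k) u - psi_gap k u) = c * (- ((-1) ^ k * INR (fact k))) - 0).
    { apply (intR_derive (fun u => c * (exp u * psi k u))).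
      - intros u. evar_last.
        + apply is_derive_scal. apply is_derive_mul;
            [apply is_derive_exp|apply psi_derive].
        + unfold plus, mult; simpl. unfold psi_gap, c.
          rewrite fact_simpl, mult_INR, S_INR. rewrite S_INR in HS. simpl pow. field. easy.
      - unfold psi_gap. cont.
      - apply (is_lim_seq_scal_l _ c (Finite _)).
        destruct (bose_bound k (S (S k))) as [C [HC H]].
        apply (is_lim_seq_exp_dist _ _ C).
        intros n. rewrite psi_bose.
        assert (HE := exp_ge_1 (INR n) (pos_INR n)). specialize (H _ HE).
        match goal with |- Rabs ?a <= _ =>
          replace a with (exp (INR n) ^ S k * bose k (exp (INR n))) by ring end.
        rewrite Rabs_mult, Rabs_pos_eq by (apply pow_le; lra). rewrite exp_Ropp.
        apply (Rmult_le_reg_r (exp (INR n))); [lra|].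
        replace (C * / exp (INR n) * exp (INR n)) with C by (field; lra). simpl in *. nra.
      - destruct (psi_bound k) as [C [HC [H1 _]]].
        apply is_lim_seq_scal0.
        apply (is_lim_seq_exp_dist _ _ C).
        intros n. rewrite Rminus_0_r, Rabs_mult, (Rabs_pos_eq (exp _)), Rmult_comm
          by (left; apply exp_pos).
        apply Rmult_le_compat_r; [left; apply exp_pos|apply H1]. }
    rewrite intR_minus in H by apply tame_psi_gap.
    assert (Hc : c * (- ((-1) ^ k * INR (fact k))) = / INR (S k)).
    { unfold c. rewrite fact_simpl, mult_INR. simpl pow.
      assert (Hc2 := pow_m1_sqr k).
      replace (-1 * (-1) ^ k / (INR (S k) * INR (fact k)) * - ((-1) ^ k * INR (fact k)))
        with ((-1) ^ k * (-1) ^ k / INR (S k)) by (field; easy).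
      rewrite Hc2. field. easy. }
    lra.
Qed.

(** Its integral in [u] is that of [x^(m+j-1) f^(m)] in [x]. Integration by parts lowers [m] and
    keeps [j]; convergence at 0 needs [j >= 2]. *)
Definition chi (m j : nat) (u : R) : R := exp u ^ (m + j) * bose m (exp u).

Lemma chi_derive m j u : is_derive (chi m j) u (INR (m + j) * chi m j u + chi (S m) j u).
Proof.
  unfold chi. evar_last.
  - apply is_derive_mul; [|apply (is_derive_comp (bose m) exp)].
    + apply is_derive_pow, is_derive_exp.
    + apply bose_dseq, exp_pos.
    + apply is_derive_exp.
  - unfold plus, mult, scal; simpl. unfold mult; simpl. destruct (m + j)%nat; simpl; ring.
Qed.

Lemma chi_continuous m j u : continuous (chi m j) u.
Proof. apply ex_derive_cont. eexists. apply chi_derive. Qed.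

Lemma tame_chi m j : tame (chi m (S (S j))).
Proof.
  destruct (phi_bounded m) as [C [HC H]].
  destruct (bose_bound m (S (m + S (S j)))) as [D [HD G]].
  apply tame_intro; [apply chi_continuous| |].
  - exists (C + INR (fact m)). intros u Hu. assert (HE := exp_le_1 u Hu).
    replace (chi m (S (S j)) u) with
      ((exp u ^ S (m + j) * phi m (exp u) + (-1) ^ m * INR (fact m) * exp u ^ j) * exp u).
    + rewrite Rabs_mult, (Rabs_pos_eq (exp u)) by lra. apply Rmult_le_compat_r; [lra|].
      eapply Rle_trans; [apply Rabs_triang|].
      assert (P1 := pow_le_1 (exp u) (S (m + j)) ltac:(lra)).
      assert (P2 := pow_le_1 (exp u) j ltac:(lra)).
      rewrite !Rabs_mult, pow_1_abs, (Rabs_pos_eq (INR _)), (Rabs_pos_eq (_ ^ S _)),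
        (Rabs_pos_eq (_ ^ _)) by (try apply pos_INR; lra).
      assert (P3 := pos_INR (fact m)). specialize (H (exp u) ltac:(lra)).
      assert (P4 := Rabs_pos (phi m (exp u))). nra.
    + unfold chi, bose. replace (m + S (S j))%nat with (S (S (m + j))) by lia.
      simpl. rewrite pow_add. field. repeat split; try apply pow_nonzero; lra.
  - exists D. intros u Hu. assert (HE := exp_ge_1 u Hu). specialize (G _ HE).
    rewrite exp_Ropp. apply (Rmult_le_reg_l (exp u)); [lra|].
    replace (exp u * (D * / exp u)) with D by (field; lra).
    unfold chi. rewrite Rabs_mult, Rabs_pos_eq by (apply pow_le; lra). simpl in G. nra.
Qed.

(** Each of the [m] integrations by parts contributes minus the current power of [x]; the factorial
    quotient is cleared to the left. *)
Lemma intR_chi m j :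
  intR (chi m (S (S j))) * INR (fact (S j)) = (-1) ^ m * INR (fact (m + S j)) * intR (chi 0 (S (S j))).
Proof.
  induction m as [|m IH]; [simpl; ring|].
  assert (H : intR (fun u => INR (m + S (S j)) * chi m (S (S j)) u + chi (S m) (S (S j)) u) = 0).
  { apply (intR_derive_tame (chi m (S (S j)))); [apply chi_derive| |apply tame_chi].
    apply cont_plus; [apply cont_mult; [apply cont_const|]|]; apply chi_continuous. }
  rewrite intR_plus, intR_scal in H; [|apply tame_chi|apply tame_scal, tame_chi|apply tame_chi].
  replace (intR (chi (S m) (S (S j)))) with (- (INR (m + S (S j)) * intR (chi m (S (S j))))) by lra.
  replace (m + S (S j))%nat with (S (m + S j)) by lia.
  change (S m + S j)%nat with (S (m + S j)). rewrite (fact_simpl (m + S j)), mult_INR.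
  change ((-1) ^ S m) with (-1 * (-1) ^ m).
  transitivity (- INR (S (m + S j)) * (intR (chi m (S (S j))) * INR (fact (S j)))); [ring|].
  rewrite IH. ring.
Qed.

(** In [x] its integral is minus that of [phi / 2 + (phi + 1/2) / x]. Either summand alone diverges
    logarithmically at infinity, with opposite signs. *)
Definition kappa (u : R) : R := - (exp u * psi 0 u / 2 + psi 0 u + / 2).

Lemma kappa_bose u :
  kappa u = exp (- u) - bose 0 (exp u) - exp u * bose 0 (exp u) / 2.
Proof.
  unfold kappa, psi, bose. rewrite exp_Ropp. assert (P := exp_pos u). simpl. field. lra.
Qed.

Lemma kappa_continuous u : continuous kappa u.
Proof. unfold kappa, Rdiv. cont. Qed.

Lemma kappa_bound : exists C, forall u, Rabs (kappa u) <= C * exp u.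
Proof.
  destruct phi_lipschitz as [D [HD H3]]. destruct (psi_bound 0) as [C [HC [H1 _]]].
  exists (C / 2 + D + C + / 2). intros u. unfold kappa. rewrite Rabs_Ropp.
  assert (P := exp_pos u). specialize (H1 u). apply Rabs_le_between in H1.
  replace (exp u * psi 0 u / 2 + psi 0 u + / 2) with (exp u * psi 0 u / 2 + (psi 0 u + / 2)) by ring.
  eapply Rle_trans; [apply Rabs_triang|].
  assert (Q1 : Rabs (exp u * psi 0 u / 2) <= C / 2 * exp u).
  { apply Rabs_le_between. nra. }
  assert (Q2 : Rabs (psi 0 u + / 2) <= (D + C + / 2) * exp u).
  { destruct (Rle_dec u 0) as [Hu|Hu].
    - assert (HE := exp_le_1 u Hu). specialize (H3 (exp u) ltac:(lra)).
      unfold psi. simpl pow. rewrite Rmult_1_l. nra.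
    - assert (HE := exp_ge_1 u ltac:(lra)). apply Rabs_le_between. nra. }
  lra.
Qed.

Lemma tame_kappa : tame kappa.
Proof.
  destruct kappa_bound as [C H].
  destruct (bose_bound 0 2) as [D [HD G]].
  apply tame_intro; [apply kappa_continuous|exists C; intros; apply H|].
  exists (1 + 2 * D). intros u Hu. rewrite kappa_bose. assert (HE := exp_ge_1 u Hu).
  specialize (G _ HE). rewrite Rabs_pos_eq in G by (left; apply bose_0_pos; lra).
  assert (P := bose_0_pos (exp u) ltac:(lra)). rewrite exp_Ropp in *.
  assert (Q : exp u * bose 0 (exp u) <= D * / exp u).
  { apply (Rmult_le_reg_r (exp u)); [lra|]. rewrite (Rmult_assoc D), Rinv_l by lra. simpl in G. lra. }
  assert (Q0 := Rinv_0_lt_compat _ (exp_pos u)).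
  apply Rabs_le_between. nra.
Qed.

(** The convolution identity at order 0 is [f^2 = - f - f'], so [x phi^2] is linear in [f] and
    [f']. *)
Lemma J_0 : intR (fun u => exp u * psi 0 u * psi 0 u) = 2 * intR kappa - / 2.
Proof.
  rewrite (intR_ext _ (fun u => 2 * kappa u - psi 1 u)).
  - rewrite intR_minus, intR_scal, intR_psi; [simpl; field|apply tame_kappa|apply tame_scal, tame_kappa|apply tame_psi].
  - intros u. assert (H := bose_convolution 0 (exp u) (exp_pos u)).
    simpl in H. rewrite Bernoulli_0 in H. unfold Binomial.C in H. simpl in H.
    assert (P := exp_pos u). rewrite kappa_bose. unfold psi. simpl.
    replace (phi 1 (exp u)) with (bose 1 (exp u) + / exp u ^ 2) by (unfold bose; simpl; field; lra).
    replace (phi 0 (exp u)) with (bose 0 (exp u) - / exp u) by (unfold bose; simpl; field; lra).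
    replace (bose 1 (exp u)) with (- (bose 0 (exp u) + 1) * bose 0 (exp u)) by lra.
    rewrite exp_Ropp. field. lra.
Qed.

(** [bose_convolution] makes [f f^(k)] linear in derivatives of [f]. The terms with [B_0] and [B_1],
    together with the poles removed in [phi], combine into [psi], [psi_gap] and [kappa]; the terms
    with [B_{i+2}] are multiples of [chi]. *)
Lemma J_S k : (1 <= k)%nat ->
  intR (fun u => exp u * psi k u * psi 0 u) =
  (-1) ^ k * INR (fact k) * (intR kappa - / (2 * INR (S k)) + / (2 * INR k) - harm k / 2)
  + bsum (k - 1) (fun i => (-1) ^ k * INR (fact k) * (Binomial.C (S k) (i + 2) / INR (S k))
       * Bernoulli (i + 2) * (intR (chi 0 (S (S i))) / INR (fact (S i)))).
Proof.
  intros Hk. destruct k as [|k]; [lia|]. clear Hk.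
  assert (HS : INR (S (S k)) <> 0) by (apply not_0_INR; lia).
  assert (HS1 : INR (S k) <> 0) by (apply not_0_INR; lia).
  assert (Hf := INR_fact_neq_0 (S k)).
  set (t := fun i u => Binomial.C (S (S k)) (i + 2) / INR (S (S k)) * Bernoulli (i + 2)
     * chi (k - i) (S (S i)) u).
  rewrite (intR_ext _ (fun u => - / INR (S (S k)) * psi (S (S k)) u + -1 * psi (S k) u
     + - ((-1) ^ S k * INR (fact (S k)) / 2) * psi_gap (S k) u
     + (-1) ^ S k * INR (fact (S k)) * kappa u
     + -1 * bsum k (fun i => t i u))).
  - assert (Ht : tame (fun u => bsum k (fun i => t i u))).
    { apply tame_bsum. intros i Hi. unfold t. apply tame_scal, tame_chi. }
    assert (H1 := tame_psi k). assert (H2 := tame_psi (S k)). assert (H3 := tame_psi_gap (S k)).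
    assert (H4 := tame_kappa).
    rewrite !intR_plus, !intR_scal, !intR_psi, intR_psi_gap, intR_bsum;
      repeat first [easy | apply tame_plus | apply tame_scal]; [|intros; apply tame_scal, tame_chi].
    rewrite fact_simpl, mult_INR. simpl (S k - 1)%nat. rewrite Nat.sub_0_r.
    rewrite <- bsum_scal. f_equal.
    + simpl pow. field. split; easy.
    + apply bsum_ext. intros i Hi. unfold t. rewrite intR_scal by apply tame_chi.
      assert (H5 := intR_chi (k - i) i).
      replace (k - i + S i)%nat with (S k) in H5 by lia.
      assert (Hi2 := INR_fact_neq_0 (S i)).
      replace (intR (chi (k - i) (S (S i)))) with
        ((-1) ^ (k - i) * INR (fact (S k)) * intR (chi 0 (S (S i))) / INR (fact (S i)))
        by (rewrite <- H5; field; easy).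
      (* Odd Bernoulli numbers beyond [B_1] vanish, so a sign [(-1)^(i+2)] may be inserted; with it
         the sign [(-1)^(k-i)] of [intR_chi] becomes independent of [i]. *)
      rewrite <- (Bernoulli_parity (i + 2)) at 1 by lia.
      assert (Hp : (-1) ^ (i + 2) * (-1) ^ (k - i) = (-1) ^ k).
      { rewrite <- pow_add. replace (i + 2 + (k - i))%nat with (2 + k)%nat by lia. simpl. ring. }
      rewrite fact_simpl, mult_INR.
      transitivity (-1 * ((-1) ^ (i + 2) * (-1) ^ (k - i)) *
         (Binomial.C (S (S k)) (i + 2) / INR (S (S k)) * Bernoulli (i + 2) *
         (INR (S k) * INR (fact k) * intR (chi 0 (S (S i))) / INR (fact (S i))))); [field; easy|].
      rewrite Hp. simpl pow. field. easy.
  - intros u. assert (P := exp_pos u).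
    assert (H := bose_convolution (S k) (exp u) P).
    rewrite !bsum_head in H. rewrite Bernoulli_0, Bernoulli_phi, phi_0_0 in H.
    replace (Binomial.C (S (S k)) 0) with 1 in H by (rewrite <- binom_C by lia; reflexivity).
    replace (Binomial.C (S (S k)) 1) with (INR (S (S k))) in H.
    2:{ rewrite <- binom_C, binom_1 by lia. reflexivity. }
    simpl (S (S k) - 0)%nat in H. simpl (S (S k) - 1)%nat in H.
    assert (HT : bsum k (fun i => t i u) = exp u ^ S (S k) / INR (S (S k)) *
       bsum k (fun i => Binomial.C (S (S k)) (S (S i)) *
          (Bernoulli (S (S i)) * bose (S (S k) - S (S i)) (exp u)))).
    { rewrite <- bsum_scal. apply bsum_ext. intros i Hi. unfold t, chi.
      replace (i + 2)%nat with (S (S i)) by lia.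
      replace (k - i + S (S i))%nat with (S (S k)) by lia. simpl (S (S k) - S (S i))%nat. field. easy. }
    rewrite HT.
    match type of H with _ = - (_ + (_ + ?s)) => replace s with
      (- (INR (S (S k)) * ((bose 0 (exp u) + 1) * bose (S k) (exp u))
        + 1 * (1 * bose (S (S k)) (exp u)) + INR (S (S k)) * (INR 1 * - / 2 * bose (S k) (exp u)))) by lra end.
    unfold psi_gap, kappa, psi, bose. rewrite !fact_simpl, !mult_INR. simpl pow.
    assert (Hf0 := INR_fact_neq_0 k). assert (Hp : exp u ^ k <> 0) by (apply pow_nonzero; lra).
    rewrite !S_INR in *. simpl (INR 0) in *. simpl (INR (fact 0)).
    assert (Hs := pow_m1_sqr k). set (s := (-1) ^ k) in *.
    (* As [s^2 = 1], one sign is moved to the denominator; the products of signs then cancel under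
       [field]. *)
    replace (-1 * s / ((INR k + 1) * INR (fact k))) with (-1 / (s * ((INR k + 1) * INR (fact k)))).
    2:{ assert (s <> 0) by (intros E; rewrite E in Hs; lra).
        apply (Rmult_eq_reg_l s); [|easy].
        transitivity (- (s * s) / ((INR k + 1) * INR (fact k))); [rewrite Hs; field; repeat split; easy|field; repeat split; easy]. }
    assert (s <> 0) by (intros E; rewrite E in Hs; lra).
    simpl (INR 1).
    field. repeat split; try easy; lra.
Qed.

(** * Zeta values and the constant ln (2 PI) - gamma *)

Definition expm (a u : R) : R := exp (- (a * exp u)).

Lemma expm_continuous a u : continuous (expm a) u.
Proof. unfold expm. cont. Qed.

Lemma expm_shift a u : 0 < a -> expm a u = expm 1 (u + ln a).
Proof. intros H. unfold expm. rewrite exp_plus, exp_ln by easy. f_equal. ring. Qed.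

Lemma expm_bounds a u : 0 < a -> 0 < expm a u <= 1.
Proof.
  intros H. split; [apply exp_pos|]. apply exp_le_1. assert (P := exp_pos u). nra.
Qed.

Lemma expm_near_1 a u : 0 <= a -> 0 <= 1 - expm a u <= a * exp u.
Proof.
  intros H. assert (P := exp_pos u). unfold expm.
  assert (H1 := exp_ineq1_le (- (a * exp u))). assert (H2 := exp_le_1 (- (a * exp u)) ltac:(nra)). lra.
Qed.

Lemma expm_small a u : 0 < a -> expm a u <= / a * exp (- u).
Proof.
  intros H. assert (P := exp_pos u). unfold expm. rewrite !exp_Ropp.
  rewrite <- Rinv_mult. apply Rinv_le_contravar; [nra|].
  assert (H1 := exp_ineq1_le (a * exp u)). lra.
Qed.

Lemma tame_gamma m : tame (fun u => exp u ^ S m * expm 1 u).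
Proof.
  apply tame_intro; [apply cont_mult; [cont|apply expm_continuous]| |].
  - exists 1. intros u Hu. assert (HE := exp_le_1 u Hu). assert (H := expm_bounds 1 u Rlt_0_1).
    assert (P := pow_le_1 (exp u) m ltac:(lra)). rewrite Rabs_pos_eq by (apply Rmult_le_pos; [apply pow_le|]; lra).
    simpl. apply Rle_trans with (exp u * 1 * 1); [|lra].
    apply Rmult_le_compat; [apply Rmult_le_pos; lra|lra|apply Rmult_le_compat_l; lra|lra].
  - assert (HS : 0 < INR (S (S m))) by (apply lt_0_INR; lia).
    exists (INR (S (S m)) ^ S (S m)). intros u Hu. assert (P := exp_pos u).
    assert (H := exp_minus_1_pow (S m) (exp u) ltac:(lra)).
    assert (PE := exp_pos (exp u)).
    assert (Q := pow_lt (exp u) (S m) P).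
    assert (PS : 0 < INR (S (S m)) ^ S (S m)) by (apply pow_lt; lra).
    rewrite Rabs_pos_eq by (apply Rmult_le_pos; [lra|left; apply exp_pos]).
    unfold expm. rewrite Rmult_1_l, !exp_Ropp.
    apply (Rmult_le_reg_r (exp (exp u) * exp u)); [nra|].
    replace (exp u ^ S m * / exp (exp u) * (exp (exp u) * exp u)) with (exp u ^ S (S m))
      by (simpl; field; lra).
    replace (INR (S (S m)) ^ S (S m) * / exp u * (exp (exp u) * exp u))
      with (INR (S (S m)) ^ S (S m) * exp (exp u)) by (field; lra).
    replace (exp u ^ S (S m)) with (INR (S (S m)) ^ S (S m) * (exp u / INR (S (S m))) ^ S (S m)).
    + apply Rmult_le_compat_l; lra.
    + rewrite <- Rpow_mult_distr. f_equal. field. lra.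
Qed.

Lemma intR_gamma_1 m : intR (fun u => exp u ^ S m * expm 1 u) = INR (fact m).
Proof.
  induction m as [|m IH].
  - rewrite (intR_derive (fun u => - expm 1 u) _ 0 (-1)).
    + simpl. ring.
    + intros u. unfold expm. auto_derive; [trivial|]. ring.
    + apply tame_gamma.
    + apply (is_lim_seq_exp_dist _ _ 1).
      intros n. rewrite Rminus_0_r, Rabs_Ropp, Rabs_pos_eq by (left; apply exp_pos).
      eapply Rle_trans; [apply expm_small; lra|]. rewrite Rinv_1. apply Rle_refl.
    + apply (is_lim_seq_exp_dist _ _ 1).
      intros n. assert (H := expm_near_1 1 (- INR n) Rle_0_1).
      replace (- expm 1 (- INR n) - -1) with (1 - expm 1 (- INR n)) by ring.
      rewrite Rabs_pos_eq; lra.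
  - assert (H : intR (fun u => INR (S m) * (exp u ^ S m * expm 1 u) - exp u ^ S (S m) * expm 1 u) = 0).
    { apply (intR_derive_tame (fun u => exp u ^ S m * expm 1 u)); [| |apply tame_gamma].
      - intros u. evar_last.
        + apply is_derive_mul; [apply is_derive_pow, is_derive_exp|].
          unfold expm. auto_derive; [trivial|reflexivity].
        + unfold plus, mult; simpl pred; cbn [plus]. unfold expm. simpl. ring.
      - apply cont_minus; [apply cont_mult; [apply cont_const|]|]; apply tame_gamma. }
    rewrite intR_minus, intR_scal, IH in H; [|apply tame_gamma|apply tame_scal, tame_gamma|apply tame_gamma].
    rewrite fact_simpl, mult_INR. lra.
Qed.

Lemma exp_pow_expm_shift m a u : 0 < a ->
  exp u ^ S m * expm a u = / a ^ S m * (exp (u + ln a) ^ S m * expm 1 (u + ln a)).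
Proof.
  intros Ha. rewrite <- expm_shift, exp_plus, exp_ln, Rpow_mult_distr by easy.
  field. apply pow_nonzero. lra.
Qed.

Lemma tame_gamma_a m a : 0 < a -> tame (fun u => exp u ^ S m * expm a u).
Proof.
  intros Ha. eapply tame_ext; [intros u; symmetry; apply exp_pow_expm_shift, Ha|].
  apply tame_scal. apply (tame_shift (fun v => exp v ^ S m * expm 1 v)), tame_gamma.
Qed.

Lemma intR_gamma m a : 0 < a -> intR (fun u => exp u ^ S m * expm a u) = INR (fact m) / a ^ S m.
Proof.
  intros Ha. rewrite (intR_ext _ _ (fun u => exp_pow_expm_shift m a u Ha)).
  rewrite (intR_scal (/ a ^ S m) (fun u => exp (u + ln a) ^ S m * expm 1 (u + ln a))).
  - rewrite (intR_shift (fun v => exp v ^ S m * expm 1 v)), intR_gamma_1 by apply tame_gamma.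
    unfold Rdiv. ring.
  - apply (tame_shift (fun v => exp v ^ S m * expm 1 v)), tame_gamma.
Qed.

Lemma expm_S n u : expm (INR (S n)) u * exp (exp u) = expm (INR n) u.
Proof. unfold expm. rewrite S_INR, <- exp_plus. f_equal. ring. Qed.

Lemma expm_diff_bose n u : (expm (INR n) u - expm (INR (S n)) u) * bose 0 (exp u) = expm (INR (S n)) u.
Proof.
  rewrite <- expm_S, bose_0 by apply exp_pos. field.
  assert (P := exp_pos u). assert (H := exp_ineq1 (exp u) ltac:(lra)). lra.
Qed.

Lemma bsum_expm n u :
  bsum n (fun i => expm (INR (S i)) u) = (1 - expm (INR n) u) * bose 0 (exp u).
Proof.
  induction n as [|n IH].
  - simpl. unfold expm. rewrite Rmult_0_l, Ropp_0, exp_0. ring.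
  - change (bsum (S n) ?F) with (bsum n F + F n). cbv beta. rewrite IH.
    assert (H := expm_diff_bose n u). lra.
Qed.

Lemma chi_0_bound j : exists C, forall u, Rabs (chi 0 (S (S j)) u) <= C * exp u.
Proof.
  destruct (bose_bound 0 (S j)) as [C [HC H]]. exists (1 + C). intros u.
  unfold chi. simpl (0 + _)%nat. assert (P := exp_pos u).
  assert (Q := bose_0_pos (exp u) P). change (exp u ^ S (S j)) with (exp u * exp u ^ S j).
  assert (R := pow_le (exp u) j ltac:(lra)).
  rewrite Rmult_assoc, Rabs_mult, (Rabs_pos_eq (exp u)), Rmult_comm by lra.
  apply Rmult_le_compat_r; [lra|].
  rewrite Rabs_mult, Rabs_pos_eq by (simpl; nra).
  destruct (Rle_dec u 0) as [Hu|Hu].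
  - assert (HE := exp_le_1 u Hu). assert (R1 := pow_le_1 (exp u) j ltac:(lra)).
    assert (Hx : exp u * bose 0 (exp u) <= 1).
    { rewrite bose_0 by easy. assert (H1 := exp_ineq1 (exp u) ltac:(lra)).
      apply (Rmult_le_reg_r (exp (exp u) - 1)); [lra|]. rewrite Rmult_assoc, Rinv_l; lra. }
    rewrite Rabs_pos_eq by lra. simpl. nra.
  - specialize (H (exp u) (exp_ge_1 u ltac:(lra))). lra.
Qed.

Lemma is_lim_seq_inv_S : is_lim_seq (fun n => / INR (S n)) 0.
Proof.
  apply (is_lim_seq_incr_1 (fun n => / INR n)).
  replace (Finite 0) with (Rbar_inv p_infty) by reflexivity.
  apply is_lim_seq_inv; [apply is_lim_seq_INR|discriminate].
Qed.

Lemma sum_n_bsum a n : sum_n a n = bsum (S n) a.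
Proof.
  induction n as [|n IH]; [rewrite sum_O; simpl; symmetry; apply Rplus_0_l|].
  rewrite sum_Sn, IH. reflexivity.
Qed.

(** The partial sum integrates [(1 - exp (- n x)) x^(j+2) f], a finite geometric sum. The remainder
    is bounded by the integral of [C x exp (- n x)], that is [C / n], so sum and integral are
    exchanged with an explicit rate. *)
Lemma is_series_zeta j :
  is_series (fun i => / INR (S i) ^ S (S j)) (intR (chi 0 (S (S j))) / INR (fact (S j))).
Proof.
  assert (Hf := INR_fact_neq_0 (S j)).
  assert (Hf0 : 0 < INR (fact (S j))) by (apply lt_0_INR, lt_O_fact).
  destruct (chi_0_bound j) as [C HC].
  assert (HS := INR_S_pos).
  assert (Hp : forall n, INR (fact (S j)) * bsum (S n) (fun i => / INR (S i) ^ S (S j)) =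
    intR (fun u => bsum (S n) (fun i => exp u ^ S (S j) * expm (INR (S i)) u))).
  { intros n. rewrite intR_bsum by (intros; apply tame_gamma_a, HS).
    rewrite <- bsum_scal. apply bsum_ext. intros i _. rewrite intR_gamma by apply HS. reflexivity. }
  apply (is_lim_seq_dist0 _ _ (fun n => (C / INR (fact (S j))) * / INR (S n))).
  2:{ apply is_lim_seq_scal0, is_lim_seq_inv_S. }
  intros n. rewrite sum_n_bsum.
  replace (bsum (S n) (fun i => / INR (S i) ^ S (S j)) - intR (chi 0 (S (S j))) / INR (fact (S j)))
    with (- (intR (chi 0 (S (S j))) - INR (fact (S j)) * bsum (S n) (fun i => / INR (S i) ^ S (S j)))
           * / INR (fact (S j))) by (field; easy).
  rewrite Rabs_mult, Rabs_Ropp, (Rabs_pos_eq (/ _)) by (left; apply Rinv_0_lt_compat; easy).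
  unfold Rdiv. replace (C * / INR (fact (S j)) * / INR (S n)) with (C * / INR (S n) * / INR (fact (S j))) by ring.
  apply Rmult_le_compat_r; [left; apply Rinv_0_lt_compat; easy|].
  assert (Hedb : tame (fun u => bsum (S n) (fun i => exp u ^ S (S j) * expm (INR (S i)) u))).
  { apply tame_bsum. intros. apply tame_gamma_a, HS. }
  rewrite Hp, <- intR_minus by (try apply tame_chi; exact Hedb).
  replace (C * / INR (S n)) with (intR (fun u => C * (exp u ^ 1 * expm (INR (S n)) u))).
  2:{ rewrite intR_scal, intR_gamma by (try apply tame_gamma_a; apply HS). simpl. field. apply Rgt_not_eq, HS. }
  apply intR_abs_le.
  - apply tame_minus; [apply tame_chi|exact Hedb].
  - apply tame_scal, tame_gamma_a, HS.
  - intros u. rewrite bsum_scal, bsum_expm.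
    replace (chi 0 (S (S j)) u - _) with (expm (INR (S n)) u * chi 0 (S (S j)) u)
      by (unfold chi; simpl (0 + _)%nat; ring).
    assert (H := expm_bounds (INR (S n)) u (HS n)).
    rewrite Rabs_mult, (Rabs_pos_eq (expm _ _)) by lra. specialize (HC u). simpl pow. nra.
Qed.

Lemma zeta_nat j :
  Re (zeta (INR (S (S j)), 0)) = intR (chi 0 (S (S j))) / INR (fact (S j)).
Proof.
  unfold zeta. destruct (Rlt_dec 1 (Re (INR (S (S j)), 0))) as [H|H].
  - unfold csum. simpl Re at 1. rewrite <- (is_series_unique _ _ (is_series_zeta j)).
    apply Series_ext. intros n. unfold cpow. unfold Re, Im, Copp, fst, snd.
    rewrite Ropp_0, Rmult_0_l, cos_0, Rmult_1_r.
    rewrite <- Ropp_mult_distr_l, exp_Ropp. f_equal.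
    rewrite <- Rpower_pow by (apply lt_0_INR; lia). reflexivity.
  - exfalso. apply H. change (1 < INR (S (S j))). rewrite !S_INR. assert (P := pos_INR j). lra.
Qed.

(** * Frullani integrals, truncated integrals of [kappa], and Euler's constant *)

Lemma tame_frullani a b : 0 < a -> 0 < b -> tame (fun u => expm a u - expm b u).
Proof.
  intros Ha Hb. apply tame_intro; [apply cont_minus; apply expm_continuous| |].
  - exists (a + b). intros u Hu. assert (H1 := expm_near_1 a u ltac:(lra)).
    assert (H2 := expm_near_1 b u ltac:(lra)). apply Rabs_le_between. nra.
  - exists (/ a + / b). intros u Hu. assert (H1 := expm_small a u Ha).
    assert (H2 := expm_small b u Hb). assert (H3 := expm_bounds a u Ha). assert (H4 := expm_bounds b u Hb).
    apply Rabs_le_between. nra.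
Qed.

(** The integrand is the derivative of [P (u + ln a) - P (u + ln b)], with [P] a primitive of
    [exp (- exp u)]. By the mean value theorem this difference tends to 0 at plus infinity and to
    [ln a - ln b] at minus infinity, where [P'] tends to 1. *)
Lemma intR_frullani a b : 0 < a -> 0 < b -> intR (fun u => expm a u - expm b u) = ln b - ln a.
Proof.
  intros Ha Hb.
  set (P := fun u => RInt (expm 1) 0 u).
  assert (HP : forall u, is_derive P u (expm 1 u)).
  { intros u. apply (is_derive_RInt (expm 1) P 0 u); [|apply expm_continuous].
    apply filter_forall. intros v. apply is_RInt_cont, expm_continuous. }
  set (M := Rabs (ln a) + Rabs (ln b)).
  assert (HQ : forall u, exists c, Rabs (c - u) <= M /\
    P (u + ln a) - P (u + ln b) = expm 1 c * (ln a - ln b)).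
  { intros u. destruct (MVT_gen P (u + ln b) (u + ln a) (expm 1)) as [c [Hc Heq]].
    - intros x _. apply HP.
    - intros x _. apply continuity_pt_filterlim. apply ex_derive_cont.
      eexists. apply HP.
    - exists c. split; [|rewrite Heq; ring].
      assert (H1 := Rabs_pos (ln a)). assert (H2 := Rabs_pos (ln b)).
      assert (H3 := Rle_abs (ln a)). assert (H4 := Rle_abs (ln b)).
      assert (H5 := Rle_abs (- ln a)). assert (H6 := Rle_abs (- ln b)).
      rewrite Rabs_Ropp in H5, H6.
      unfold Rmin, Rmax in Hc. apply Rabs_le_between. unfold M.
      destruct (Rle_dec (u + ln b) (u + ln a)); lra. }
  rewrite (intR_derive (fun u => P (u + ln a) - P (u + ln b)) _ 0 (ln a - ln b)).
  - ring.
  - intros u. rewrite (expm_shift a), (expm_shift b) by easy.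
    apply @is_derive_minus.
    + evar_last; [apply (is_derive_comp P (fun u => u + ln a)); [apply HP|auto_derive; [trivial|reflexivity]]|].
      unfold scal; simpl; unfold mult; simpl. ring.
    + evar_last; [apply (is_derive_comp P (fun u => u + ln b)); [apply HP|auto_derive; [trivial|reflexivity]]|].
      unfold scal; simpl; unfold mult; simpl. ring.
  - apply tame_frullani; easy.
  - apply (is_lim_seq_exp_dist _ _ (Rabs (ln a - ln b) * exp M)).
    intros n. destruct (HQ (INR n)) as [c [Hc ->]]. rewrite Rminus_0_r, Rabs_mult, Rmult_comm, Rmult_assoc.
    apply Rmult_le_compat_l; [apply Rabs_pos|].
    rewrite Rabs_pos_eq by (left; apply exp_pos).
    eapply Rle_trans; [apply expm_small; lra|]. rewrite Rinv_1, Rmult_1_l, <- exp_plus.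
    apply exp_le. apply Rabs_le_between in Hc. lra.
  - apply (is_lim_seq_exp_dist _ _ (Rabs (ln a - ln b) * exp M)).
    intros n. destruct (HQ (- INR n)) as [c [Hc ->]].
    replace (expm 1 c * (ln a - ln b) - (ln a - ln b)) with ((ln a - ln b) * - (1 - expm 1 c)) by ring.
    rewrite Rabs_mult, Rmult_assoc.
    apply Rmult_le_compat_l; [apply Rabs_pos|].
    assert (H := expm_near_1 1 c Rle_0_1). rewrite Rabs_Ropp, Rabs_pos_eq by lra.
    apply Rle_trans with (1 * exp c); [lra|]. rewrite Rmult_1_l, <- exp_plus.
    apply exp_le. apply Rabs_le_between in Hc. lra.
Qed.

Lemma ln_le_minus_1 x : 0 < x -> ln x <= x - 1.
Proof. intros H. assert (H1 := exp_ineq1_le (ln x)). rewrite exp_ln in H1; lra. Qed.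

Lemma expm_diff_continuous n u : continuous (fun u => exp (- u) * (expm (INR n) u - expm (INR (S n)) u)
   + INR n * expm (INR n) u - INR (S n) * expm (INR (S n)) u) u.
Proof. unfold expm. cont. Qed.

(** An exact derivative, which disposes of the [1/x] part in the step of [intR_kappa_n]. The value 1
    is the limit of [(exp (- n x) - exp (- (n+1) x)) / x] at [x = 0]. *)
Lemma intR_boundary n :
  intR (fun u => exp (- u) * (expm (INR n) u - expm (INR (S n)) u)
    + INR n * expm (INR n) u - INR (S n) * expm (INR (S n)) u) = 1.
Proof.
  assert (HS := INR_S_pos n). assert (Hn := pos_INR n).
  rewrite (intR_derive (fun u => - (exp (- u) * (expm (INR n) u - expm (INR (S n)) u))) _ 0 (-1)).
  - ring.
  - intros u. unfold expm. generalize (INR (S n)) as b, (INR n) as a. intros b a.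
    auto_derive; [trivial|]. rewrite (exp_Ropp u). assert (P := exp_pos u). field. lra.
  - apply expm_diff_continuous.
  - apply (is_lim_seq_exp_dist _ _ 1).
    intros m. assert (H1 := expm_near_1 (INR n) (INR m) Hn). assert (H2 := expm_bounds (INR (S n)) (INR m) HS).
    assert (H3 : 0 < expm (INR n) (INR m)) by apply exp_pos.
    rewrite Rminus_0_r, Rabs_Ropp, Rabs_mult, Rmult_comm, (Rabs_pos_eq (exp _)) by (left; apply exp_pos).
    apply Rmult_le_compat_r; [left; apply exp_pos|]. abs_lra.
  - apply (is_lim_seq_exp_dist _ _ (INR (S n))).
    intros m. set (u := - INR m). assert (P := exp_pos u).
    assert (H1 := expm_near_1 (INR (S n)) u ltac:(lra)).
    assert (H2 : expm (INR n) u - expm (INR (S n)) u <= exp u).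
    { rewrite S_INR. unfold expm. replace (- ((INR n + 1) * exp u)) with (- (INR n * exp u) + - exp u) by ring.
      rewrite exp_plus. assert (H3 := exp_ineq1_le (- exp u)).
      assert (H4 := exp_le_1 (- (INR n * exp u)) ltac:(nra)). nra. }
    assert (H3 : exp u * expm (INR (S n)) u <= expm (INR n) u - expm (INR (S n)) u).
    { rewrite <- (expm_S n). assert (H4 := exp_ineq1_le (exp u)).
      assert (H5 : 0 < expm (INR (S n)) u) by apply exp_pos. nra. }
    replace (exp (- u)) with (/ exp u) by (symmetry; apply exp_Ropp).
    set (d := expm (INR n) u - expm (INR (S n)) u) in *.
    replace (- (/ exp u * d) - -1) with ((exp u - d) * / exp u) by (field; lra).
    assert (Q := Rinv_0_lt_compat _ P).
    rewrite Rabs_mult, (Rabs_pos_eq (/ _)), Rabs_pos_eq by lra.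
    apply (Rmult_le_reg_r (exp u)); [lra|]. rewrite Rmult_assoc, Rinv_l, Rmult_1_r by lra. nra.
Qed.

(** Going from [n] to [n + 1] multiplies [kappa] by [exp (- n x) - exp (- (n+1) x)], which removes
    the denominator of [f] ([expm_diff_bose]). The increment is therefore elementary: a boundary
    term, a Frullani integral and a Gamma integral. *)
Lemma intR_kappa_n n :
  intR (fun u => (1 - expm (INR n) u) * kappa u) = ln (INR (fact n)) - INR n * ln (INR n) + INR n - harm n / 2.
Proof.
  assert (Hed : forall n, tame (fun u => (1 - expm (INR n) u) * kappa u)).
  { intros m. apply (tame_bounded_mult _ _ 1); [| |apply tame_kappa].
    - apply cont_minus; [apply cont_const|apply expm_continuous].
    - intros u. assert (H := expm_near_1 (INR m) u (pos_INR m)). assert (H2 : 0 < expm (INR m) u) by apply exp_pos.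
      abs_lra. }
  induction n as [|n IH].
  - rewrite (intR_ext _ (fun _ => 0)); [rewrite intR_0; unfold harm; simpl; rewrite ln_1; field|].
    intros u. unfold expm. simpl. rewrite Rmult_0_l, Ropp_0, exp_0. ring.
  - assert (HS := INR_S_pos n).
    assert (Hfr : tame (fun u => INR n * (expm (INR n) u - expm (INR (S n)) u)) /\
       intR (fun u => INR n * (expm (INR n) u - expm (INR (S n)) u)) = INR n * (ln (INR (S n)) - ln (INR n))).
    (* Frullani's formula needs a positive rate; at [n = 0] the factor [INR n] removes the term,
       whatever [ln 0] is. *)
    { destruct n as [|n].
      - split; [apply (tame_ext (fun _ => 0)); [intros; simpl; ring|apply tame_0]|].
        rewrite (intR_ext _ (fun _ => 0)) by (intros; simpl; ring). rewrite intR_0. simpl. ring.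
      - assert (HS' : 0 < INR (S n)) by (apply lt_0_INR; lia).
        split; [apply tame_scal, tame_frullani; easy|].
        rewrite intR_scal by (apply tame_frullani; easy). rewrite intR_frullani by easy. reflexivity. }
    destruct Hfr as [Hfe Hfr].
    assert (Hg : tame (fun u => - / 2 * (exp u ^ 1 * expm (INR (S n)) u))) by (apply tame_scal, tame_gamma_a, HS).
    assert (Hb : forall u, exp (- u) * (expm (INR n) u - expm (INR (S n)) u)
         + INR n * expm (INR n) u - INR (S n) * expm (INR (S n)) u =
        ((1 - expm (INR (S n)) u) * kappa u - (1 - expm (INR n) u) * kappa u)
         + INR n * (expm (INR n) u - expm (INR (S n)) u) - (- / 2 * (exp u ^ 1 * expm (INR (S n)) u))).
    { intros u. rewrite kappa_bose. assert (H := expm_diff_bose n u). rewrite S_INR in *.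
      set (a := expm (INR n) u) in *. set (b := expm (INR n + 1) u) in *. set (f := bose 0 (exp u)) in *.
      rewrite pow_1.
      replace ((1 - b) * (exp (- u) - f - exp u * f / 2) - (1 - a) * (exp (- u) - f - exp u * f / 2))
        with (exp (- u) * (a - b) - ((a - b) * f) - exp u * ((a - b) * f) / 2) by field.
      rewrite H. field. }
    assert (H := intR_boundary n). rewrite (intR_ext _ _ Hb) in H.
    rewrite intR_minus, intR_plus, intR_minus, Hfr, IH, intR_scal, intR_gamma in H;
      repeat first [easy | apply Hed | apply tame_minus | apply tame_plus | apply tame_gamma_a].
    change (harm (S n)) with (harm n + / INR (S n)).
    rewrite fact_simpl, mult_INR, ln_mult by (apply lt_0_INR; first [apply lt_O_fact | lia]).
    change (INR (fact 0)) with 1 in H. rewrite pow_1 in H.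
    rewrite S_INR in *. unfold Rdiv in H. lra.
Qed.

(** The discarded part is at most the integral of [C x exp (- (n+1) x)], because
    [|kappa| <= C x]. *)
Lemma is_lim_kappa_n :
  is_lim_seq (fun n => ln (INR (fact (S n))) - INR (S n) * ln (INR (S n)) + INR (S n) - harm (S n) / 2) (intR kappa).
Proof.
  destruct kappa_bound as [C HC].
  apply (is_lim_seq_dist0 _ _ (fun n => C * / INR (S n))); [|apply is_lim_seq_scal0, is_lim_seq_inv_S].
  intros n. assert (HS := INR_S_pos n).
  rewrite <- intR_kappa_n.
  assert (Hk := tame_kappa).
  assert (Hek : tame (fun u => expm (INR (S n)) u * kappa u)).
  { apply (tame_bounded_mult _ _ 1); [apply expm_continuous| |easy].
    intros u. assert (H := expm_bounds (INR (S n)) u HS). rewrite Rabs_pos_eq; lra. }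
  rewrite (intR_ext _ (fun u => kappa u - expm (INR (S n)) u * kappa u)) by (intros; ring).
  rewrite intR_minus by easy.
  match goal with |- Rabs ?a <= _ => replace a with (- intR (fun u => expm (INR (S n)) u * kappa u)) by ring end.
  rewrite Rabs_Ropp.
  replace (C * / INR (S n)) with (intR (fun u => C * (exp u ^ 1 * expm (INR (S n)) u))).
  2:{ rewrite intR_scal, intR_gamma by (try apply tame_gamma_a; apply HS). simpl. field. apply Rgt_not_eq, HS. }
  apply intR_abs_le; [easy|apply tame_scal, tame_gamma_a, HS|].
  intros u. assert (H := expm_bounds (INR (S n)) u HS).
  rewrite Rabs_mult, (Rabs_pos_eq (expm _ _)) by lra. specialize (HC u). simpl pow. nra.
Qed.

(** [euler_gamma] is the real part of a [Lim_seq], so convergence has to be supplied: by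
    [ln x <= x - 1] the sequence decreases and is nonnegative. *)
Lemma is_lim_euler_gamma : is_lim_seq (fun n => harm (S n) - ln (INR (S n))) euler_gamma.
Proof.
  assert (E : forall n, sumR 1 n (fun k => / INR k) - ln (INR n) = harm n - ln (INR n)).
  { intros n. rewrite sumR_bsum. rewrite Nat.sub_succ, Nat.sub_0_r. reflexivity. }
  assert (HS := INR_S_pos).
  assert (H : ex_finite_lim_seq (fun n => harm (S n) - ln (INR (S n)))).
  { apply (ex_finite_lim_seq_decr _ 0).
    - intros n. change (harm (S (S n))) with (harm (S n) + / INR (S (S n))).
      assert (H := ln_le_minus_1 (INR (S n) / INR (S (S n))) (Rdiv_lt_0_compat _ _ (HS n) (HS (S n)))).
      rewrite ln_div in H by apply HS.
      replace (INR (S n) / INR (S (S n)) - 1) with (- / INR (S (S n))) in H; [lra|].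
      assert (H1 := HS (S n)). rewrite (S_INR (S n)) in *. field. lra.
    - intros n. assert (H : forall m, ln (INR (S m)) <= harm m).
      { induction m as [|m IH]; [simpl; rewrite ln_1; unfold harm; simpl; lra|].
        change (harm (S m)) with (harm m + / INR (S m)).
        assert (H := ln_le_minus_1 (INR (S (S m)) / INR (S m)) (Rdiv_lt_0_compat _ _ (HS (S m)) (HS m))).
        rewrite ln_div in H by apply HS.
        replace (INR (S (S m)) / INR (S m) - 1) with (/ INR (S m)) in H; [lra|].
        assert (H1 := HS m). rewrite (S_INR (S m)) in *. field. lra. }
      specialize (H (S n)). assert (H1 : ln (INR (S n)) <= ln (INR (S (S n)))).
      { apply Rcomplements.ln_le; [apply HS|apply le_INR; lia]. }
      lra. }
  destruct H as [l H]. replace euler_gamma with l; [exact H|].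
  unfold euler_gamma. rewrite (Lim_seq_ext _ _ E).
  rewrite (is_lim_seq_unique _ l); [reflexivity|].
  apply is_lim_seq_incr_1. exact H.
Qed.

(** * Wallis integrals and Stirling's constant *)

Lemma cosh_ge u : 2 * cosh u >= exp (Rabs u).
Proof.
  unfold cosh. assert (P := exp_pos u). assert (Q := exp_pos (- u)).
  unfold Rabs. destruct (Rcase_abs u); lra.
Qed.

(** Under [theta = 2 atan (exp u)] this is the integral of [sin^(n-1)] over [[0, PI]]; the
    hyperbolic form fits [intR]. *)
Definition wallis (n : nat) : R := intR (fun u => (/ cosh u) ^ n).

Lemma cosh_ge_1 u : 1 <= cosh u.
Proof.
  unfold cosh. rewrite exp_Ropp. assert (P := exp_pos u).
  assert (H : exp u + / exp u - 2 = (exp u - 1) ^ 2 * / exp u) by (field; lra).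
  assert (H2 := Rinv_0_lt_compat _ P).
  assert (H3 := Rmult_le_pos _ _ (pow2_ge_0 (exp u - 1)) (Rlt_le _ _ H2)). lra.
Qed.

Lemma sech_bounds u : 0 < / cosh u <= 1.
Proof.
  assert (H := cosh_ge_1 u). split; [apply Rinv_0_lt_compat; lra|].
  rewrite <- Rinv_1. apply Rinv_le_contravar; lra.
Qed.

Lemma sech_continuous u : continuous (fun u => / cosh u) u.
Proof.
  apply ex_derive_cont. unfold cosh. auto_derive.
  assert (H := cosh_ge_1 u). unfold cosh in H. lra.
Qed.

Lemma tame_sech n : tame (fun u => (/ cosh u) ^ S n).
Proof.
  split; [apply cont_pow, sech_continuous|]. exists 2. intros u.
  assert (H := sech_bounds u). assert (P := pow_le_1 (/ cosh u) n ltac:(lra)).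
  rewrite Rabs_pos_eq by (simpl; nra). apply Rle_trans with (/ cosh u); [simpl; nra|].
  assert (H1 := cosh_ge u). assert (H2 := cosh_ge_1 u).
  assert (H3 : exp (Rabs u / 2) <= exp (Rabs u)) by (apply exp_le; assert (Q := Rabs_pos u); lra).
  replace (- Rabs u / 2) with (- (Rabs u / 2)) by field. rewrite exp_Ropp.
  assert (Q := exp_pos (Rabs u / 2)).
  apply (Rmult_le_reg_r (cosh u)); [lra|]. rewrite Rinv_l by lra.
  apply (Rmult_le_reg_r (exp (Rabs u / 2))); [lra|].
  replace (2 * / exp (Rabs u / 2) * cosh u * exp (Rabs u / 2)) with (2 * cosh u) by (field; lra). lra.
Qed.

Lemma wallis_1 : wallis 1 = PI.
Proof.
  assert (Hc : continuous atan 0).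
  { apply ex_derive_cont. auto_derive. trivial. }
  assert (Hm : is_lim_seq (fun n => atan (exp (- INR n))) 0).
  { rewrite <- atan_0. apply (is_lim_seq_continuous atan _ 0); [|apply is_lim_seq_exp_opp].
    apply continuity_pt_filterlim, Hc. }
  unfold wallis. rewrite (intR_derive (fun u => 2 * atan (exp u)) _ PI 0).
  - ring.
  - intros u. unfold cosh. auto_derive; [trivial|]. rewrite exp_Ropp. assert (P := exp_pos u).
    field. repeat split; apply Rgt_not_eq; nra.
  - apply tame_sech.
  - apply (is_lim_seq_ext (fun n => PI - 2 * atan (exp (- INR n)))).
    + intros n. rewrite exp_Ropp, atan_inv by apply exp_pos. field.
    + replace (Finite PI) with (Finite (PI - 0)) by (f_equal; ring).
      apply is_lim_seq_minus'; [apply is_lim_seq_const|apply is_lim_seq_scal0, Hm].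
  - apply is_lim_seq_scal0, Hm.
Qed.

Lemma sinh_cosh_sqr u : sinh u * sinh u = cosh u * cosh u - 1.
Proof.
  unfold sinh, cosh. rewrite exp_Ropp. assert (P := exp_pos u). field. lra.
Qed.

Lemma is_derive_sinh u : is_derive sinh u (cosh u).
Proof. unfold sinh, cosh. auto_derive; [trivial|field]. Qed.

Lemma is_derive_cosh u : is_derive cosh u (sinh u).
Proof. unfold sinh, cosh. auto_derive; [trivial|field]. Qed.

Lemma wallis_2 : wallis 2 = 2.
Proof.
  assert (Hb : forall u, 0 <= u -> Rabs (sinh u / cosh u - 1) <= 2 * exp (- u)).
  { intros u Hu. assert (H := cosh_ge_1 u). assert (Q := exp_pos (- u)).
    replace (sinh u / cosh u - 1) with (- (exp (- u) / cosh u)) by (unfold sinh, cosh in *; field; lra).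
    rewrite Rabs_Ropp. unfold Rdiv. assert (P := sech_bounds u).
    rewrite Rabs_mult, !Rabs_pos_eq by lra. nra. }
  unfold wallis. rewrite (intR_derive (fun u => sinh u / cosh u) _ 1 (-1)).
  - ring.
  - intros u. assert (H := cosh_ge_1 u). evar_last.
    + apply is_derive_div; [apply is_derive_sinh|apply is_derive_cosh|lra].
    + replace (cosh u * cosh u - sinh u * sinh u) with 1 by (rewrite sinh_cosh_sqr; ring).
      field. lra.
  - apply tame_sech.
  - apply (is_lim_seq_exp_dist _ _ 2).
    intros n. apply Hb, pos_INR.
  - apply (is_lim_seq_exp_dist _ _ 2).
    intros n. replace (sinh (- INR n) / cosh (- INR n) - -1) with (- (sinh (INR n) / cosh (INR n) - 1)).
    + rewrite Rabs_Ropp. apply Hb, pos_INR.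
    + unfold sinh, cosh. rewrite Ropp_involutive. assert (P := exp_pos (INR n)).
      assert (Q := exp_pos (- INR n)). field. lra.
Qed.

Lemma wallis_rec n : INR (S (S n)) * wallis (S (S (S n))) = INR (S n) * wallis (S n).
Proof.
  assert (H : intR (fun u => INR (S (S n)) * (/ cosh u) ^ S (S (S n)) - INR (S n) * (/ cosh u) ^ S n) = 0).
  { apply (intR_derive_tame (fun u => sinh u * (/ cosh u) ^ S (S n))).
    - intros u. assert (H := cosh_ge_1 u). evar_last.
      + apply is_derive_mul; [apply is_derive_sinh|].
        apply is_derive_pow. apply is_derive_inv; [apply is_derive_cosh|lra].
      + unfold plus, mult; simpl pred. cbn [plus].
        change (@AbelianMonoid.sort R_AbelianMonoid) with R.
        assert (H1 := sinh_cosh_sqr u).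
        set (c := cosh u) in *. set (s := sinh u) in *.
        rewrite (S_INR (S n)). generalize (INR (S n)) as M. intros M. simpl. set (p := (/ c) ^ n).
        transitivity (p * / c * (1 - (M + 1) * (s * s) / (c * c))); [field; lra|].
        rewrite H1. field. lra.
    - apply cont_minus; (apply cont_mult; [apply cont_const|apply tame_sech]).
    - apply (tame_ext (fun u => (sinh u * / cosh u) * (/ cosh u) ^ S n)); [intros; simpl; ring|].
      apply (tame_bounded_mult _ _ 1); [| |apply tame_sech].
      + apply cont_mult; [unfold sinh, Rdiv; cont|apply sech_continuous].
      + intros u. assert (P := sech_bounds u). assert (P2 := cosh_ge_1 u).
        apply (Rmult_le_reg_r (cosh u)); [lra|].
        rewrite Rabs_mult, (Rabs_pos_eq (/ _)), Rmult_assoc, Rinv_l by lra.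
        assert (Q1 := exp_pos u). assert (Q2 := exp_pos (- u)).
        unfold sinh, cosh. rewrite Rmult_1_r. abs_lra. }
  rewrite intR_minus, !intR_scal in H by (try apply tame_scal; apply tame_sech).
  unfold wallis. lra.
Qed.

Lemma wallis_product n : INR (S n) * wallis (S n) * wallis (S (S n)) = 2 * PI.
Proof.
  induction n as [|n IH]; [rewrite wallis_1, wallis_2; simpl; ring|].
  rewrite <- IH. transitivity ((INR (S (S n)) * wallis (S (S (S n)))) * wallis (S (S n))); [ring|].
  rewrite wallis_rec. ring.
Qed.

Lemma wallis_decr n : wallis (S (S n)) <= wallis (S n).
Proof.
  apply intR_le; try apply tame_sech. intros u. assert (H := sech_bounds u).
  assert (P := pow_le (/ cosh u) (S n) ltac:(lra)). simpl in *. nra.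
Qed.

Lemma wallis_pos n : 0 < wallis (S n).
Proof.
  assert (H0 : 0 <= wallis (S n)).
  { rewrite <- intR_0. apply intR_le; [apply tame_0|apply tame_sech|].
    intros u. apply pow_le. left. apply sech_bounds. }
  destruct H0 as [H0|H0]; [exact H0|]. assert (H := wallis_product n). rewrite <- H0 in H.
  assert (P := PI_RGT_0). lra.
Qed.

Lemma wallis_even n :
  wallis (2 * S n) = 4 ^ S n * INR (fact (S n)) ^ 2 / (INR (S n) * INR (fact (2 * S n))).
Proof.
  induction n as [|n IH]; [simpl; rewrite wallis_2; field|].
  assert (H := wallis_rec (2 * n + 1)).
  replace (S (S (S (2 * n + 1)))) with (2 * S (S n))%nat in H by lia.
  replace (S (2 * n + 1)) with (2 * S n)%nat in H by lia. rewrite IH in H.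
  assert (H1 : INR (fact (S n)) <> 0) by apply INR_fact_neq_0.
  assert (H2 : INR (fact (2 * S n)) <> 0) by apply INR_fact_neq_0.
  replace (fact (2 * S (S n))) with (S (S (2 * S n)) * (S (2 * S n) * fact (2 * S n)))%nat
    by (replace (2 * S (S n))%nat with (S (S (2 * S n))) by lia; reflexivity).
  rewrite (fact_simpl (S n)). rewrite !mult_INR. rewrite (S_INR (S (2 * S n))).
  rewrite (S_INR (2 * S n)) in *. rewrite (mult_INR 2 (S n)) in *.
  rewrite (S_INR (S n)). simpl (INR 2) in *. assert (P := lt_0_INR (S n) ltac:(lia)).
  set (x := INR (S n)) in *.
  apply (Rmult_eq_reg_l ((1 + 1) * x + 1)); [|lra]. rewrite H. simpl pow. field. repeat split; lra || easy.
Qed.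

(** With [w] the even integral of index [2n + 2], monotonicity between its two odd neighbours in
    [wallis_product] gives [PI <= (n+1) w^2] and [(2n+1) w^2 <= 2 PI]. *)
Lemma is_lim_wallis : is_lim_seq (fun n => INR (S n) * wallis (2 * S n) ^ 2) PI.
Proof.
  assert (HP := PI_RGT_0).
  apply (is_lim_seq_dist0 _ _ (fun n => PI * / INR (S n))); [|apply is_lim_seq_scal0, is_lim_seq_inv_S].
  intros n.
  assert (Hs : (2 * S n = S (S (2 * n)))%nat) by lia. rewrite Hs.
  assert (H1 := wallis_product (S (2 * n))). assert (H2 := wallis_product (2 * n)).
  assert (D1 := wallis_decr (S (2 * n))). assert (RInt2 := wallis_decr (2 * n)).
  assert (P1 := wallis_pos (2 * n)). assert (P2 := wallis_pos (S (2 * n))).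
  assert (P3 := wallis_pos (S (S (2 * n)))).
  rewrite <- Hs in H1 at 1. rewrite mult_INR in H1. simpl (INR 2) in H1.
  rewrite !S_INR, mult_INR in H2. simpl (INR 2) in H2. rewrite S_INR in *.
  assert (Pn := pos_INR n).
  set (w := wallis (S (S (2 * n)))) in *. set (x := INR n) in *.
  assert (B1 : PI <= (x + 1) * w ^ 2) by (simpl; nra).
  assert (B2 : (2 * x + 1) * w ^ 2 <= 2 * PI).
  { simpl. rewrite <- H2. nra. }
  rewrite Rabs_pos_eq by lra.
  apply (Rmult_le_reg_r (x + 1)); [lra|]. rewrite Rmult_assoc, Rinv_l by lra. simpl in *. nra.
Qed.

(** [sigma] is the remainder in Stirling's formula; it converges because the truncated integrals of
    [kappa] do. Its limit is then also that of twice the remainder at [m] minus the remainder at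
    [2m], which is the logarithm of a Wallis quotient. *)
Lemma intR_kappa : intR kappa = (ln (2 * PI) - euler_gamma) / 2.
Proof.
  set (sigma := fun n => ln (INR (fact (S n))) - (INR (S n) + / 2) * ln (INR (S n)) + INR (S n)).
  assert (HS := INR_S_pos).
  assert (HP := PI_RGT_0).
  assert (L1 : is_lim_seq sigma (intR kappa + euler_gamma / 2)).
  { eapply is_lim_seq_ext; [|apply is_lim_seq_plus'; [apply is_lim_kappa_n|]].
    2:{ apply (is_lim_seq_ext (fun n => / 2 * (harm (S n) - ln (INR (S n))))).
        - intros n. reflexivity.
        - replace (Finite (euler_gamma / 2)) with (Rbar_mult (/ 2) euler_gamma) by (simpl; f_equal; field).
          apply is_lim_seq_scal_l, is_lim_euler_gamma. }
    intros n. unfold sigma. cbv beta. field. }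
  (* [sigma n] is the remainder at [n + 1], so the index [2n + 1] is the remainder at
     [2 (n + 1)]. *)
  assert (L2 : is_lim_seq (fun n => sigma (2 * n + 1)%nat) (intR kappa + euler_gamma / 2)).
  { apply (is_lim_seq_subseq sigma _ (fun n => (2 * n + 1)%nat)); [|exact L1].
    apply eventually_subseq. intros n. lia. }
  assert (L3 : is_lim_seq (fun n => 2 * sigma n - sigma (2 * n + 1)%nat) (intR kappa + euler_gamma / 2)).
  { replace (Finite (intR kappa + euler_gamma / 2)) with
      (Finite (2 * (intR kappa + euler_gamma / 2) - (intR kappa + euler_gamma / 2))) by (f_equal; ring).
    apply is_lim_seq_minus'; [|exact L2]. apply (is_lim_seq_scal_l sigma 2 (Finite _)), L1. }
  assert (L4 : is_lim_seq (fun n => 2 * sigma n - sigma (2 * n + 1)%nat) (/ 2 * ln PI + / 2 * ln 2)).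
  { apply (is_lim_seq_ext (fun n => / 2 * ln (INR (S n) * wallis (2 * S n) ^ 2) + / 2 * ln 2)).
    - intros n. assert (PW := wallis_pos (S (2 * n))). replace (S (S (2 * n))) with (2 * S n)%nat in PW by lia.
      rewrite ln_mult, ln_pow by (try apply pow_lt; easy).
      rewrite wallis_even.
      assert (PF1 : 0 < INR (fact (S n))) by apply lt_0_INR, lt_O_fact.
      assert (PF2 : 0 < INR (fact (2 * S n))) by apply lt_0_INR, lt_O_fact.
      assert (P4 : 0 < 4 ^ S n) by (apply pow_lt; lra).
      assert (P5 : 0 < INR (fact (S n)) ^ 2) by (apply pow_lt; lra).
      assert (P6 : 0 < 4 ^ S n * INR (fact (S n)) ^ 2) by (apply Rmult_lt_0_compat; easy).
      rewrite ln_div by (try apply Rmult_lt_0_compat; easy).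
      rewrite !ln_mult by easy. rewrite !ln_pow by lra.
      unfold sigma. replace (S (2 * n + 1)) with (2 * S n)%nat by lia.
      replace (ln 4) with (2 * ln 2).
      2:{ replace 4 with (2 * 2) by ring. rewrite ln_mult by lra. ring. }
      rewrite !(mult_INR 2 (S n)). simpl (INR 2). rewrite (ln_mult (1 + 1)) by (try easy; lra).
      replace (1 + 1) with 2 by ring. field.
    - apply is_lim_seq_plus'; [|apply is_lim_seq_const].
      apply (is_lim_seq_scal_l _ (/ 2) (Finite _)).
      apply (is_lim_seq_continuous ln _ PI); [|apply is_lim_wallis].
      apply continuity_pt_filterlim. apply ex_derive_cont. auto_derive. exact HP. }
  apply is_lim_seq_unique in L3. apply is_lim_seq_unique in L4. rewrite L3 in L4.
  injection L4 as L4. rewrite ln_mult by lra. lra.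
Qed.

(** * The damped energy of a truncated function *)

Definition cont2 (f : R -> R -> R) : Prop :=
  forall p : R * R, continuous (fun q : R * R => f (fst q) (snd q)) p.

Lemma cont2_pt f x y : cont2 f -> continuity_2d_pt f x y.
Proof. intros H. apply continuity_2d_pt_filterlim. apply (H (x, y)). Qed.

Lemma cont2_r f x : cont2 f -> forall y, continuous (fun y => f x y) y.
Proof.
  intros H y. apply (continuous_comp (fun y => (x, y)) (fun q : R * R => f (fst q) (snd q))); [|apply H].
  intros P [eps HP]. exists eps. intros z Hz. apply HP. split; [apply ball_center|exact Hz].
Qed.

Lemma cont2_swap f : cont2 f -> cont2 (fun y x => f x y).
Proof.
  intros H p. apply (continuous_comp (fun p : R * R => (snd p, fst p)) (fun q : R * R => f (fst q) (snd q))); [|apply H].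
  intros P [eps HP]. exists eps. intros z Hz. apply HP. split; apply Hz.
Qed.

Lemma cont2_l f y : cont2 f -> forall x, continuous (fun x => f x y) x.
Proof. intros H. apply (cont2_r (fun y x => f x y)), cont2_swap, H. Qed.

Lemma RInt_scal_cont (k : R -> R) c a b :
  (forall u, continuous k u) -> RInt (fun u => c * k u) a b = c * RInt k a b.
Proof. intros H. apply (RInt_scal k). apply ex_RInt_cont, H. Qed.

Lemma RInt_plus_cont (f g : R -> R) a b :
  (forall u, continuous f u) -> (forall u, continuous g u) ->
  RInt (fun u => f u + g u) a b = RInt f a b + RInt g a b.
Proof. intros H1 H2. apply (RInt_plus f g); apply ex_RInt_cont; easy. Qed.

Lemma RInt_minus_cont (f g : R -> R) a b :
  (forall u, continuous f u) -> (forall u, continuous g u) ->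
  RInt (fun u => f u - g u) a b = RInt f a b - RInt g a b.
Proof. intros H1 H2. apply (RInt_minus f g); apply ex_RInt_cont; easy. Qed.

Lemma RInt_le_cont (f g : R -> R) a b :
  a <= b -> (forall u, continuous f u) -> (forall u, continuous g u) ->
  (forall u, a <= u <= b -> f u <= g u) -> RInt f a b <= RInt g a b.
Proof.
  intros Hab H1 H2 H. apply RInt_le; try easy; try (apply ex_RInt_cont; easy).
  intros x Hx. apply H. lra.
Qed.

Lemma RInt_ext_all (f g : R -> R) a b : (forall u, f u = g u) -> RInt f a b = RInt g a b.
Proof. intros H. apply RInt_ext. intros; apply H. Qed.

Lemma RInt_param_cont f a b : cont2 f -> forall x, continuous (fun x => RInt (f x) a b) x.
Proof.
  intros Hf.
  assert (Hle : forall a b, a <= b -> forall x, continuous (fun x => RInt (f x) a b) x).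
  { clear a b. intros a b Hab x. apply filterlim_locally. intros eps.
    assert (He : 0 < eps / (b - a + 1)) by (apply Rdiv_lt_0_compat; [apply cond_pos|lra]).
    destruct (uniform_continuity_2d_1d' f a b x) with (eps := mkposreal _ He) as [delta Hd].
    { intros y _. apply cont2_pt, Hf. }
    exists delta. intros v Hv. change (Rabs (v - x) < delta) in Hv. apply Rabs_lt_between in Hv.
    change (Rabs (RInt (f v) a b - RInt (f x) a b) < eps).
    assert (Hc : forall x y, continuous (f x) y) by (intros; apply cont2_r, Hf).
    rewrite <- RInt_minus_cont by apply Hc.
    apply Rle_lt_trans with ((b - a) * (eps / (b - a + 1))).
    - apply abs_RInt_le_const; [easy|apply ex_RInt_cont, cont_minus; apply Hc|].
      intros t Ht. assert (P := cond_pos delta). left.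
      apply (Hd t x t v); try lra. rewrite Rminus_diag, Rabs_R0. lra.
    - assert (P := cond_pos eps). apply (Rmult_lt_reg_r (b - a + 1)); [lra|].
      replace ((b - a) * (eps / (b - a + 1)) * (b - a + 1)) with ((b - a) * eps) by (field; lra). nra. }
  destruct (Rle_dec a b) as [H|H]; [apply Hle, H|].
  intros x. apply (continuous_ext (fun x => - RInt (f x) b a)).
  - intros y. apply (opp_RInt_swap (f y)). apply ex_RInt_cont, cont2_r, Hf.
  - apply (continuous_opp (fun x => RInt (f x) b a)), Hle. lra.
Qed.

Lemma is_derive_RInt_cont (k : R -> R) a x :
  (forall u, continuous k u) -> is_derive (fun z => RInt k a z) x (k x).
Proof.
  intros H. apply (is_derive_RInt k (fun z => RInt k a z) a x); [|apply H].
  apply filter_forall. intros z. apply is_RInt_cont, H.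
Qed.

(** As functions of the upper limit [b] both sides vanish at [a] and have the same derivative. *)
Lemma fubini_rect f a b c d :
  cont2 f ->
  RInt (fun x => RInt (fun y => f x y) c d) a b = RInt (fun y => RInt (fun x => f x y) a b) c d.
Proof.
  intros Hf.
  set (Psi := fun z => RInt (fun y => RInt (fun x => f x y) a z) c d).
  assert (Hr : forall x y, continuous (fun y => f x y) y) by (intros; apply cont2_r, Hf).
  assert (Hl : forall y x, continuous (fun x => f x y) x) by (intros; apply cont2_l, Hf).
  assert (Hh : forall y z, is_derive (fun z => RInt (fun x => f x y) a z) z (f z y)).
  { intros y z. apply (is_derive_RInt_cont (fun x => f x y)), Hl. }
  assert (HPsi : forall z, is_derive Psi z (RInt (fun y => f z y) c d)).
  { intros z. evar_last.
    - apply (is_derive_RInt_param (fun z y => RInt (fun x => f x y) a z) c d z).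
      + apply filter_forall. intros u t _. eexists. apply Hh.
      + intros t _. apply (continuity_2d_pt_ext f); [|apply cont2_pt, Hf].
        intros u v. symmetry. apply is_derive_unique, Hh.
      + apply filter_forall. intros u. apply ex_RInt_cont.
        apply (RInt_param_cont (fun y x => f x y) a u), cont2_swap, Hf.
    - apply RInt_ext_all. intros y. apply is_derive_unique, Hh. }
  rewrite (RInt_derive_cont Psi (fun z => RInt (fun y => f z y) c d) a b HPsi (RInt_param_cont f c d Hf)).
  unfold Psi. rewrite (RInt_ext_all (fun y => RInt (fun x => f x y) a a) (fun _ => 0)).
  - rewrite RInt_const. unfold scal; simpl; unfold mult; simpl. ring.
  - intros y. apply (RInt_point a (fun x => f x y)).
Qed.

Definition Fcos_on (G : R -> R) (L t : R) : R := RInt (fun u => G u * cos (t * u)) (- L) L.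
Definition Fsin_on (G : R -> R) (L t : R) : R := RInt (fun u => G u * sin (t * u)) (- L) L.
(* The weight [exp (- e t)] replaces the Dirichlet kernel by the positive Poisson kernel. *)
Definition damped_cos (e A w : R) : R := RInt (fun t => exp (- (e * t)) * cos (t * w)) 0 A.

Lemma Fcos_on_continuous G L : (forall u, continuous G u) -> forall t, continuous (Fcos_on G L) t.
Proof.
  intros H. apply (RInt_param_cont (fun t u => G u * cos (t * u))). unfold cont2. cont.
Qed.

Lemma Fsin_on_continuous G L : (forall u, continuous G u) -> forall t, continuous (Fsin_on G L) t.
Proof.
  intros H. apply (RInt_param_cont (fun t u => G u * sin (t * u))). unfold cont2. cont.
Qed.

Lemma damped_cos_continuous e A : forall w, continuous (damped_cos e A) w.
Proof.
  apply (RInt_param_cont (fun w t => exp (- (e * t)) * cos (t * w))). unfold cont2. cont.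
Qed.

(** Squares are opened as double integrals, and [cos (t u) cos (t v) + sin (t u) sin (t v) = cos (t
    (u - v))]; the [t] integral is then done first. *)
Lemma weighted_energy G L e A :
  (forall u, continuous G u) ->
  RInt (fun t => exp (- (e * t)) * (Fcos_on G L t ^ 2 + Fsin_on G L t ^ 2)) 0 A =
  RInt (fun u => RInt (fun v => G u * G v * damped_cos e A (u - v)) (- L) L) (- L) L.
Proof.
  intros HG. assert (HC := Fcos_on_continuous G L HG). assert (HS := Fsin_on_continuous G L HG).
  set (f := fun t u => exp (- (e * t)) * (G u * (cos (t * u) * Fcos_on G L t + sin (t * u) * Fsin_on G L t))).
  assert (Hf : cont2 f) by (unfold cont2, f; cont).
  transitivity (RInt (fun t => RInt (fun u => f t u) (- L) L) 0 A).
  - apply RInt_ext_all. intros t. unfold f.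
    rewrite (RInt_ext_all _ (fun u => exp (- (e * t)) * Fcos_on G L t * (G u * cos (t * u))
      + exp (- (e * t)) * Fsin_on G L t * (G u * sin (t * u)))) by (intros; ring).
    rewrite RInt_plus_cont, !RInt_scal_cont by cont. fold (Fcos_on G L t). fold (Fsin_on G L t). ring.
  - rewrite fubini_rect by exact Hf. apply RInt_ext_all. intros u.
    set (h := fun t v => exp (- (e * t)) * (G v * cos (t * (u - v)))).
    assert (Hh : cont2 h) by (unfold cont2, h; cont).
    transitivity (G u * RInt (fun t => RInt (fun v => h t v) (- L) L) 0 A).
    + rewrite <- RInt_scal_cont by (apply RInt_param_cont, Hh).
      apply RInt_ext_all. intros t. unfold f, h. rewrite RInt_scal_cont by cont.
      rewrite (RInt_ext_all (fun v => G v * cos (t * (u - v)))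
        (fun v => cos (t * u) * (G v * cos (t * v)) + sin (t * u) * (G v * sin (t * v)))).
      * rewrite RInt_plus_cont, !RInt_scal_cont by cont. fold (Fcos_on G L t). fold (Fsin_on G L t). ring.
      * intros v. rewrite Rmult_minus_distr_l, cos_minus. ring.
    + rewrite fubini_rect by exact Hh. rewrite <- RInt_scal_cont.
      2:{ apply (RInt_param_cont (fun v t => h t v)), cont2_swap, Hh. }
      apply RInt_ext_all. intros v. unfold damped_cos.
      rewrite <- !RInt_scal_cont by (unfold h; cont). apply RInt_ext_all. intros t. unfold h. ring.
Qed.

Definition poisson (e w : R) : R := e / (e * e + w * w).

Lemma sqr_sum_pos e w : 0 < e -> 0 < e * e + w * w.
Proof. intros H. nra. Qed.

Lemma damped_cos_poisson e A w :
  0 < e -> Rabs (damped_cos e A w - poisson e w) <= 2 / e * exp (- (e * A)).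
Proof.
  intros He. assert (Hd : 0 < e * e + w * w) by nra.
  assert (H : damped_cos e A w = exp (- (e * A)) * (w * sin (A * w) - e * cos (A * w)) / (e * e + w * w)
     + poisson e w).
  { unfold damped_cos.
    rewrite (RInt_derive_cont (fun t => exp (- (e * t)) * (w * sin (t * w) - e * cos (t * w)) / (e * e + w * w))).
    - rewrite Rmult_0_r, Ropp_0, exp_0, Rmult_0_l, sin_0, cos_0. unfold poisson. field. lra.
    - intros t. auto_derive; [trivial|]. field. lra.
    - cont. }
  rewrite H. replace (_ + poisson e w - poisson e w) with
    (exp (- (e * A)) * ((w * sin (A * w) - e * cos (A * w)) / (e * e + w * w))) by (unfold Rdiv; ring).
  assert (P := exp_pos (- (e * A))).
  rewrite Rabs_mult, (Rabs_pos_eq (exp _)), Rmult_comm by lra. apply Rmult_le_compat_r; [lra|].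
  unfold Rdiv. rewrite Rabs_mult, (Rabs_pos_eq (/ _)) by (left; apply Rinv_0_lt_compat; lra).
  apply (Rmult_le_reg_r (e * e + w * w)); [easy|]. rewrite Rmult_assoc, Rinv_l, Rmult_1_r by lra.
  apply (Rmult_le_reg_r e); [easy|].
  replace (2 * / e * (e * e + w * w) * e) with (2 * (e * e + w * w)) by (field; lra).
  assert (H1 : Rabs (w * sin (A * w) - e * cos (A * w)) <= Rabs w + e).
  { eapply Rle_trans; [apply Rabs_triang|]. rewrite Rabs_Ropp, !Rabs_mult, (Rabs_pos_eq e) by lra.
    assert (S1 := SIN_bound (A * w)). assert (S2 := COS_bound (A * w)).
    apply Rabs_le_between in S1. apply Rabs_le_between in S2. assert (Q := Rabs_pos w). nra. }
  assert (H2 : Rabs w * Rabs w = w * w) by (rewrite <- Rabs_mult; apply Rabs_pos_eq; nra).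
  apply Rle_trans with ((Rabs w + e) * e); [apply Rmult_le_compat_r; lra|].
  assert (Q := pow2_ge_0 (Rabs w - e)). nra.
Qed.

Lemma poisson_continuous e : 0 < e -> forall w, continuous (poisson e) w.
Proof.
  intros He w. apply ex_derive_cont. unfold poisson. auto_derive. nra.
Qed.

Lemma poisson_pos e w : 0 < e -> 0 < poisson e w.
Proof. intros He. apply Rdiv_lt_0_compat; nra. Qed.

Lemma RInt_poisson e L u :
  0 < e -> RInt (fun v => poisson e (u - v)) (- L) L = atan ((L - u) / e) + atan ((L + u) / e).
Proof.
  intros He. rewrite (RInt_derive_cont (fun v => - atan ((u - v) / e))).
  - replace ((u - L) / e) with (- ((L - u) / e)) by (field; lra). rewrite atan_opp.
    replace (u - - L) with (L + u) by ring.
    match goal with |- ?a = ?b => change (@eq R a b) end. ring.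
  - intros v. unfold poisson. auto_derive; [trivial|]. field.
    split; apply Rgt_not_eq; [apply sqr_sum_pos|]; easy.
  - apply (cont_comp (poisson e) (fun v => u - v)); [apply poisson_continuous, He|cont].
Qed.

Definition RInt2 (L : R) (f : R -> R -> R) : R := RInt (fun u => RInt (fun v => f u v) (- L) L) (- L) L.

Lemma RInt2_ext L f g : (forall u v, f u v = g u v) -> RInt2 L f = RInt2 L g.
Proof. intros H. apply RInt_ext_all. intros u. apply RInt_ext_all. apply H. Qed.

Lemma RInt2_le L f g : 0 <= L -> cont2 f -> cont2 g ->
  (forall u v, f u v <= g u v) -> RInt2 L f <= RInt2 L g.
Proof.
  intros HL Hf Hg H. apply RInt_le_cont; [lra|apply RInt_param_cont, Hf|apply RInt_param_cont, Hg|].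
  intros u _. apply RInt_le_cont; [lra|apply cont2_r, Hf|apply cont2_r, Hg|]. intros; apply H.
Qed.

Lemma RInt2_plus L f g : cont2 f -> cont2 g -> RInt2 L (fun u v => f u v + g u v) = RInt2 L f + RInt2 L g.
Proof.
  intros Hf Hg. unfold RInt2. rewrite <- RInt_plus_cont.
  - apply RInt_ext_all. intros u. apply RInt_plus_cont; [apply cont2_r, Hf|apply cont2_r, Hg].
  - apply (RInt_param_cont f), Hf.
  - apply (RInt_param_cont g), Hg.
Qed.

Lemma RInt2_scal L c f : cont2 f -> RInt2 L (fun u v => c * f u v) = c * RInt2 L f.
Proof.
  intros Hf. unfold RInt2. rewrite <- RInt_scal_cont by (apply (RInt_param_cont f), Hf).
  apply RInt_ext_all. intros u. apply RInt_scal_cont, cont2_r, Hf.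
Qed.

Lemma RInt2_const L c : RInt2 L (fun _ _ => c) = c * (2 * L) ^ 2.
Proof.
  unfold RInt2. rewrite !RInt_const. unfold scal; simpl; unfold mult; simpl. ring.
Qed.

Lemma RInt2_bound L f B : 0 <= L -> cont2 f -> (forall u v, Rabs (f u v) <= B) ->
  Rabs (RInt2 L f) <= B * (2 * L) ^ 2.
Proof.
  intros HL Hf H. replace (B * (2 * L) ^ 2) with ((L - - L) * ((L - - L) * B)) by ring.
  apply abs_RInt_le_const; [lra|apply ex_RInt_cont, RInt_param_cont, Hf|]. intros u _.
  apply abs_RInt_le_const; [lra|apply ex_RInt_cont, cont2_r, Hf|]. intros; apply H.
Qed.

Lemma RInt2_swap L f : cont2 f -> RInt2 L f = RInt2 L (fun u v => f v u).
Proof. intros Hf. unfold RInt2. apply fubini_rect, Hf. Qed.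

Lemma cont2_poisson e : 0 < e -> cont2 (fun u v => poisson e (u - v)).
Proof.
  intros He. unfold cont2. apply (cont_comp (poisson e) (fun q : R * R => fst q - snd q));
    [apply poisson_continuous, He|cont].
Qed.

Lemma cont2_damped_cos e A : cont2 (fun u v => damped_cos e A (u - v)).
Proof.
  unfold cont2. apply (cont_comp (damped_cos e A) (fun q : R * R => fst q - snd q));
    [apply damped_cos_continuous|cont].
Qed.

Definition poisson_form (G : R -> R) (L e : R) : R := RInt2 L (fun u v => G u * G v * poisson e (u - v)).

Lemma weighted_energy_poisson G L e A M :
  (forall u, continuous G u) -> (forall u, Rabs (G u) <= M) -> 0 < e -> 0 <= L ->
  Rabs (RInt (fun t => exp (- (e * t)) * (Fcos_on G L t ^ 2 + Fsin_on G L t ^ 2)) 0 A - poisson_form G L e)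
  <= M * M * (2 / e) * (2 * L) ^ 2 * exp (- (e * A)).
Proof.
  intros HG HM He HL. rewrite weighted_energy by easy.
  fold (RInt2 L (fun u v => G u * G v * damped_cos e A (u - v))). unfold poisson_form.
  assert (HP := cont2_poisson e He). assert (HK := cont2_damped_cos e A). unfold cont2 in HP, HK.
  set (B := M * M * (2 / e * exp (- (e * A)))).
  assert (HM0 : 0 <= M) by (eapply Rle_trans; [apply Rabs_pos|apply (HM 0)]).
  assert (H : forall u v, Rabs (G u * G v * damped_cos e A (u - v) - G u * G v * poisson e (u - v)) <= B).
  { intros u v. rewrite <- Rmult_minus_distr_l, !Rabs_mult.
    apply Rmult_le_compat; [apply Rmult_le_pos; apply Rabs_pos|apply Rabs_pos| |apply damped_cos_poisson, He].
    apply Rmult_le_compat; try apply Rabs_pos; apply HM. }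
  assert (Hc1 : cont2 (fun u v => G u * G v * damped_cos e A (u - v))) by (unfold cont2; cont).
  assert (Hc2 : cont2 (fun u v => G u * G v * poisson e (u - v))) by (unfold cont2; cont).
  replace (M * M * (2 / e) * (2 * L) ^ 2 * exp (- (e * A))) with (B * (2 * L) ^ 2) by (unfold B; ring).
  eapply Rle_trans; [|apply (RInt2_bound L (fun u v => G u * G v * damped_cos e A (u - v)
    - G u * G v * poisson e (u - v)) B HL); [|exact H]; unfold cont2; cont].
  right. f_equal.
  transitivity (RInt2 L (fun u v => G u * G v * damped_cos e A (u - v) + -1 * (G u * G v * poisson e (u - v)))).
  - rewrite RInt2_plus, RInt2_scal by (unfold cont2; cont). ring.
  - apply RInt2_ext. intros; ring.
Qed.

(* [G u G v = (G u ^ 2 + G v ^ 2 - (G u - G v) ^ 2) / 2] reduces the form to its diagonal part. *)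
Lemma poisson_form_diag G L e :
  (forall u, continuous G u) -> 0 < e ->
  poisson_form G L e = RInt (fun u => G u ^ 2 * (atan ((L - u) / e) + atan ((L + u) / e))) (- L) L
    - / 2 * RInt2 L (fun u v => (G u - G v) ^ 2 * poisson e (u - v)).
Proof.
  intros HG He. assert (HP := cont2_poisson e He). unfold cont2 in HP.
  unfold poisson_form.
  assert (Hc1 : cont2 (fun u v => G u ^ 2 * poisson e (u - v))) by (unfold cont2; cont).
  assert (Hc2 : cont2 (fun u v => G v ^ 2 * poisson e (u - v))) by (unfold cont2; cont).
  assert (Hc3 : cont2 (fun u v => (G u - G v) ^ 2 * poisson e (u - v))) by (unfold cont2; cont).
  rewrite (RInt2_ext _ _ (fun u v => / 2 * (G u ^ 2 * poisson e (u - v)) + / 2 * (G v ^ 2 * poisson e (u - v))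
     + - / 2 * ((G u - G v) ^ 2 * poisson e (u - v)))) by (intros; field).
  rewrite !RInt2_plus, !RInt2_scal by (try easy; unfold cont2; cont).
  rewrite (RInt2_swap L (fun u v => G v ^ 2 * poisson e (u - v))) by easy.
  rewrite (RInt2_ext L (fun u v => G u ^ 2 * poisson e (v - u)) (fun u v => G u ^ 2 * poisson e (u - v))).
  2:{ intros u v. unfold poisson. f_equal. f_equal. ring. }
  replace (RInt (fun u => G u ^ 2 * (atan ((L - u) / e) + atan ((L + u) / e))) (- L) L)
    with (RInt2 L (fun u v => G u ^ 2 * poisson e (u - v))); [field|].
  unfold RInt2. apply RInt_ext_all. intros u. rewrite RInt_scal_cont, RInt_poisson; try easy.
  apply (cont2_r (fun u v => poisson e (u - v))), cont2_poisson, He.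
Qed.

Lemma atan_lt_PI2 x : - (PI / 2) < atan x < PI / 2.
Proof. assert (H := atan_bound x). lra. Qed.

Lemma atan_le x y : x <= y -> atan x <= atan y.
Proof. intros [H| ->]; [left; apply atan_increasing, H|apply Rle_refl]. Qed.

Lemma cont_atan_sum L e : forall u, continuous (fun u => atan ((L - u) / e) + atan ((L + u) / e)) u.
Proof.
  apply cont_plus; unfold Rdiv; intros u; apply (@ex_derive_continuous _ R_NormedModule);
    auto_derive; trivial.
Qed.

(** The off-diagonal part is nonnegative and the sum of the two arctangents is below [PI]. *)
Lemma poisson_form_le G L e :
  (forall u, continuous G u) -> 0 < e -> 0 <= L ->
  poisson_form G L e <= PI * RInt (fun u => G u ^ 2) (- L) L.
Proof.
  intros HG He HL. rewrite poisson_form_diag by easy.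
  assert (HP := cont2_poisson e He). unfold cont2 in HP.
  assert (H1 : 0 <= RInt2 L (fun u v => (G u - G v) ^ 2 * poisson e (u - v))).
  { replace 0 with (RInt2 L (fun _ _ => 0)) by (rewrite RInt2_const; ring).
    apply RInt2_le; [easy|unfold cont2; cont|unfold cont2; cont|].
    intros u v. apply Rmult_le_pos; [apply pow2_ge_0|left; apply poisson_pos, He]. }
  assert (H2 : RInt (fun u => G u ^ 2 * (atan ((L - u) / e) + atan ((L + u) / e))) (- L) L
     <= PI * RInt (fun u => G u ^ 2) (- L) L).
  { rewrite <- RInt_scal_cont by cont. apply RInt_le_cont; [lra| |cont|].
    - apply cont_mult; [cont|apply cont_atan_sum].
    - intros u _. assert (A1 := atan_lt_PI2 ((L - u) / e)). assert (A2 := atan_lt_PI2 ((L + u) / e)).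
      rewrite Rmult_comm. apply Rmult_le_compat_r; [apply pow2_ge_0|lra]. }
  lra.
Qed.

(** The Lipschitz bound and [e w^2 / (e^2 + w^2) <= e] make the off-diagonal part [O(e)]. For
    [|u| <= L - 1] both arctangents have arguments at least [1/e]; this is why the window shrinks by
    1. *)
Lemma poisson_form_ge G L e c :
  (forall u, continuous G u) -> (forall u v, Rabs (G u - G v) <= c * Rabs (u - v)) ->
  0 < e -> 1 <= L ->
  2 * atan (/ e) * RInt (fun u => G u ^ 2) (- (L - 1)) (L - 1) - / 2 * (c ^ 2 * (2 * L) ^ 2) * e
  <= poisson_form G L e.
Proof.
  intros HG Hc He HL. rewrite poisson_form_diag by easy.
  assert (HP := cont2_poisson e He). unfold cont2 in HP.
  assert (H1 : RInt2 L (fun u v => (G u - G v) ^ 2 * poisson e (u - v)) <= c ^ 2 * e * (2 * L) ^ 2).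
  { rewrite <- RInt2_const. apply RInt2_le; [lra|unfold cont2; cont|unfold cont2; cont|].
    intros u v. unfold poisson. assert (Hd := sqr_sum_pos e (u - v) He).
    apply (Rmult_le_reg_r (e * e + (u - v) * (u - v))); [easy|].
    replace ((G u - G v) ^ 2 * (e / (e * e + (u - v) * (u - v))) * (e * e + (u - v) * (u - v)))
      with ((G u - G v) ^ 2 * e) by (field; lra).
    assert (H : (G u - G v) ^ 2 <= c ^ 2 * ((u - v) * (u - v))).
    { rewrite <- (pow2_abs (G u - G v)).
      replace (c ^ 2 * ((u - v) * (u - v))) with ((c * Rabs (u - v)) ^ 2)
        by (rewrite Rpow_mult_distr, pow2_abs; ring).
      apply pow_incr. split; [apply Rabs_pos|apply Hc]. }
    assert (Q := pow2_ge_0 c).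
    apply Rle_trans with (c ^ 2 * ((u - v) * (u - v)) * e); [apply Rmult_le_compat_r; lra|].
    replace (c ^ 2 * e * (e * e + (u - v) * (u - v))) with (c ^ 2 * ((u - v) * (u - v)) * e + c ^ 2 * e * (e * e)) by ring.
    assert (Q2 := Rmult_le_pos _ _ (Rmult_le_pos _ _ Q (Rlt_le _ _ He)) (Rle_0_sqr e)).
    unfold Rsqr in Q2. lra. }
  set (h := fun u => G u ^ 2 * (atan ((L - u) / e) + atan ((L + u) / e))).
  assert (Hh : forall u, continuous h u) by (apply cont_mult; [cont|apply cont_atan_sum]).
  assert (Hinv := Rinv_0_lt_compat _ He).
  assert (Hpos : forall u, - L <= u <= L -> 0 <= h u).
  { intros u Hu. apply Rmult_le_pos; [apply pow2_ge_0|].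
    apply Rplus_le_le_0_compat; rewrite <- atan_0; apply atan_le; apply Rmult_le_pos; lra. }
  assert (H2 : 2 * atan (/ e) * RInt (fun u => G u ^ 2) (- (L - 1)) (L - 1) <= RInt h (- L) L).
  { rewrite <- (RInt_Chasles_cont h (- L) (- (L - 1)) L Hh), <- (RInt_Chasles_cont h (- (L - 1)) (L - 1) L Hh).
    assert (P1 : 0 <= RInt h (- L) (- (L - 1))).
    { apply RInt_ge_0; [lra|apply ex_RInt_cont, Hh|intros; apply Hpos; lra]. }
    assert (P2 : 0 <= RInt h (L - 1) L).
    { apply RInt_ge_0; [lra|apply ex_RInt_cont, Hh|intros; apply Hpos; lra]. }
    assert (P3 : 2 * atan (/ e) * RInt (fun u => G u ^ 2) (- (L - 1)) (L - 1) <= RInt h (- (L - 1)) (L - 1)).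
    { rewrite <- RInt_scal_cont by cont. apply RInt_le_cont; [lra|cont|exact Hh|].
      intros u Hu. unfold h. rewrite Rmult_comm. apply Rmult_le_compat_l; [apply pow2_ge_0|].
      assert (A1 : atan (/ e) <= atan ((L - u) / e)).
      { apply atan_le. unfold Rdiv. apply Rle_trans with (1 * / e); [lra|]. apply Rmult_le_compat_r; lra. }
      assert (A2 : atan (/ e) <= atan ((L + u) / e)).
      { apply atan_le. unfold Rdiv. apply Rle_trans with (1 * / e); [lra|]. apply Rmult_le_compat_r; lra. }
      lra. }
    lra. }
  apply Rplus_le_compat; [exact H2|]. apply Ropp_le_contravar.
  replace (/ 2 * (c ^ 2 * (2 * L) ^ 2) * e) with (/ 2 * (c ^ 2 * e * (2 * L) ^ 2)) by ring.
  apply Rmult_le_compat_l; [lra|exact H1].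
Qed.

(** * Plancherel's formula *)

Definition energy (G : R -> R) (L A : R) : R := RInt (fun t => Fcos_on G L t ^ 2 + Fsin_on G L t ^ 2) 0 A.

Lemma is_lim_seq_exp_scal e a : 0 < e -> is_lim_seq (fun n => exp (- (e * (a + INR n)))) 0.
Proof.
  intros He. apply (is_lim_seq_ext (fun n => exp (- (e * a)) * exp (- e) ^ n)).
  - intros n. induction n as [|n IH]; [simpl; rewrite Rmult_1_r; f_equal; ring|].
    simpl pow. rewrite <- Rmult_assoc, (Rmult_comm (exp (- (e * a)))), Rmult_assoc, IH, <- exp_plus, S_INR.
    f_equal. ring.
  - apply is_lim_seq_scal0, is_lim_seq_geom. rewrite Rabs_pos_eq by (left; apply exp_pos).
    rewrite <- exp_0. apply exp_increasing. lra.
Qed.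

(** On [[0, A]] the weight is at least [exp (- e A)]. For fixed [e] the weighted integral is
    extended to infinity, where it becomes the Poisson form; [e] then tends to 0. *)
Lemma energy_upper G L A M :
  (forall u, continuous G u) -> (forall u, Rabs (G u) <= M) -> 0 <= L -> 0 <= A ->
  energy G L A <= PI * RInt (fun u => G u ^ 2) (- L) L.
Proof.
  intros HG HM HL HA. assert (HC := Fcos_on_continuous G L HG). assert (HS := Fsin_on_continuous G L HG).
  assert (Hpos : forall t, 0 <= Fcos_on G L t ^ 2 + Fsin_on G L t ^ 2).
  { intros t. apply Rplus_le_le_0_compat; apply pow2_ge_0. }
  assert (HeA : forall e, 0 < e -> energy G L A <= exp (e * A) * (PI * RInt (fun u => G u ^ 2) (- L) L)).
  { intros e He. apply Rle_trans with (exp (e * A) * (poisson_form G L e + 0)).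
    - set (K := M * M * (2 / e) * (2 * L) ^ 2).
      refine (is_lim_seq_le (fun _ => energy G L A)
        (fun n => exp (e * A) * (poisson_form G L e + K * exp (- (e * (A + INR n))))) (Finite _) (Finite _)
        _ (is_lim_seq_const _) _).
      2:{ apply (is_lim_seq_scal_l _ _ (Finite _)), is_lim_seq_plus'; [apply is_lim_seq_const|].
          apply is_lim_seq_scal0, is_lim_seq_exp_scal, He. }
      intros n. assert (Hn := pos_INR n).
      assert (H := weighted_energy_poisson G L e (A + INR n) M HG HM He HL).
      apply Rabs_le_between in H. fold K in H.
      set (w := fun t => exp (- (e * t)) * (Fcos_on G L t ^ 2 + Fsin_on G L t ^ 2)) in *.
      assert (Hw : forall t, continuous w t) by (unfold w; cont).
      apply Rle_trans with (exp (e * A) * RInt w 0 (A + INR n)).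
      + rewrite <- (RInt_Chasles_cont w 0 A) by easy.
        assert (P : 0 <= RInt w A (A + INR n)).
        { apply RInt_ge_0; [lra|apply ex_RInt_cont, Hw|]. intros t _.
          apply Rmult_le_pos; [left; apply exp_pos|apply Hpos]. }
        apply Rle_trans with (exp (e * A) * RInt w 0 A).
        * rewrite <- RInt_scal_cont by easy. apply RInt_le_cont; [easy|cont|cont|].
          intros t Ht. unfold w. rewrite <- Rmult_assoc, <- exp_plus.
          assert (Q := exp_ge_1 (e * A + - (e * t)) ltac:(nra)). specialize (Hpos t). nra.
        * apply Rmult_le_compat_l; [left; apply exp_pos|lra].
      + apply Rmult_le_compat_l; [left; apply exp_pos|lra].
    - rewrite Rplus_0_r. apply Rmult_le_compat_l; [left; apply exp_pos|]. apply poisson_form_le; easy. }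
  set (I := PI * RInt (fun u => G u ^ 2) (- L) L) in *.
  rewrite <- (Rmult_1_l I).
  refine (is_lim_seq_le (fun _ => energy G L A) (fun n => exp (/ INR (S n) * A) * I)
     (Finite _) (Finite _) _ (is_lim_seq_const _) _).
  - intros n. apply HeA, Rinv_0_lt_compat, lt_0_INR. lia.
  - apply (is_lim_seq_scal_r _ I (Finite 1)). rewrite <- exp_0.
    apply (is_lim_seq_continuous exp _ 0).
    + apply continuity_pt_filterlim, exp_continuous.
    + apply (is_lim_seq_ext (fun n => A * / INR (S n))); [intros; ring|].
      apply is_lim_seq_scal0, is_lim_seq_inv_S.
Qed.

Lemma RInt_decay k C L : (forall u, continuous k u) -> decay C k -> 0 <= L ->
  Rabs (RInt k (- L) L) <= 4 * C.
Proof.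
  intros Hc Hd HL. assert (H := RInt_window k C 0 0 L Hc Hd (conj (Rle_refl 0) HL) (conj (Rle_refl 0) HL)).
  replace (- 0) with 0 in H by ring. rewrite (RInt_point 0 k) in H. unfold zero in H; simpl in H.
  rewrite Rminus_0_r in H. unfold Rdiv in H. rewrite Rmult_0_l, exp_0 in H. lra.
Qed.

Lemma decay_mult C k h : decay C k -> (forall u, Rabs (h u) <= 1) -> decay C (fun u => k u * h u).
Proof.
  intros H Hh u. rewrite Rabs_mult. specialize (H u). specialize (Hh u).
  assert (P := Rabs_pos (k u)). assert (Q := Rabs_pos (h u)). nra.
Qed.

Lemma Rabs_cos_le x : Rabs (cos x) <= 1.
Proof. assert (H := COS_bound x). abs_lra. Qed.

Lemma Rabs_sin_le x : Rabs (sin x) <= 1.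
Proof. assert (H := SIN_bound x). abs_lra. Qed.

Lemma decay_le C k : decay C k -> forall u, Rabs (k u) <= C.
Proof.
  intros H u. eapply Rle_trans; [apply H|]. assert (HC := decay_pos _ _ H).
  assert (P := exp_le_1 (- Rabs u / 2) ltac:(assert (Q := Rabs_pos u); lra)). nra.
Qed.

(** One integration by parts: [2 C] bounds the boundary terms and [4 C'] the integral of the
    derivative. The bound is independent of [L], so the tail in [t] survives the limit of the
    window. *)
Lemma Fourier_on_decay G G' C C' L t :
  (forall u, is_derive G u (G' u)) -> (forall u, continuous G' u) ->
  decay C G -> decay C' G' -> 0 <= L ->
  Fcos_on G L t ^ 2 + Fsin_on G L t ^ 2 <= 2 * ((4 * C) ^ 2 + (2 * C + 4 * C') ^ 2) * / (1 + t ^ 2).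
Proof.
  intros HD HG' Hd Hd' HL.
  assert (HG := is_derive_cont _ _ HD).
  assert (HC := decay_pos _ _ Hd). assert (HC' := decay_pos _ _ Hd').
  assert (B1 : Rabs (Fcos_on G L t) <= 4 * C).
  { apply RInt_decay; [cont|apply decay_mult; [easy|intros; apply Rabs_cos_le]|easy]. }
  assert (B2 : Rabs (Fsin_on G L t) <= 4 * C).
  { apply RInt_decay; [cont|apply decay_mult; [easy|intros; apply Rabs_sin_le]|easy]. }
  assert (Hb : forall h dh, (forall u, is_derive h u (dh u)) -> (forall u, continuous h u) ->
    (forall u, continuous dh u) -> (forall u, Rabs (h u) <= 1) ->
    Rabs (RInt (fun u => G u * dh u) (- L) L) <= 2 * C + 4 * C').
  { intros h dh H1 H2 H3 H4.
    assert (H := RInt_derive_cont (fun u => G u * h u) (fun u => G' u * h u + G u * dh u) (- L) L).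
    rewrite RInt_plus_cont in H by cont.
    replace (RInt (fun u => G u * dh u) (- L) L) with
      (G L * h L + - (G (- L) * h (- L)) + - RInt (fun u => G' u * h u) (- L) L).
    2:{ match goal with |- ?a = ?b => change (@eq R a b) end.
        rewrite <- (Rplus_0_r (RInt (fun u => G u * dh u) (- L) L)).
        lapply H; [clear H; intros H|].
        - lapply H; [clear H; intros H; lra|cont].
        - intros u. apply is_derive_mul; [apply HD|apply H1]. }
    eapply Rle_trans; [apply Rabs_triang|].
    assert (R1 := RInt_decay (fun u => G' u * h u) C' L ltac:(cont) (decay_mult _ _ _ Hd' H4) HL).
    assert (R2 := Rabs_triang (G L * h L) (- (G (- L) * h (- L)))).
    rewrite Rabs_Ropp in R2. rewrite (Rabs_Ropp (RInt _ _ _)).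
    assert (D := decay_le _ _ (decay_mult _ _ _ Hd H4)). assert (D1 := D L). assert (RInt2 := D (- L)).
    cbv beta in D1, RInt2.
    eapply Rle_trans; [apply Rplus_le_compat; [exact R2|exact R1]|]. lra. }
  assert (K1 : Rabs (t * Fcos_on G L t) <= 2 * C + 4 * C').
  { assert (H := Hb (fun u => sin (t * u)) (fun u => t * cos (t * u))).
    rewrite (RInt_ext_all _ (fun u => t * (G u * cos (t * u)))) in H by (intros; ring).
    rewrite RInt_scal_cont in H by cont. apply H; [|cont|cont|intros; apply Rabs_sin_le].
    intros u. auto_derive; [trivial|ring]. }
  assert (K2 : Rabs (t * Fsin_on G L t) <= 2 * C + 4 * C').
  { assert (H := Hb (fun u => - cos (t * u)) (fun u => t * sin (t * u))).
    rewrite (RInt_ext_all (fun u => G u * (t * sin (t * u))) (fun u => t * (G u * sin (t * u)))) in H by (intros; ring).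
    rewrite RInt_scal_cont in H by cont. apply H; [|cont|cont|intros; rewrite Rabs_Ropp; apply Rabs_cos_le].
    intros u. auto_derive; [trivial|ring]. }
  assert (P : 0 < 1 + t ^ 2) by (assert (Q := pow2_ge_0 t); lra).
  apply (Rmult_le_reg_r (1 + t ^ 2)); [easy|]. rewrite Rmult_assoc, Rinv_l, Rmult_1_r by lra.
  assert (S : forall x M, Rabs x <= M -> x ^ 2 <= M ^ 2).
  { intros x M H. rewrite <- (pow2_abs x). apply pow_incr. split; [apply Rabs_pos|easy]. }
  apply S in B1. apply S in B2. apply S in K1. apply S in K2. rewrite Rpow_mult_distr in K1, K2. nra.
Qed.

Lemma RInt_inv_sqr_sum a b : RInt (fun t => / (1 + t ^ 2)) a b = atan b - atan a.
Proof.
  apply RInt_derive_cont.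
  - intros t. auto_derive; [trivial|]. unfold Rsqr. assert (Q := pow2_ge_0 t). field. simpl in *. lra.
  - intros t. apply ex_derive_cont. auto_derive.
    assert (Q := pow2_ge_0 t). simpl in *. lra.
Qed.

Lemma cont_inv_sqr_sum : forall t : R, continuous (fun t => / (1 + t ^ 2)) t.
Proof.
  intros t. apply ex_derive_cont. auto_derive.
  assert (Q := pow2_ge_0 t). simpl in *. lra.
Qed.

Lemma is_lim_atan : is_lim_seq (fun n => atan (INR (S n))) (PI / 2).
Proof.
  apply (is_lim_seq_ext (fun n => PI / 2 - atan (/ INR (S n)))).
  - intros n. rewrite atan_inv by (apply lt_0_INR; lia). ring.
  - replace (PI / 2) with (PI / 2 - atan 0) at 1 by (rewrite atan_0; ring).
    apply is_lim_seq_minus'; [apply is_lim_seq_const|].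
    apply (is_lim_seq_continuous atan _ 0); [|apply is_lim_seq_inv_S].
    apply continuity_pt_filterlim. apply ex_derive_cont. auto_derive. trivial.
Qed.

(** The Poisson form bounds from below the energy over all frequencies; those beyond [A] cost at
    most the integral of the bound of [Fourier_on_decay], which is the term with
    [PI / 2 - atan A]. *)
Lemma energy_lower G G' C C' L A :
  (forall u, is_derive G u (G' u)) -> (forall u, continuous G' u) ->
  decay C G -> decay C' G' -> 1 <= L -> 0 <= A ->
  PI * RInt (fun u => G u ^ 2) (- (L - 1)) (L - 1)
    - 2 * ((4 * C) ^ 2 + (2 * C + 4 * C') ^ 2) * (PI / 2 - atan A) <= energy G L A.
Proof.
  intros HD HG' Hd Hd' HL HA.
  assert (HG := is_derive_cont _ _ HD).
  assert (HC := Fcos_on_continuous G L HG). assert (HS := Fsin_on_continuous G L HG).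
  set (Dc := 2 * ((4 * C) ^ 2 + (2 * C + 4 * C') ^ 2)).
  assert (HDc : 0 <= Dc).
  { unfold Dc. assert (Q1 := pow2_ge_0 (4 * C)). assert (Q2 := pow2_ge_0 (2 * C + 4 * C')). lra. }
  assert (Hlip : forall u v, Rabs (G u - G v) <= C' * Rabs (u - v)).
  { intros u v. destruct (MVT_gen G v u G') as [c [_ Hc]].
    - intros x _. apply HD.
    - intros x _. apply continuity_pt_filterlim, HG.
    - rewrite Hc, Rabs_mult. apply Rmult_le_compat_r; [apply Rabs_pos|apply decay_le, Hd']. }
  assert (Hcp : forall t : R, continuous (fun t : R => Fcos_on G L t ^ 2 + Fsin_on G L t ^ 2) t) by cont.
  assert (Hpos : forall t, 0 <= Fcos_on G L t ^ 2 + Fsin_on G L t ^ 2).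
  { intros t. apply Rplus_le_le_0_compat; apply pow2_ge_0. }
  assert (He : forall e, 0 < e -> poisson_form G L e - Dc * (PI / 2 - atan A) <= energy G L A).
  { intros e He.
    assert (Hn0 : forall n, poisson_form G L e - C * C * (2 / e) * (2 * L) ^ 2 * exp (- (e * (A + INR n)))
       <= energy G L A + Dc * (PI / 2 - atan A)).
    { intros n. assert (Hn := pos_INR n).
      assert (H := weighted_energy_poisson G L e (A + INR n) C HG (decay_le _ _ Hd) He ltac:(lra)).
      apply Rabs_le_between in H.
      assert (H1 : RInt (fun t => exp (- (e * t)) * (Fcos_on G L t ^ 2 + Fsin_on G L t ^ 2)) 0 (A + INR n)
         <= energy G L (A + INR n)).
      { apply RInt_le_cont; [lra|cont|exact Hcp|]. intros t Ht.
        assert (Q := exp_le_1 (- (e * t)) ltac:(nra)). specialize (Hpos t). nra. }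
      assert (H2 : energy G L (A + INR n) <= energy G L A + Dc * (PI / 2 - atan A)).
      { unfold energy at 1. rewrite <- (RInt_Chasles_cont _ 0 A (A + INR n) Hcp).
        apply Rplus_le_compat_l.
        apply Rle_trans with (RInt (fun t => Dc * / (1 + t ^ 2)) A (A + INR n)).
        - apply RInt_le_cont; [lra|exact Hcp|apply cont_mult; [apply cont_const|apply cont_inv_sqr_sum]|].
          intros t _. apply (Fourier_on_decay G G'); try easy. lra.
        - rewrite RInt_scal_cont by apply cont_inv_sqr_sum. rewrite RInt_inv_sqr_sum.
          assert (Q := atan_lt_PI2 (A + INR n)). apply Rmult_le_compat_l; lra. }
      lra. }
    assert (H : poisson_form G L e - 0 <= energy G L A + Dc * (PI / 2 - atan A)); [|lra].
    refine (is_lim_seq_le _ (fun _ => energy G L A + Dc * (PI / 2 - atan A)) (Finite _) (Finite _) Hn0 _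
      (is_lim_seq_const _)).
    apply is_lim_seq_minus'; [apply is_lim_seq_const|].
    apply is_lim_seq_scal0, is_lim_seq_exp_scal, He. }
  set (I := RInt (fun u => G u ^ 2) (- (L - 1)) (L - 1)).
  set (K := / 2 * (C' ^ 2 * (2 * L) ^ 2)).
  replace (PI * I) with (2 * (PI / 2) * I - K * 0) by field.
  refine (is_lim_seq_le (fun n => 2 * atan (INR (S n)) * I - K * / INR (S n) - Dc * (PI / 2 - atan A))
    (fun _ => energy G L A) (Finite _) (Finite _) _ _ (is_lim_seq_const _)).
  - intros n. assert (HS0 : 0 < INR (S n)) by (apply lt_0_INR; lia).
    assert (Hi := Rinv_0_lt_compat _ HS0).
    assert (H := poisson_form_ge G L _ C' HG Hlip Hi HL). rewrite Rinv_inv in H.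
    specialize (He _ Hi). fold I K in H. lra.
  - apply is_lim_seq_minus'; [|apply is_lim_seq_const]. apply is_lim_seq_minus'.
    + apply (is_lim_seq_scal_r _ I (Finite _)), (is_lim_seq_scal_l _ 2 (Finite _)), is_lim_atan.
    + apply (is_lim_seq_scal_l _ K (Finite _)), is_lim_seq_inv_S.
Qed.

(** * Fourier transforms of [tame] functions *)

Definition Fcos (k : R -> R) (t : R) : R := intR (fun u => k u * cos (t * u)).
Definition Fsin (k : R -> R) (t : R) : R := intR (fun u => k u * sin (t * u)).

Lemma tame_cos k t : tame k -> tame (fun u => k u * cos (t * u)).
Proof.
  intros H. apply (tame_ext (fun u => cos (t * u) * k u)); [intros; ring|].
  apply (tame_bounded_mult _ _ 1); [cont|intros; apply Rabs_cos_le|easy].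
Qed.

Lemma tame_sin k t : tame k -> tame (fun u => k u * sin (t * u)).
Proof.
  intros H. apply (tame_ext (fun u => sin (t * u) * k u)); [intros; ring|].
  apply (tame_bounded_mult _ _ 1); [cont|intros; apply Rabs_sin_le|easy].
Qed.

Lemma Fcos_on_close k C n t : (forall u, continuous k u) -> decay C k ->
  Rabs (Fcos k t - Fcos_on k (INR n) t) <= 4 * C * exp (- INR n / 2).
Proof.
  intros Hc Hd. eapply Rle_trans; [apply (intR_close _ C (INR n) (INR n))|].
  - cont.
  - apply decay_mult; [easy|intros; apply Rabs_cos_le].
  - apply pos_INR.
  - apply pos_INR.
  - lra.
Qed.

Lemma Fsin_on_close k C n t : (forall u, continuous k u) -> decay C k ->
  Rabs (Fsin k t - Fsin_on k (INR n) t) <= 4 * C * exp (- INR n / 2).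
Proof.
  intros Hc Hd. eapply Rle_trans; [apply (intR_close _ C (INR n) (INR n))|].
  - cont.
  - apply decay_mult; [easy|intros; apply Rabs_sin_le].
  - apply pos_INR.
  - apply pos_INR.
  - lra.
Qed.

Lemma uniform_limit_continuous (f : R -> R) (fn : nat -> R -> R) (d : nat -> R) :
  (forall n t, continuous (fn n) t) -> (forall n t, Rabs (f t - fn n t) <= d n) ->
  is_lim_seq d 0 -> forall t, continuous f t.
Proof.
  intros Hc Hd Hl t. apply filterlim_locally. intros eps.
  assert (He : 0 < eps / 3) by (assert (P := cond_pos eps); lra).
  apply is_lim_seq_spec in Hl. destruct (Hl (mkposreal _ He)) as [N HN].
  specialize (HN N (Nat.le_refl N)). rewrite Rminus_0_r in HN. simpl in HN.
  apply Rabs_lt_between in HN.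
  generalize (proj1 (filterlim_locally (fn N) (fn N t)) (Hc N t) (mkposreal _ He)).
  apply filter_imp. intros s Hs. change (Rabs (fn N s - fn N t) < eps / 3) in Hs.
  change (Rabs (f s - f t) < eps). assert (H1 := Hd N s). assert (H2 := Hd N t).
  abs_lra.
Qed.

Lemma Fcos_continuous k : tame k -> forall t, continuous (Fcos k) t.
Proof.
  intros [Hc [C Hd]]. apply (uniform_limit_continuous _ (fun n => Fcos_on k (INR n)) (fun n => 4 * C * exp (- INR n / 2))).
  - intros n. apply Fcos_on_continuous, Hc.
  - intros n t. apply Fcos_on_close; easy.
  - apply is_lim_seq_scal0, is_lim_seq_exp_half.
Qed.

Lemma Fsin_continuous k : tame k -> forall t, continuous (Fsin k) t.
Proof.
  intros [Hc [C Hd]]. apply (uniform_limit_continuous _ (fun n => Fsin_on k (INR n)) (fun n => 4 * C * exp (- INR n / 2))).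
  - intros n. apply Fsin_on_continuous, Hc.
  - intros n t. apply Fsin_on_close; easy.
  - apply is_lim_seq_scal0, is_lim_seq_exp_half.
Qed.

Lemma Rabs_sqr_diff x y M : Rabs x <= M -> Rabs y <= M -> Rabs (x ^ 2 - y ^ 2) <= 2 * M * Rabs (x - y).
Proof.
  intros Hx Hy. replace (x ^ 2 - y ^ 2) with ((x + y) * (x - y)) by ring.
  rewrite Rabs_mult. apply Rmult_le_compat_r; [apply Rabs_pos|].
  eapply Rle_trans; [apply Rabs_triang|]. lra.
Qed.

Lemma Fcos_bound k C t : (forall u, continuous k u) -> decay C k -> Rabs (Fcos k t) <= 8 * C.
Proof.
  intros Hc Hd. assert (H := Fcos_on_close k C 0 t Hc Hd).
  assert (H1 : Rabs (Fcos_on k (INR 0) t) <= 4 * C)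
    by (apply RInt_decay; [cont|apply decay_mult; [easy|intros; apply Rabs_cos_le]|apply Rle_refl]).
  assert (HC := decay_pos _ _ Hd).
  assert (P := exp_le_1 (- INR 0 / 2) ltac:(simpl; lra)).
  assert (P2 : 4 * C * exp (- INR 0 / 2) <= 4 * C) by nra.
  abs_lra.
Qed.

Lemma Fsin_bound k C t : (forall u, continuous k u) -> decay C k -> Rabs (Fsin k t) <= 8 * C.
Proof.
  intros Hc Hd. assert (H := Fsin_on_close k C 0 t Hc Hd).
  assert (H1 : Rabs (Fsin_on k (INR 0) t) <= 4 * C)
    by (apply RInt_decay; [cont|apply decay_mult; [easy|intros; apply Rabs_sin_le]|apply Rle_refl]).
  assert (HC := decay_pos _ _ Hd).
  assert (P := exp_le_1 (- INR 0 / 2) ltac:(simpl; lra)).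
  assert (P2 : 4 * C * exp (- INR 0 / 2) <= 4 * C) by nra.
  abs_lra.
Qed.

Lemma is_lim_energy k A : tame k -> 0 <= A ->
  is_lim_seq (fun n => energy k (INR n) A) (RInt (fun t => Fcos k t ^ 2 + Fsin k t ^ 2) 0 A).
Proof.
  intros Hk HA. assert (HFc := Fcos_continuous k Hk). assert (HFs := Fsin_continuous k Hk).
  destruct Hk as [Hc [C Hd]]. assert (HC := decay_pos _ _ Hd).
  apply (is_lim_seq_dist0 _ _ (fun n => A * (2 * (2 * (8 * C)) * (4 * C)) * exp (- INR n / 2)));
    [|apply is_lim_seq_scal0, is_lim_seq_exp_half].
  intros n. assert (HCt := Fcos_on_continuous k (INR n) Hc). assert (HSt := Fsin_on_continuous k (INR n) Hc).
  unfold energy. rewrite <- RInt_minus_cont by cont.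
  set (e := exp (- INR n / 2)).
  replace (A * (2 * (2 * (8 * C)) * (4 * C)) * e) with ((A - 0) * (2 * (2 * (8 * C)) * (4 * C * e))) by ring.
  apply abs_RInt_le_const; [easy|apply ex_RInt_cont; cont|].
  intros t _.
  assert (B1 : Rabs (Fcos_on k (INR n) t) <= 8 * C).
  { eapply Rle_trans; [apply (RInt_decay _ C); [cont|apply decay_mult; [easy|intros; apply Rabs_cos_le]|apply pos_INR]|lra]. }
  assert (B2 : Rabs (Fsin_on k (INR n) t) <= 8 * C).
  { eapply Rle_trans; [apply (RInt_decay _ C); [cont|apply decay_mult; [easy|intros; apply Rabs_sin_le]|apply pos_INR]|lra]. }
  assert (D1 := Rabs_sqr_diff _ _ _ B1 (Fcos_bound k C t Hc Hd)).
  assert (RInt2 := Rabs_sqr_diff _ _ _ B2 (Fsin_bound k C t Hc Hd)).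
  assert (E1 := Fcos_on_close k C n t Hc Hd). assert (E2 := Fsin_on_close k C n t Hc Hd).
  rewrite Rabs_minus_sym in E1, E2. fold e in E1, E2.
  match goal with |- Rabs ?a <= _ => replace a with
    ((Fcos_on k (INR n) t ^ 2 - Fcos k t ^ 2) + (Fsin_on k (INR n) t ^ 2 - Fsin k t ^ 2)) by ring end.
  eapply Rle_trans; [apply Rabs_triang|]. nra.
Qed.

Lemma tame_sqr k : tame k -> tame (fun u => k u ^ 2).
Proof.
  intros [Hc [C Hd]]. apply (tame_ext (fun u => k u * k u)); [intros; ring|].
  apply (tame_bounded_mult _ _ C); [easy|apply decay_le, Hd|]. split; [easy|exists C; easy].
Qed.

(** At fixed [A] the two energy bounds pass to the full line in [u]; they meet as [A] grows. Each
    half-line of frequencies carries [PI] times the square norm, because the integrand is even. *)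
Lemma plancherel G G' :
  (forall u, is_derive G u (G' u)) -> tame G -> tame G' ->
  is_RInt_gen (fun t => Fcos G t ^ 2 + Fsin G t ^ 2) (Rbar_locally m_infty) (Rbar_locally p_infty)
    (2 * PI * intR (fun u => G u ^ 2)).
Proof.
  intros HD HG HG'. assert (HFc := Fcos_continuous G HG). assert (HFs := Fsin_continuous G HG).
  destruct HG as [Hc [C Hd]]. destruct HG' as [Hc' [C' Hd']].
  assert (HG : tame G) by (split; [easy|exists C; easy]).
  assert (HI := intR_lim _ (tame_sqr G HG)).
  set (I := intR (fun u => G u ^ 2)) in *.
  set (Dc := 2 * ((4 * C) ^ 2 + (2 * C + 4 * C') ^ 2)).
  set (p := fun t => Fcos G t ^ 2 + Fsin G t ^ 2).
  assert (Hp : forall t, continuous p t) by (unfold p; cont).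
  assert (Hup : forall A, 0 <= A -> RInt p 0 A <= PI * I).
  { intros A HA. refine (is_lim_seq_le _ _ (Finite _) (Finite _) _ (is_lim_energy G A HG HA)
      (is_lim_seq_scal_l _ PI (Finite _) HI)).
    intros n. apply (energy_upper G (INR n) A C); try easy; [apply decay_le, Hd|apply pos_INR]. }
  assert (Hlow : forall A, 0 <= A -> PI * I - Dc * (PI / 2 - atan A) <= RInt p 0 A).
  (* The window [n + 1] is used because [energy_lower] loses a unit at each end. *)
  { intros A HA. refine (is_lim_seq_le
      (fun n => PI * RInt (fun u => G u ^ 2) (- INR n) (INR n) - Dc * (PI / 2 - atan A))
      (fun n => energy G (INR (S n)) A) (Finite _) (Finite _) _ _ _).
    - intros n. assert (H := energy_lower G G' C C' (INR (S n)) A HD Hc' Hd Hd').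
      replace (INR (S n) - 1) with (INR n) in H by (rewrite S_INR; ring).
      apply H; [rewrite S_INR; assert (Q := pos_INR n); lra|easy].
    - apply is_lim_seq_minus'; [|apply is_lim_seq_const]. apply (is_lim_seq_scal_l _ PI (Finite _) HI).
    - apply (is_lim_seq_incr_1 (fun n => energy G (INR n) A)), is_lim_energy; easy. }
  assert (Heven : forall t, p (- t) = p t).
  { intros t. unfold p, Fcos, Fsin. f_equal.
    - f_equal. apply intR_ext. intros u. rewrite <- Ropp_mult_distr_l, cos_neg. reflexivity.
    - rewrite <- (pow2_abs (intR _)), <- (pow2_abs (intR (fun u => G u * sin (t * u)))). f_equal.
      rewrite <- Rabs_Ropp. f_equal.
      rewrite (intR_ext (fun u => G u * sin (- t * u)) (fun u => -1 * (G u * sin (t * u)))).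
      + rewrite intR_scal by (apply tame_sin, HG). ring.
      + intros u. rewrite <- Ropp_mult_distr_l, sin_neg. ring. }
  intros P [eps HP].
  assert (Hl : is_lim_seq (fun n => Dc * (PI / 2 - atan (INR (S n)))) 0).
  { apply is_lim_seq_scal0. replace (Finite 0) with (Finite (PI / 2 - PI / 2)) by (f_equal; ring).
    apply is_lim_seq_minus'; [apply is_lim_seq_const|apply is_lim_atan]. }
  apply is_lim_seq_spec in Hl.
  assert (He : 0 < eps / 2) by (assert (Q := cond_pos eps); lra).
  destruct (Hl (mkposreal _ He)) as [n Hn]. specialize (Hn n (Nat.le_refl n)).
  rewrite Rminus_0_r in Hn. simpl pos in Hn. apply Rabs_lt_between in Hn.
  set (N := INR (S n)) in *. assert (HN : 0 <= N) by apply pos_INR.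
  assert (HDc : 0 <= Dc).
  { unfold Dc. assert (Q1 := pow2_ge_0 (4 * C)). assert (Q2 := pow2_ge_0 (2 * C + 4 * C')). lra. }
  assert (Hb : forall A, N <= A -> Rabs (RInt p 0 A - PI * I) < eps / 2).
  { intros A HA. assert (H1 := Hup A ltac:(lra)). assert (H2 := Hlow A ltac:(lra)).
    assert (H3 := atan_le N A HA).
    assert (H4 : Dc * (PI / 2 - atan A) <= Dc * (PI / 2 - atan N)) by (apply Rmult_le_compat_l; lra).
    abs_lra. }
  apply (Filter_prod _ _ _ (fun a => a < - N) (fun b => N < b)).
  - exists (- N). easy.
  - exists N. easy.
  - intros a b Ha Hb'. exists (RInt p a b). split; [apply is_RInt_cont, Hp|].
    apply HP. change (Rabs (RInt p a b - 2 * PI * I) < eps).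
    rewrite <- (RInt_Chasles_cont p a 0 b Hp).
    assert (E : RInt p a 0 = RInt p 0 (- a)).
    { rewrite <- (RInt_opp_cont p a 0 Hp), Ropp_0. apply RInt_ext_all, Heven. }
    rewrite E. assert (H1 := Hb (- a) ltac:(lra)). assert (H2 := Hb b ltac:(lra)).
    abs_lra.
Qed.

Lemma Fourier_derive k k' t :
  (forall u, is_derive k u (k' u)) -> tame k -> tame k' ->
  Fcos k' t = t * Fsin k t /\ Fsin k' t = - t * Fcos k t.
Proof.
  intros HD Hk Hk'. assert (Hc := proj1 Hk). assert (Hc' := proj1 Hk').
  split.
  - assert (H : intR (fun u => k' u * cos (t * u) + - t * (k u * sin (t * u))) = 0).
    { apply (intR_derive_tame (fun u => k u * cos (t * u))); [|cont|apply tame_cos, Hk].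
      intros u. evar_last.
      - apply is_derive_mul; [apply HD|auto_derive; [trivial|reflexivity]].
      - unfold plus, mult; simpl. ring. }
    rewrite intR_plus, intR_scal in H; [|apply tame_sin, Hk|apply tame_cos, Hk'|apply tame_scal, tame_sin, Hk].
    unfold Fcos, Fsin. lra.
  - assert (H : intR (fun u => k' u * sin (t * u) + t * (k u * cos (t * u))) = 0).
    { apply (intR_derive_tame (fun u => k u * sin (t * u))); [|cont|apply tame_sin, Hk].
      intros u. evar_last.
      - apply is_derive_mul; [apply HD|auto_derive; [trivial|reflexivity]].
      - unfold plus, mult; simpl. ring. }
    rewrite intR_plus, intR_scal in H; [|apply tame_cos, Hk|apply tame_sin, Hk'|apply tame_scal, tame_cos, Hk].
    unfold Fcos, Fsin. lra.
Qed.

(** * Gamma times zeta on the critical line *)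

(** At [s = 1/2 + i t], [Fcos + i Fsin] of [gker a], [zker] and [eker] are the Mellin transforms of
    [exp (- a x)], [phi] and [1 / (exp x + 1)], the factor [exp (u / 2)] being [x^(1/2)]. *)
Definition gker (a u : R) : R := exp (u / 2) * expm a u.
Definition zker (u : R) : R := exp (u / 2) * psi 0 u.
Definition eker (u : R) : R := exp (u / 2) * / (exp (exp u) + 1).

Lemma exp_half u : exp (u / 2) * exp (u / 2) = exp u.
Proof. rewrite <- exp_plus. f_equal. field. Qed.

Lemma tame_gker_1 : tame (gker 1).
Proof.
  split; [unfold gker, Rdiv; apply cont_mult; [cont|apply expm_continuous]|].
  exists 1. intros u. assert (P := exp_pos (u / 2)). assert (H := expm_bounds 1 u Rlt_0_1).
  unfold gker. rewrite Rabs_pos_eq by nra. destruct (Rle_dec u 0) as [Hu|Hu].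
  - rewrite Rabs_left1 by easy. replace (- - u / 2) with (u / 2) by field. nra.
  - rewrite Rabs_pos_eq by lra. assert (H1 := expm_small 1 u Rlt_0_1). rewrite Rinv_1 in H1.
    replace (- u / 2) with (u / 2 + - u) by field. rewrite exp_plus. nra.
Qed.

Lemma gker_shift a u : 0 < a -> gker a u = exp (- ln a / 2) * gker 1 (u + ln a).
Proof.
  intros Ha. unfold gker. rewrite (expm_shift a) by easy. rewrite <- Rmult_assoc, <- exp_plus.
  do 2 f_equal. field.
Qed.

Lemma tame_gker a : 0 < a -> tame (gker a).
Proof.
  intros Ha. eapply tame_ext; [intros u; symmetry; apply gker_shift, Ha|].
  apply tame_scal, (tame_shift (gker 1)), tame_gker_1.
Qed.

Lemma intR_gker a : 0 < a -> intR (gker a) = exp (- ln a / 2) * intR (gker 1).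
Proof.
  intros Ha. rewrite (intR_ext _ _ (fun u => gker_shift a u Ha)).
  rewrite (intR_scal _ (fun u => gker 1 (u + ln a))) by (apply (tame_shift (gker 1)), tame_gker_1).
  rewrite (intR_shift (gker 1)) by apply tame_gker_1. reflexivity.
Qed.

Lemma tame_exp_half_psi k : tame (fun u => exp (u / 2) * psi k u).
Proof.
  split; [unfold Rdiv; cont|]. destruct (psi_bound k) as [C [HC [H1 [H2 _]]]].
  exists C. intros u. assert (P := exp_pos (u / 2)).
  rewrite Rabs_mult, (Rabs_pos_eq (exp _)) by lra. destruct (Rle_dec u 0) as [Hu|Hu].
  - rewrite (Rabs_left1 u) by easy. replace (- - u / 2) with (u / 2) by field. specialize (H1 u). nra.
  - rewrite (Rabs_pos_eq u) by lra. specialize (H2 u).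
    replace (- u / 2) with (u / 2 + - u) by field. rewrite exp_plus. nra.
Qed.

Lemma tame_zker : tame zker.
Proof. exact (tame_exp_half_psi 0). Qed.

(** The shift already carries a factor [sqrt (2 x)], so only [sqrt 2] of the factor 2 in front of
    [phi (2 x)] remains. *)
Lemma eker_zker u : eker u = zker u - exp (ln 2 / 2) * zker (u + ln 2).
Proof.
  assert (P := exp_pos u). assert (HE := exp_neq_1 (exp u) ltac:(lra)).
  assert (HE2 := exp_neq_1 (exp u * 2) ltac:(lra)).
  assert (H2 : exp (exp u * 2) = exp (exp u) * exp (exp u)) by (rewrite <- exp_plus; f_equal; ring).
  assert (P2 := exp_pos (exp u)).
  unfold eker, zker, psi. rewrite !pow_O, !Rmult_1_l, (exp_plus u (ln 2)), exp_ln by lra.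
  rewrite !phi_0 by lra. rewrite <- Rmult_assoc, <- exp_plus.
  replace (ln 2 / 2 + (u + ln 2) / 2) with (u / 2 + ln 2) by field.
  rewrite exp_plus, exp_ln, H2 by lra. rewrite H2 in HE2. field. repeat split; try easy; try lra.
Qed.

Lemma tame_eker : tame eker.
Proof.
  eapply tame_ext; [intros u; symmetry; apply eker_zker|].
  apply tame_minus; [apply tame_zker|apply tame_scal, (tame_shift zker), tame_zker].
Qed.

(** The improper integral lets its two ends vary independently, so the estimate for arbitrary
    windows in [intR_close] is what applies. *)
Lemma is_RInt_gen_exp_subst h k :
  (forall x, 0 < x -> continuous h x) -> tame k -> (forall u, exp u * h (exp u) = k u) ->
  is_RInt_gen h (at_right 0) (Rbar_locally p_infty) (intR k).
Proof.
  intros Hh Hk E P [eps HP]. destruct Hk as [Hc [C Hd]].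
  assert (H := is_lim_seq_scal0 _ (4 * C) is_lim_seq_exp_half).
  apply is_lim_seq_spec in H. destruct (H eps) as [N HN].
  specialize (HN N (Nat.le_refl N)). rewrite Rminus_0_r in HN. apply Rabs_lt_between in HN.
  assert (HC := decay_pos _ _ Hd). assert (HN0 := pos_INR N).
  apply (Filter_prod _ _ _ (fun a => 0 < a < exp (- INR N)) (fun b => exp (INR N) < b)).
  - exists (mkposreal _ (exp_pos (- INR N))). intros y Hy Hy0. split; [easy|].
    change (Rabs (y - 0) < exp (- INR N)) in Hy. rewrite Rminus_0_r in Hy.
    apply Rabs_lt_between in Hy. lra.
  - exists (exp (INR N)). easy.
  - intros a b [Ha0 Ha] Hb. assert (Hb0 : 0 < b) by (assert (Q := exp_pos (INR N)); lra).
    exists (RInt h a b). split.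
    + apply (RInt_correct (V := R_CompleteNormedModule)).
      apply (ex_RInt_continuous (V := R_CompleteNormedModule)). intros z Hz. apply Hh.
      assert (Q := Rmin_glb_lt a b 0 Ha0 Hb0). lra.
    + apply HP. change (Rabs (RInt h a b - intR k) < eps). rewrite Rabs_minus_sym.
      assert (ER : RInt h a b = RInt k (- - ln a) (ln b)).
      { rewrite Ropp_involutive.
        rewrite <- (exp_ln a) at 1 by easy. rewrite <- (exp_ln b) at 1 by easy.
        rewrite <- (RInt_comp (V := R_CompleteNormedModule) h exp exp).
        - apply RInt_ext_all, E.
        - intros x _. apply Hh, exp_pos.
        - intros x _. split; [apply is_derive_exp|apply exp_continuous]. }
      rewrite ER.
      assert (La : ln a < - INR N) by (rewrite <- (ln_exp (- INR N)); apply ln_increasing; easy).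
      assert (Lb : INR N < ln b) by (rewrite <- (ln_exp (INR N)); apply ln_increasing; [apply exp_pos|easy]).
      eapply Rle_lt_trans; [apply (intR_close k C); try easy; lra|].
      assert (H1 : exp (- - ln a / 2) <= exp (- INR N / 2)) by (apply exp_le; lra).
      assert (H2 : exp (- ln b / 2) <= exp (- INR N / 2)) by (apply exp_le; lra).
      nra.
Qed.

Lemma Gamma_half t : Gamma (/ 2, t) = (Fcos (gker 1) t, Fsin (gker 1) t).
Proof.
  unfold Gamma, cpow, Re, Im; simpl.
  f_equal; apply is_RInt_gen_unique; apply is_RInt_gen_exp_subst;
    try apply tame_cos, tame_gker_1; try apply tame_sin, tame_gker_1;
    try (intros x Hx; apply ex_derive_cont; auto_derive; easy);
    intros u; rewrite ln_exp; unfold gker, expm;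
    rewrite <- Rmult_assoc, <- Rmult_assoc, <- exp_plus, Rmult_1_l;
    replace (u + (/ 2 + - (1)) * u) with (u / 2) by field;
    replace ((t + - 0) * u) with (t * u) by ring; ring.
Qed.

Lemma Fourier_shift k a t : tame k ->
  Fcos (fun u => k (u + a)) t = cos (t * a) * Fcos k t + sin (t * a) * Fsin k t /\
  Fsin (fun u => k (u + a)) t = cos (t * a) * Fsin k t - sin (t * a) * Fcos k t.
Proof.
  intros Hk. assert (H1 := tame_cos k t Hk). assert (H2 := tame_sin k t Hk).
  split; unfold Fcos, Fsin.
  - rewrite <- !intR_scal, <- intR_plus by (try apply tame_scal; easy).
    rewrite <- (intR_shift (fun u => cos (t * a) * (k u * cos (t * u)) + sin (t * a) * (k u * sin (t * u))) a)
      by (apply tame_plus; apply tame_scal; easy).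
    apply intR_ext. intros u. replace (t * u) with (t * (u + a) - t * a) by ring.
    rewrite cos_minus. ring.
  - rewrite <- !intR_scal, <- intR_minus by (try apply tame_scal; easy).
    rewrite <- (intR_shift (fun u => cos (t * a) * (k u * sin (t * u)) - sin (t * a) * (k u * cos (t * u))) a)
      by (apply tame_minus; apply tame_scal; easy).
    apply intR_ext. intros u. replace (t * u) with (t * (u + a) - t * a) by ring.
    rewrite sin_minus. ring.
Qed.

Lemma Fourier_lin c k1 k2 t : tame k1 -> tame k2 ->
  Fcos (fun u => k1 u + c * k2 u) t = Fcos k1 t + c * Fcos k2 t /\
  Fsin (fun u => k1 u + c * k2 u) t = Fsin k1 t + c * Fsin k2 t.
Proof.
  intros H1 H2. unfold Fcos, Fsin. split.
  - rewrite <- intR_scal, <- intR_plus by (try apply tame_scal; apply tame_cos; easy).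
    apply intR_ext. intros; ring.
  - rewrite <- intR_scal, <- intR_plus by (try apply tame_scal; apply tame_sin; easy).
    apply intR_ext. intros; ring.
Qed.

(** With [eta_im], the real and imaginary parts of the term [(-1)^n (n+1)^(-s)] at
    [s = 1/2 + i t]. *)
Definition eta_re (t : R) (n : nat) : R := (-1) ^ n * (exp (- ln (INR (S n)) / 2) * cos (t * ln (INR (S n)))).
Definition eta_im (t : R) (n : nat) : R := (-1) ^ n * (exp (- ln (INR (S n)) / 2) * - sin (t * ln (INR (S n)))).

Lemma Fourier_gker n t :
  (-1) ^ n * Fcos (gker (INR (S n))) t = Fcos (gker 1) t * eta_re t n - Fsin (gker 1) t * eta_im t n /\
  (-1) ^ n * Fsin (gker (INR (S n))) t = Fcos (gker 1) t * eta_im t n + Fsin (gker 1) t * eta_re t n.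
Proof.
  assert (HS := INR_S_pos n).
  assert (Hs := tame_shift (gker 1) (ln (INR (S n))) tame_gker_1).
  destruct (Fourier_shift (gker 1) (ln (INR (S n))) t tame_gker_1) as [H1 H2].
  assert (E1 : Fcos (gker (INR (S n))) t = exp (- ln (INR (S n)) / 2) * Fcos (fun u => gker 1 (u + ln (INR (S n)))) t).
  { unfold Fcos. rewrite <- intR_scal by (apply (tame_cos (fun u => gker 1 (u + ln (INR (S n))))), Hs).
    apply intR_ext. intros u. rewrite gker_shift by easy. ring. }
  assert (E2 : Fsin (gker (INR (S n))) t = exp (- ln (INR (S n)) / 2) * Fsin (fun u => gker 1 (u + ln (INR (S n)))) t).
  { unfold Fsin. rewrite <- intR_scal by (apply (tame_sin (fun u => gker 1 (u + ln (INR (S n))))), Hs).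
    apply intR_ext. intros u. rewrite gker_shift by easy. ring. }
  rewrite E1, E2, H1, H2. unfold eta_re, eta_im. split; ring.
Qed.

Definition eker_sum (n : nat) (u : R) : R := bsum n (fun i => (-1) ^ i * gker (INR (S i)) u).

Lemma tame_eker_sum n : tame (eker_sum n).
Proof. apply tame_bsum. intros i _. apply tame_scal, tame_gker, lt_0_INR. lia. Qed.

Lemma eker_sum_fermi n u : eker_sum n u = eker u - (-1) ^ n * expm (INR n) u * eker u.
Proof.
  induction n as [|n IH].
  - unfold eker_sum, expm. simpl. rewrite Rmult_0_l, Ropp_0, exp_0. ring.
  - change (eker_sum (S n) u) with (eker_sum n u + (-1) ^ n * gker (INR (S n)) u). rewrite IH.
    unfold gker, eker. rewrite <- (expm_S n). simpl pow. assert (P := exp_pos (exp u)). field. lra.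
Qed.

(** On the critical line the series does not converge absolutely. The remainder of the alternating
    geometric sum is bounded pointwise by its next exponential, whose integral is
    [O((n+1)^(-1/2))]. *)
Lemma is_lim_eker_sum n t :
  Rabs (Fcos (eker_sum (S n)) t - Fcos eker t) <= exp (- ln (INR (S n)) / 2) * intR (gker 1) /\
  Rabs (Fsin (eker_sum (S n)) t - Fsin eker t) <= exp (- ln (INR (S n)) / 2) * intR (gker 1).
Proof.
  assert (HS := INR_S_pos n).
  rewrite <- intR_gker by easy.
  assert (H0 : forall u, Rabs (eker_sum (S n) u - eker u) <= gker (INR (S n)) u).
  { intros u. rewrite eker_sum_fermi.
    match goal with |- Rabs ?a <= _ => replace a with (- ((-1) ^ S n * (expm (INR (S n)) u * eker u))) by ring end.
    assert (H := expm_bounds (INR (S n)) u HS). assert (P := exp_pos (exp u)).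
    assert (Q := exp_pos (u / 2)).
    assert (F : 0 < / (exp (exp u) + 1) <= 1).
    { split; [apply Rinv_0_lt_compat; lra|]. rewrite <- Rinv_1. apply Rinv_le_contravar; lra. }
    rewrite Rabs_Ropp, Rabs_mult, pow_1_abs, Rmult_1_l, Rabs_mult, (Rabs_pos_eq (expm _ _)) by lra.
    unfold gker, eker. rewrite Rabs_pos_eq by nra. rewrite Rmult_comm. apply Rmult_le_compat_r; nra. }
  assert (H1 : forall h, (forall v, Rabs (h v) <= 1) -> (forall k, tame k -> tame (fun u => k u * h (t * u))) ->
    Rabs (intR (fun u => eker_sum (S n) u * h (t * u)) - intR (fun u => eker u * h (t * u)))
      <= intR (gker (INR (S n)))).
  { intros h Hh He. assert (E1 := He _ (tame_eker_sum (S n))). assert (E2 := He _ tame_eker).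
    rewrite <- intR_minus by easy. apply intR_abs_le; [apply tame_minus; easy|apply tame_gker, HS|].
    intros u. rewrite <- Rmult_minus_distr_r, Rabs_mult. specialize (H0 u). specialize (Hh (t * u)).
    assert (Q := Rabs_pos (h (t * u))). assert (Q1 := Rabs_pos (eker_sum (S n) u - eker u)). nra. }
  split; apply H1.
  - apply Rabs_cos_le.
  - intros k. apply tame_cos.
  - apply Rabs_sin_le.
  - intros k. apply tame_sin.
Qed.

Lemma is_lim_seq_inv_sqrt_S : is_lim_seq (fun n => exp (- ln (INR (S n)) / 2)) 0.
Proof.
  apply is_lim_seq_spec. intros eps. assert (He := cond_pos eps).
  assert (H := is_lim_seq_inv_S). apply is_lim_seq_spec in H.
  assert (He2 : 0 < eps * eps) by nra.
  destruct (H (mkposreal _ He2)) as [N HN]. exists N. intros n Hn. specialize (HN n Hn).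
  simpl in HN. change (Rabs (/ INR (S n) - 0) < eps * eps) in HN.
  assert (HS := INR_S_pos n).
  rewrite Rminus_0_r in *. rewrite Rabs_pos_eq in * by (left; first [apply exp_pos|apply Rinv_0_lt_compat; easy]).
  assert (E : exp (- ln (INR (S n)) / 2) * exp (- ln (INR (S n)) / 2) = / INR (S n)).
  { rewrite exp_half, exp_Ropp, exp_ln by easy. reflexivity. }
  assert (P := exp_pos (- ln (INR (S n)) / 2)). nra.
Qed.

Lemma Fourier_eker_sum n t :
  Fcos (eker_sum n) t = Fcos (gker 1) t * bsum n (eta_re t) - Fsin (gker 1) t * bsum n (eta_im t) /\
  Fsin (eker_sum n) t = Fcos (gker 1) t * bsum n (eta_im t) + Fsin (gker 1) t * bsum n (eta_re t).
Proof.
  induction n as [|n [IH1 IH2]].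
  - unfold Fcos, Fsin, eker_sum. simpl.
    rewrite (intR_ext (fun u => 0 * cos (t * u)) (fun _ => 0)), (intR_ext (fun u => 0 * sin (t * u)) (fun _ => 0)) by (intros; ring).
    rewrite intR_0. split; ring.
  - assert (HS := INR_S_pos n).
    destruct (Fourier_lin ((-1) ^ n) (eker_sum n) (gker (INR (S n))) t (tame_eker_sum n) (tame_gker _ HS)) as [H1 H2].
    destruct (Fourier_gker n t) as [H3 H4].
    change (eker_sum (S n)) with (fun u => eker_sum n u + (-1) ^ n * gker (INR (S n)) u).
    rewrite H1, H2, H3, H4, IH1, IH2. simpl. split; ring.
Qed.

Lemma eta_half t : eta (/ 2, t) = (Series (eta_re t), Series (eta_im t)).
Proof.
  unfold eta, csum. f_equal; apply Series_ext; intros n; unfold cpow, Re, Im; cbn -[INR ln pow];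
    unfold eta_re, eta_im; replace (- / 2 * ln (INR (S n))) with (- ln (INR (S n)) / 2) by field;
    rewrite <- Ropp_mult_distr_l, ?cos_neg, ?sin_neg; ring.
Qed.

(* If [Gamma s = 0] then both sides vanish, so no independent convergence proof for [eta s] is needed. *)
Lemma Gamma_eta_half t : Cmult (Gamma (/ 2, t)) (eta (/ 2, t)) = (Fcos eker t, Fsin eker t).
Proof.
  rewrite Gamma_half, eta_half.
  set (a := Fcos (gker 1) t). set (b := Fsin (gker 1) t).
  assert (L1 : is_lim_seq (fun n => a * sum_n (eta_re t) n - b * sum_n (eta_im t) n) (Fcos eker t)).
  { apply (is_lim_seq_dist0 _ _ (fun n => intR (gker 1) * exp (- ln (INR (S n)) / 2)));
      [|apply is_lim_seq_scal0, is_lim_seq_inv_sqrt_S].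
    intros n. unfold a, b. rewrite !sum_n_bsum, <- (proj1 (Fourier_eker_sum (S n) t)), (Rmult_comm (intR _)).
    exact (proj1 (is_lim_eker_sum n t)). }
  assert (L2 : is_lim_seq (fun n => a * sum_n (eta_im t) n + b * sum_n (eta_re t) n) (Fsin eker t)).
  { apply (is_lim_seq_dist0 _ _ (fun n => intR (gker 1) * exp (- ln (INR (S n)) / 2)));
      [|apply is_lim_seq_scal0, is_lim_seq_inv_sqrt_S].
    intros n. unfold a, b. rewrite !sum_n_bsum, <- (proj2 (Fourier_eker_sum (S n) t)), (Rmult_comm (intR _)).
    exact (proj2 (is_lim_eker_sum n t)). }
  destruct (Req_dec (a * a + b * b) 0) as [H0|H0].
  - assert (Ha : a = 0) by nra. assert (Hb : b = 0) by nra.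
    rewrite Ha, Hb in *. unfold Cmult. simpl fst; simpl snd. f_equal.
    + apply is_lim_seq_unique in L1. rewrite (Lim_seq_ext _ (fun _ => 0)), Lim_seq_const in L1 by (intros; ring).
      injection L1 as <-. ring.
    + apply is_lim_seq_unique in L2. rewrite (Lim_seq_ext _ (fun _ => 0)), Lim_seq_const in L2 by (intros; ring).
      injection L2 as <-. ring.
  (* Dividing by [Gamma s = a + i b] recovers the convergence of the eta series from that of its
     product with [Gamma s]. *)
  - assert (S1 : is_series (eta_re t) ((a * Fcos eker t + b * Fsin eker t) / (a * a + b * b))).
    { change (is_lim_seq (sum_n (eta_re t)) (Finite ((a * Fcos eker t + b * Fsin eker t) / (a * a + b * b)))).
      apply (is_lim_seq_ext (fun n => / (a * a + b * b) * (a * (a * sum_n (eta_re t) n - b * sum_n (eta_im t) n)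
         + b * (a * sum_n (eta_im t) n + b * sum_n (eta_re t) n)))).
      - intros n. field. easy.
      - replace ((a * Fcos eker t + b * Fsin eker t) / (a * a + b * b))
          with (/ (a * a + b * b) * (a * Fcos eker t + b * Fsin eker t)) by (unfold Rdiv; ring).
        apply (is_lim_seq_scal_l _ _ (Finite _)), is_lim_seq_plus'; apply (is_lim_seq_scal_l _ _ (Finite _)); easy. }
    assert (S2 : is_series (eta_im t) ((a * Fsin eker t - b * Fcos eker t) / (a * a + b * b))).
    { change (is_lim_seq (sum_n (eta_im t)) (Finite ((a * Fsin eker t - b * Fcos eker t) / (a * a + b * b)))).
      apply (is_lim_seq_ext (fun n => / (a * a + b * b) * (a * (a * sum_n (eta_im t) n + b * sum_n (eta_re t) n)
         - b * (a * sum_n (eta_re t) n - b * sum_n (eta_im t) n)))).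
      - intros n. field. easy.
      - replace ((a * Fsin eker t - b * Fcos eker t) / (a * a + b * b))
          with (/ (a * a + b * b) * (a * Fsin eker t - b * Fcos eker t)) by (unfold Rdiv; ring).
        apply (is_lim_seq_scal_l _ _ (Finite _)), is_lim_seq_minus'; apply (is_lim_seq_scal_l _ _ (Finite _)); easy. }
    rewrite (is_series_unique _ _ S1), (is_series_unique _ _ S2).
    unfold Cmult. simpl fst; simpl snd. f_equal; field; easy.
Qed.

Lemma Gamma_zeta_half t : Cmult (Gamma (/ 2, t)) (zeta (/ 2, t)) = (Fcos zker t, Fsin zker t).
Proof.
  unfold zeta. destruct (Rlt_dec 1 (Re (/ 2, t))) as [H|_]; [simpl in H; lra|].
  set (c := exp (ln 2 / 2)).
  assert (Hd : Cminus (RtoC 1) (cpow 2 (Cminus (RtoC 1) (/ 2, t)))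
     = (1 - c * cos (t * ln 2), c * sin (t * ln 2))).
  { unfold cpow, Cminus, Cplus, Copp, RtoC, Re, Im. simpl fst; simpl snd.
    replace ((1 + - / 2) * ln 2) with (ln 2 / 2) by field.
    replace ((0 + - t) * ln 2) with (- (t * ln 2)) by ring. rewrite cos_neg, sin_neg. fold c.
    f_equal; ring. }
  rewrite Hd.
  (* [2^(1-s)] has modulus [sqrt 2] on the critical line, so [1 - 2^(1-s)] has no zero there. *)
  assert (Hc : c * c = 2) by (unfold c; rewrite exp_half, exp_ln; lra).
  assert (Hn : (1 - c * cos (t * ln 2), c * sin (t * ln 2)) <> RtoC 0).
  { intros E. injection E as E1 E2. assert (Q := sin2_cos2 (t * ln 2)). unfold Rsqr in Q.
    assert (c * c * (sin (t * ln 2) * sin (t * ln 2) + cos (t * ln 2) * cos (t * ln 2)) =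
      (c * sin (t * ln 2)) * (c * sin (t * ln 2)) + (c * cos (t * ln 2)) * (c * cos (t * ln 2))) by ring.
    rewrite Q, E2 in H. replace (c * cos (t * ln 2)) with 1 in H by lra. lra. }
  unfold Cdiv. rewrite Cmult_assoc, Gamma_eta_half.
  assert (Hs := tame_shift zker (ln 2) tame_zker).
  destruct (Fourier_lin (- c) zker (fun u => zker (u + ln 2)) t tame_zker Hs) as [H1 H2].
  destruct (Fourier_shift zker (ln 2) t tame_zker) as [H3 H4].
  assert (E : (Fcos eker t, Fsin eker t) = Cmult (Fcos zker t, Fsin zker t) (1 - c * cos (t * ln 2), c * sin (t * ln 2))).
  { replace (Fcos eker t) with (Fcos (fun u => zker u + - c * zker (u + ln 2)) t)
      by (apply intR_ext; intros; rewrite eker_zker; fold c; ring).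
    replace (Fsin eker t) with (Fsin (fun u => zker u + - c * zker (u + ln 2)) t)
      by (apply intR_ext; intros; rewrite eker_zker; fold c; ring).
    rewrite H1, H2, H3, H4. unfold Cmult. simpl fst; simpl snd. f_equal; ring. }
  rewrite E, <- Cmult_assoc, Cinv_r, Cmult_1_r by exact Hn. reflexivity.
Qed.

(** * The moment formula *)

(* The n-th derivative of [zker], by Leibniz and [(d/du)^i psi_0 = sum_k S(i,k) psi_k]. *)
Definition zder (n : nat) (u : R) : R :=
  bsum (S n) (fun i => Binomial.C n i *
    (Sfun i (fun k => psi k u) * ((/ 2) ^ (n - i) * exp (u / 2)))).

Lemma zder_dseq : dseq (fun _ => True) zder.
Proof.
  apply (dseq_mult _ (fun n u => Sfun n (fun k => psi k u)) (fun n u => (/ 2) ^ n * exp (u / 2))).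
  - intros n u _. rewrite Sfun_S. apply (is_derive_bsum (S n) (fun k u => INR (stirling2 n k) * psi k u)).
    intros k _. apply is_derive_scal, psi_derive.
  - intros n u _. auto_derive; [trivial|]. simpl. unfold Rdiv. field.
Qed.

Lemma zder_0 u : zder 0 u = zker u.
Proof. unfold zder, zker, Sfun, Binomial.C. simpl. field. Qed.

Lemma tame_zder n : tame (zder n).
Proof.
  unfold zder. apply tame_bsum. intros i _.
  apply (tame_ext (fun u => Binomial.C n i * (/ 2) ^ (n - i) *
    bsum (S i) (fun k => INR (stirling2 i k) * (exp (u / 2) * psi k u)))).
  - intros u. unfold Sfun. rewrite !Rmult_assoc. f_equal.
    rewrite (Rmult_comm (bsum _ _)), Rmult_assoc. f_equal.
    rewrite <- bsum_scal. apply bsum_ext. intros; ring.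
  - apply tame_scal, tame_bsum. intros k _. apply tame_scal, tame_exp_half_psi.
Qed.

Lemma zder_derive n u : is_derive (zder n) u (zder (S n) u).
Proof. apply zder_dseq. exact I. Qed.

Lemma Fourier_zder n t :
  Fcos (zder n) t ^ 2 + Fsin (zder n) t ^ 2 = t ^ (2 * n) * (Fcos zker t ^ 2 + Fsin zker t ^ 2).
Proof.
  induction n as [|n IH].
  - replace (Fcos (zder 0) t) with (Fcos zker t) by (apply intR_ext; intros; rewrite zder_0; reflexivity).
    replace (Fsin (zder 0) t) with (Fsin zker t) by (apply intR_ext; intros; rewrite zder_0; reflexivity).
    simpl. ring.
  - destruct (Fourier_derive (zder n) (zder (S n)) t (zder_derive n) (tame_zder n) (tame_zder (S n))) as [H1 H2].
    rewrite H1, H2. replace (2 * S n)%nat with (2 + 2 * n)%nat by lia. rewrite pow_add.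
    transitivity (t ^ 2 * (Fcos (zder n) t ^ 2 + Fsin (zder n) t ^ 2)); [ring|]. rewrite IH. ring.
Qed.

Lemma tame_mult k1 k2 : tame k1 -> tame k2 -> tame (fun u => k1 u * k2 u).
Proof.
  intros [Hc [C Hd]] H2. apply (tame_bounded_mult _ _ C); [easy|apply decay_le, Hd|easy].
Qed.

Lemma intR_zder_parts n m :
  intR (fun u => zder (S n) u * zder m u) = - intR (fun u => zder n u * zder (S m) u).
Proof.
  assert (H : intR (fun u => zder (S n) u * zder m u + zder n u * zder (S m) u) = 0).
  { apply (intR_derive_tame (fun u => zder n u * zder m u)).
    - intros u. apply is_derive_mul; [apply zder_derive|apply zder_derive].
    - apply cont_plus; apply cont_mult; apply tame_zder.
    - apply tame_mult; apply tame_zder. }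
  rewrite intR_plus in H by (apply tame_mult; apply tame_zder). lra.
Qed.

Lemma intR_zder_sqr n :
  intR (fun u => zder n u ^ 2) = (-1) ^ n * intR (fun u => zder 0 u * zder (2 * n) u).
Proof.
  assert (H : forall j m, intR (fun u => zder j u * zder m u)
     = (-1) ^ j * intR (fun u => zder 0 u * zder (m + j) u)).
  { induction j as [|j IH]; intros m.
    - rewrite Nat.add_0_r. simpl. ring.
    - rewrite intR_zder_parts, IH. replace (S m + j)%nat with (m + S j)%nat by lia. simpl. ring. }
  rewrite (intR_ext _ (fun u => zder n u * zder n u)) by (intros; ring).
  rewrite H. replace (n + n)%nat with (2 * n)%nat by lia. reflexivity.
Qed.

Definition moment (k : nat) : R := intR (fun u => exp u * psi k u * psi 0 u).

(** The two factors [exp (u / 2)] combine to [exp u], and [2^M] clears the powers of [1/2] left by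
    the Leibniz rule: this is [(1 + 2 x d/dx)^M] expanded binomially. *)
Lemma intR_zder_0 M :
  2 ^ M * intR (fun u => zder 0 u * zder M u)
  = bsum (S M) (fun n => Binomial.C M n * (2 ^ n * Sfun n moment)).
Proof.
  rewrite (intR_ext _ (fun u => bsum (S M) (fun n => Binomial.C M n * (/ 2) ^ (M - n) *
    bsum (S n) (fun k => INR (stirling2 n k) * (exp u * psi k u * psi 0 u))))).
  - rewrite (intR_bsum (S M) (fun n u => Binomial.C M n * (/ 2) ^ (M - n) *
      bsum (S n) (fun k => INR (stirling2 n k) * (exp u * psi k u * psi 0 u)))).
    2:{ intros n _. apply tame_scal, tame_bsum. intros k _. apply tame_scal, tame_exp_psi_psi. }
    rewrite <- bsum_scal. apply bsum_ext. intros n Hn.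
    rewrite intR_scal by (apply tame_bsum; intros k _; apply tame_scal, tame_exp_psi_psi).
    rewrite (intR_bsum (S n) (fun k u => INR (stirling2 n k) * (exp u * psi k u * psi 0 u)))
      by (intros k _; apply tame_scal, tame_exp_psi_psi).
    replace (Sfun n moment) with (bsum (S n) (fun k => intR (fun u => INR (stirling2 n k) * (exp u * psi k u * psi 0 u)))).
    2:{ apply bsum_ext. intros k _. rewrite intR_scal by apply tame_exp_psi_psi. reflexivity. }
    replace (2 ^ M) with (2 ^ n * 2 ^ (M - n)) by (rewrite <- pow_add; f_equal; lia).
    rewrite pow_inv. field. apply pow_nonzero. lra.
  - intros u. rewrite zder_0. unfold zder, zker. rewrite <- bsum_scal. apply bsum_ext. intros n Hn.
    unfold Sfun.
    transitivity (Binomial.C M n * (/ 2) ^ (M - n) * ((exp (u / 2) * exp (u / 2)) * psi 0 u *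
       bsum (S n) (fun k => INR (stirling2 n k) * psi k u))); [ring|].
    rewrite exp_half, <- bsum_scal. f_equal. apply bsum_ext. intros; ring.
Qed.

Lemma binom_absorb_S k r : (S r * binom (S k) (S r) = S k * binom k r)%nat.
Proof.
  assert (H := binom_absorb k r). change (binom (S k) (S r)) with (binom k r + binom k (S r))%nat. nia.
Qed.

(** Up to [(-1)^k k!], the coefficient of [B_{j+2} zeta(j+2)] in the moment of order [k]. The
    subtracted 1 removes [k = j + 1], where the binomial is 1 but the convolution formula has no
    term; it gives the second Stirling number in [T]. *)
Definition zcoef (j : nat) (k : nat) : R :=
  (INR (binom k (S j)) - (if Nat.eqb k (S j) then 1 else 0)) / INR (S (S j)).

Lemma Sfun_alt_delta n m :
  Sfun n (alt (fun k => if Nat.eqb k m then 1 else 0)) = (-1) ^ m * INR (fact m) * INR (stirling2 n m).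
Proof.
  unfold Sfun, alt.
  assert (H : forall p, bsum p (fun k => INR (stirling2 n k) * ((-1) ^ k * INR (fact k) * (if Nat.eqb k m then 1 else 0)))
    = if Nat.ltb m p then (-1) ^ m * INR (fact m) * INR (stirling2 n m) else 0).
  { induction p as [|p IH]; [reflexivity|].
    change (bsum (S p) ?F) with (bsum p F + F p). cbv beta. rewrite IH.
    destruct (Nat.eqb_spec p m) as [->|Hn].
    - rewrite Nat.ltb_irrefl. replace (Nat.ltb m (S m)) with true by (symmetry; apply Nat.ltb_lt; lia). ring.
    - destruct (Nat.ltb_spec m p), (Nat.ltb_spec m (S p)); try lia; ring. }
  rewrite H. destruct (Nat.ltb_spec m (S n)); [reflexivity|].
  rewrite stirling2_gt by lia. simpl. ring.
Qed.

Lemma Sfun_zcoef n j :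
  Sfun n (alt (zcoef j)) = INR (fact (S j)) / INR (S (S j)) *
    ((-1) ^ n * INR (stirling2 (S n) (S (S j))) + (-1) ^ S (S j) * INR (stirling2 n (S j))).
Proof.
  rewrite (Sfun_alt_ext n _ (fun k => / INR (S (S j)) * (INR (binom k (S j)) +
     -1 * (if Nat.eqb k (S j) then 1 else 0)))) by (intros; unfold zcoef, Rdiv; ring).
  rewrite Sfun_alt_scal, Sfun_alt_plus, Sfun_alt_scal, Sfun_alt_binom, Sfun_alt_delta.
  simpl pow. unfold Rdiv. ring.
Qed.

Definition zval (i : nat) : R := Bernoulli (S (S i)) * Re (zeta (INR (S (S i)), 0)).

(** The sum runs to a common bound [M], the extra [zcoef] being 0, so that it can be exchanged with
    the Stirling sum. At [k = 0], [/ INR 0 = 0] makes the general expression [intR kappa - 1/2]; the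
    missing [intR kappa] is added apart. *)
Lemma moment_eq k M : (k <= M)%nat ->
  moment k = alt (fun k => intR kappa + - / 2 * / INR (S k) + / 2 * / INR k + - / 2 * harm k) k
    + (if k then intR kappa else 0) + bsum (M - 1) (fun i => alt (zcoef i) k * zval i).
Proof.
  intros HM. unfold moment. destruct k as [|k].
  - rewrite J_0. rewrite bsum_zero.
    + unfold alt, harm. simpl. rewrite Rinv_0. field.
    + intros i _. unfold alt, zcoef. simpl. unfold Rdiv. ring.
  - rewrite J_S by lia.
    replace (M - 1)%nat with ((S k - 1) + (M - S k))%nat by lia. rewrite bsum_app.
    rewrite (bsum_zero (M - S k)).
    2:{ intros i Hi. unfold alt, zcoef.
        destruct (Nat.eqb_spec (S k) (S (S k - 1 + i))) as [E|E].
        - rewrite <- E, binom_diag. simpl (INR 1). unfold Rdiv. rewrite Rminus_diag. ring.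
        - rewrite binom_gt by lia. simpl (INR 0). unfold Rdiv. rewrite Rminus_diag. ring. }
    rewrite !Rplus_0_r. f_equal.
    + unfold alt. assert (H1 : INR (S k) <> 0) by (apply not_0_INR; lia).
      assert (H2 : INR (S (S k)) <> 0) by (apply not_0_INR; lia). field. easy.
    + apply bsum_ext. intros i Hi. unfold alt, zcoef, zval. rewrite zeta_nat.
      destruct (Nat.eqb_spec (S k) (S i)) as [E|E]; [lia|].
      replace (i + 2)%nat with (S (S i)) by lia.
      rewrite <- binom_C by lia.
      assert (H := binom_absorb_S (S k) (S i)). apply (f_equal INR) in H. rewrite !mult_INR in H.
      assert (H1 : INR (S (S i)) <> 0) by (apply not_0_INR; lia).
      assert (H2 : INR (S (S k)) <> 0) by (apply not_0_INR; lia).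
      assert (H3 := INR_fact_neq_0 (S i)).
      replace (INR (binom (S (S k)) (S (S i)))) with (INR (S (S k)) * INR (binom (S k) (S i)) / INR (S (S i)))
        by (rewrite <- H; field; easy).
      field. repeat split; easy.
Qed.

Lemma Sfun_bsum n m (c : nat -> nat -> R) :
  Sfun n (fun k => bsum m (fun i => c i k)) = bsum m (fun i => Sfun n (c i)).
Proof.
  unfold Sfun. rewrite bsum_switch. apply bsum_ext. intros k _. rewrite <- bsum_scal. reflexivity.
Qed.

Lemma T_bsum M j : (2 <= M)%nat ->
  T M (S (S j)) / INR (S (S j)) = bsum (S M) (fun n => Binomial.C M n * (2 ^ n * Sfun n (alt (zcoef j)))).
Proof.
  intros HM. unfold T. rewrite sumR_bsum.
  replace (S M) with (2 + (S M - 2))%nat at 2 by lia. rewrite bsum_app.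
  rewrite (bsum_zero 2).
  - rewrite Rplus_0_l. replace (S (S j) - 1)%nat with (S j) by lia.
    match goal with |- ?f * ?s / ?d = _ => transitivity (f / d * s); [unfold Rdiv; ring|] end.
    rewrite <- bsum_scal.
    apply bsum_ext. intros i _. rewrite Sfun_zcoef. unfold Rdiv. ring.
  - intros i Hi. rewrite Sfun_zcoef. destruct i as [|[|i]]; [| |lia].
    + rewrite !stirling2_gt by lia. simpl (INR 0). ring.
    (* [T] starts at [n = 2]. At [n = 1] and lowest index the bracket is [- S(2,2) + S(1,1) = 0];
       for higher indices both Stirling numbers vanish. *)
    + destruct j as [|j]; [simpl; ring|]. rewrite !stirling2_gt by lia. simpl (INR 0). ring.
Qed.

(** The sequence 1 and the correction at [k = 0] each contribute one [intR kappa], together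
    [ln (2 PI) - gamma]. The sequences [1/k] and [harm] contribute [-2N] each, [1/(k+1)] the
    Bernoulli term, and [zcoef] the sum with [T]. The evenness of [M] enters through
    [(1 - 2)^M = 1]. *)
Lemma sum_moments N :
  bsum (S (2 * N)) (fun n => Binomial.C (2 * N) n * (2 ^ n * Sfun n moment)) =
  ln (2 * PI) - euler_gamma - 4 * INR N + (4 ^ N / 2 - 1) * Bernoulli (2 * N)
  + sumR 2 (2 * N) (fun j => T (2 * N) j * Re (zeta (INR j, 0)) * Bernoulli j / INR j).
Proof.
  set (M := (2 * N)%nat). set (K := intR kappa).
  rewrite (bsum_ext (S M) _ (fun n =>
    K * (Binomial.C M n * (-2) ^ n) + - / 2 * (Binomial.C M n * (2 ^ n * Bernoulli n))
    + / 2 * (Binomial.C M n * (2 ^ n * Sfun n (alt (fun k => / INR k))))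
    + - / 2 * (Binomial.C M n * ((-2) ^ n * INR n))
    + Binomial.C M n * (2 ^ n * (if n then K else 0))
    + bsum (M - 1) (fun i => zval i * (Binomial.C M n * (2 ^ n * Sfun n (alt (zcoef i))))))).
  2:{ intros n Hn.
      rewrite (Sfun_ext n moment _ (fun k Hk => moment_eq k M ltac:(lia))). fold K.
      rewrite !Sfun_plus, !Sfun_bsum.
      rewrite (Sfun_ext n (fun k => alt _ k) (alt (fun k => (K * 1 + - / 2 * / INR (S k)) + / 2 * / INR k + - / 2 * harm k)))
        by (intros; unfold alt; ring).
      rewrite !Sfun_alt_plus, !Sfun_alt_scal, Sfun_alt_1, Sfun_alt_harm.
      rewrite (Sfun_alt_bernoulli Bernoulli Bernoulli_0 Bernoulli_rec).
      assert (H0 : Sfun n (fun k => if k then K else 0) = if n then K else 0).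
      { unfold Sfun. rewrite bsum_head, bsum_zero by (intros; ring). destruct n; simpl; ring. }
      rewrite H0. replace ((-2) ^ n) with ((-1) ^ n * 2 ^ n) by (rewrite <- Rpow_mult_distr; f_equal; ring).
      rewrite (bsum_ext (M - 1) _ (fun i => zval i * Sfun n (alt (zcoef i)))).
      2:{ intros i _. rewrite <- Sfun_scal. apply Sfun_ext. intros; ring. }
      rewrite (bsum_ext (M - 1) (fun i => zval i * (_ * _)) (fun i => (Binomial.C M n * 2 ^ n) * (zval i * Sfun n (alt (zcoef i)))))
        by (intros; ring).
      rewrite bsum_scal. ring. }
  rewrite !bsum_plus, !bsum_scal, bsum_binom_pow, Bernoulli_double.
  rewrite bsum_switch.
  assert (HI : bsum (S M) (fun n => Binomial.C M n * (2 ^ n * Sfun n (alt (fun k => / INR k)))) = -2 * INR M).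
  { destruct N as [|N].
    - unfold M. simpl. rewrite Sfun_alt_inv. simpl. rewrite Rinv_0. ring.
    - unfold M. replace (2 * S N)%nat with (S (S (2 * N))) by lia.
      rewrite !bsum_head, bsum_zero by (intros; rewrite Sfun_alt_inv; ring).
      rewrite !Sfun_alt_inv. simpl (INR 0). rewrite Rinv_0.
      rewrite <- (binom_C _ 1), binom_1 by lia. ring. }
  rewrite HI.
  assert (HE : (1 + -2) ^ M = 1).
  { unfold M. rewrite pow_mult. replace ((1 + -2) ^ 2) with 1 by ring. apply pow1. }
  assert (HN := bsum_binom_pow_n M (-2)). rewrite HE in HN.
  assert (HK : bsum (S M) (fun n => Binomial.C M n * (2 ^ n * (if n then K else 0))) = K).
  { rewrite bsum_head, bsum_zero by (intros; ring). rewrite <- binom_C by lia.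
    destruct M; simpl; ring. }
  rewrite HK, HE.
  assert (HM : INR M = 2 * INR N) by (unfold M; rewrite mult_INR; simpl; ring).
  assert (H4 : 2 ^ M = 4 ^ N).
  { unfold M. rewrite pow_mult. f_equal. ring. }
  replace (ln (2 * PI) - euler_gamma) with (2 * K) by (unfold K; rewrite intR_kappa; field).
  rewrite H4. rewrite HM in *.
  replace (bsum (S M) (fun i => Binomial.C M i * ((-2) ^ i * INR i))) with (2 * (2 * INR N)) by lra.
  assert (HT : bsum (M - 1) (fun j => bsum (S M) (fun i => zval j * (Binomial.C M i * (2 ^ i * Sfun i (alt (zcoef j))))))
    = sumR 2 M (fun j => T M j * Re (zeta (INR j, 0)) * Bernoulli j / INR j)).
  { rewrite sumR_bsum. replace (S M - 2)%nat with (M - 1)%nat by lia.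
    apply bsum_ext. intros i Hi. rewrite bsum_scal, <- T_bsum by lia. unfold zval, Rdiv.
    replace (2 + i)%nat with (S (S i)) by lia. ring. }
  rewrite HT. field.
Qed.

Theorem theorem1 (N : nat) :
  exists I : R,
    is_RInt_gen
      (fun t : R => t ^ (2 * N) *
         (Cmod (Cmult (Gamma (/ 2, t)) (zeta (/ 2, t)))) ^ 2)
      (Rbar_locally m_infty) (Rbar_locally p_infty) I /\
    (-4) ^ N / (2 * PI) * I =
      ln (2 * PI) - euler_gamma - 4 * INR N
      + (4 ^ N / 2 - 1) * Bernoulli (2 * N)
      + sumR 2 (2 * N) (fun j =>
          T (2 * N) j * Re (zeta (INR j, 0)) * Bernoulli j / INR j).
Proof.
  (* The Fourier transform of the N-th derivative of [zker] carries the factor [t^N] in modulus,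
     which supplies the weight [t^(2N)]. *)
  exists (2 * PI * intR (fun u => zder N u ^ 2)). split.
  - apply (is_RInt_gen_ext (fun t => Fcos (zder N) t ^ 2 + Fsin (zder N) t ^ 2)).
    + apply filter_forall. intros ab t _.
      rewrite Fourier_zder, Gamma_zeta_half. unfold Cmod. simpl fst; simpl snd.
      rewrite pow2_sqrt; [reflexivity|]. apply Rplus_le_le_0_compat; apply pow2_ge_0.
    + apply (plancherel _ (zder (S N)) (zder_derive N) (tame_zder N) (tame_zder (S N))).
  - rewrite <- sum_moments, <- intR_zder_0, intR_zder_sqr.
    (* The sign [(-1)^N] comes from moving [N] derivatives onto one factor, and [2^(2N)] from
       clearing the halves; this explains [(-4)^N]. *)
    replace (2 ^ (2 * N)) with ((-4) ^ N * (-1) ^ N).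
    + field. apply PI_neq0.
    + rewrite <- Rpow_mult_distr, pow_mult. f_equal. ring.
Qed.
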